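(* Let $d\ge 3$ and let $P$ be a cubical $d$-polytope whose graph $G(P)$ has minimum degree $\delta$. Then $G(P)$ is $\min\{\delta,2d-2\}$-connected. Furthermore, if $d\ge 4$, then for every cubical $d$-polytope $P$ and every minimum separator $X$ of $P$ of cardinality at most $2d-3$, the set $X$ consists of all the neighbours of some vertex $w$ of $G(P)$, and the subgraph $G(P)-X$ has exactly two components, one of them being the single vertex $w$ itself.
   Context: A cube is any polytope combinatorially equivalent to a standard cube (i.e. its face lattice is isomorphic to the face lattice of a standard cube). A cubical $d$-polytope is a $d$-dimensional (convex) polytope all of whose facets are ($(d-1)$-dimensional) cubes. The graph $G(P)$ of a polytope $P$ is the graph formed by its vertices and edges (1-dimensional faces); degrees, neighbours and connectivity refer to $G(P)$. A graph is $k$-connected if it has more than $k$ vertices and removing any set of fewer than $k$ vertices leaves a connected graph. A separator of $P$ is a set of vertices of $P$ whose removal disconnects $G(P)$; a minimum separator is a separator of smallest cardinality. For a set $X$ of vertices of a graph $G$, $G-X$ is the subgraph of $G$ induced by the vertices not in $X$. *)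

(* Defs.v *)
From HB Require Import structures.
From mathcomp Require Import all_boot all_order all_algebra finmap.
From mathcomp Require Import boolp classical_sets functions cardinality reals.

Set Implicit Arguments.
Unset Strict Implicit.
Unset Printing Implicit Defensive.

Import Order.TTheory GRing.Theory Num.Theory.

Local Open Scope classical_set_scope.
Local Open Scope ring_scope.

Section Polytopes.
Variable R : realType.

Definition conv_hull n (S : set 'rV[R]_n) : set 'rV[R]_n :=
  [set x | exists (m : nat) (a : 'I_m -> R) (v : 'I_m -> 'rV[R]_n),
    [/\ forall i, S (v i), forall i, 0 <= a i, \sum_i a i = 1
      & x = \sum_i a i *: v i]].

Definition aff_hull n (S : set 'rV[R]_n) : set 'rV[R]_n :=
  [set x | exists (m : nat) (a : 'I_m -> R) (v : 'I_m -> 'rV[R]_n),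
    [/\ forall i, S (v i), \sum_i a i = 1 & x = \sum_i a i *: v i]].

(* The affine hull of S is a translate of a k-dimensional linear subspace;
   the empty set, usually given dimension -1, has no dimension here. *)
Definition has_dim n (S : set 'rV[R]_n) (k : nat) : Prop :=
  exists (x0 : 'rV[R]_n) (U : {vspace 'rV[R]_n}),
    \dim U = k /\ aff_hull S = [set x | x - x0 \in U].

Definition polytope n (P : set 'rV[R]_n) : Prop :=
  exists V : set 'rV[R]_n, finite_set V /\ P = conv_hull V.

(* Faces are cut out by valid linear inequalities; taking c = 0 with b = 0 or
   b = 1 shows that P itself and set0 are among them. *)
Definition face n (P F : set 'rV[R]_n) : Prop :=
  exists (c : 'rV[R]_n) (b : R),
    (forall x, P x -> \sum_i c 0 i * x 0 i <= b) /\
    F = P `&` [set x | \sum_i c 0 i * x 0 i = b].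

Definition dim_face n (k : nat) (P F : set 'rV[R]_n) : Prop :=
  face P F /\ has_dim F k.

Definition comb_equiv n m (P : set 'rV[R]_n) (Q : set 'rV[R]_m) : Prop :=
  exists f : set 'rV[R]_n -> set 'rV[R]_m,
    set_bij (face P) (face Q) f /\
    forall F G, face P F -> face P G -> (F `<=` G <-> f F `<=` f G).

Definition std_cube (k : nat) : set 'rV[R]_k :=
  [set x | forall i, 0 <= x 0 i <= 1].

Definition is_cube n (k : nat) (Q : set 'rV[R]_n) : Prop :=
  polytope Q /\ comb_equiv Q (@std_cube k).

(* Used for d >= 3 only, so d.-1 is not truncated. The ambient dimension n may
   exceed d. *)
Definition cubical_polytope n (d : nat) (P : set 'rV[R]_n) : Prop :=
  [/\ polytope P, has_dim P d
    & forall F, dim_face d.-1 P F -> is_cube d.-1 F].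

(* A polytope has finitely many vertices, so fset_set does not take its default
   value (the empty set) on the sets of interest. *)
Definition vertices n (P : set 'rV[R]_n) : {fset 'rV[R]_n} :=
  fset_set [set v | face P [set v]].

(* An edge contains exactly two vertices of P, its endpoints. *)
Definition adj n (P : set 'rV[R]_n) : rel (vertices P) :=
  fun u v => (u != v) && `[< exists2 E, dim_face 1 P E & E (val u) /\ E (val v) >].

End Polytopes.

(* A finite graph is given by a finite type of vertices and its adjacency
   relation, symmetric and irreflexive in the case of polytope graphs. *)
Section Graphs.
Variables (T : finType) (e : rel T).

Definition neighbours (v : T) : {set T} := [set u | e v u].

Definition is_min_degree (delta : nat) : Prop :=
  (exists v, #|neighbours v| = delta) /\
  (forall v, (delta <= #|neighbours v|)%N).

(* Adjacency in G - X, whose vertex set is ~: X. *)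
Definition del (X : {set T}) : rel T :=
  fun u v => [&& u \notin X, v \notin X & e u v].

Definition components (X : {set T}) : {set {set T}} :=
  equivalence_partition (connect (del X)) (~: X).

Definition connected_del (X : {set T}) : Prop :=
  forall u v, u \notin X -> v \notin X -> connect (del X) u v.

Definition k_connected (k : nat) : Prop :=
  (k < #|T|)%N /\ forall X : {set T}, (#|X| < k)%N -> connected_del X.

Definition separator (X : {set T}) : Prop := ~ connected_del X.

Definition min_separator (X : {set T}) : Prop :=
  separator X /\ forall Y, separator Y -> (#|X| <= #|Y|)%N.

End Graphs.

Arguments adj {R n} P.

(* Main.v *)
Require Import Defs.
From mathcomp Require Import all_boot all_order all_algebra finmap.
From mathcomp Require Import zify ring lra.
From mathcomp Require Import boolp.

(* Let [k = d - 1], and let [X] be a separator with [#|X| <= 2k - 1] and [#|X|] at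
   most the minimum degree. A facet cannot contain more than [k] vertices of [X]:
   facets other than it are still connected through ridges not contained in it,
   and a cube minus a face minus [k - 2] vertices is connected. Hence in each facet
   [X] either leaves a connected graph or cuts off a single corner. The large
   parts of adjacent facets meet outside [X], with one exception for 3-cubes that
   [#|X| <= 5] excludes, so they lie in one component, and a vertex outside that
   component is a corner of all its facets: its neighbours form [X]. Two such
   vertices would again need more than [2k - 1] neighbours.
   For [d = 3] it suffices that [#|X| <= 2], because a cubical 3-polytope has a
   vertex of degree 3; this follows by counting, for a generic height function,
   the angles of squares at vertices of intermediate height.
   A polytope is handled through the vectors [(1, v)] for its vertices [v]: a face
   is the zero set of a linear functional that is nonnegative on all of them, and
   a facet is a face of corank 1. Facets across ridges are obtained by rotating
   functionals, dual connectivity by the dual simplex method. *)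

Set Implicit Arguments.
Unset Strict Implicit.
Unset Printing Implicit Defensive.

(** * Cubes *)

(** The bound [2 * k - 1], that is [2 * d - 3], acts first on a facet [F] with more than [k]
    vertices of [X]. At most [k - 2] vertices of [X] then lie outside [F], which is what a cube
    minus a face tolerates. A vertex of [F] outside [X] has at least [#|X|] neighbours, exactly [k]
    of them in [F]; so more neighbours leave [F] than [X] has vertices outside [F], and one of them
    escapes [X].

    For [d = 3] ridges are edges, too small for comparing the large parts of adjacent facets. The
    target [minn delta 4] drops to 3 once a vertex of degree 3 is known. The count of mixed angles
    that yields it takes the place of Euler's formula.

    The graph argument sees a polytope only through the record [cubical_lattice], so the geometry
    can be settled separately. Farkas' lemma serves to show that irredundant generators of a
    polytope are its vertices; all other facts about faces come from moving a functional until it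
    vanishes at one more vertex. *)

Section Linked.
Variables (T : finType) (r : rel T).
Hypothesis r_sym : symmetric r.

Definition within (S : {set T}) : rel T :=
  [rel x y | [&& x \in S, y \in S & r x y]].

Definition linked (S : {set T}) := {in S &, forall x y, connect (within S) x y}.

Lemma within_sym S : symmetric (within S).
Proof. by move=> x y; rewrite /within /= r_sym andbCA. Qed.

Lemma linkedC (S : {set T}) x y : connect (within S) x y = connect (within S) y x.
Proof. exact: (sym_connect_sym (within_sym S)). Qed.

Lemma connect_within (S S' : {set T}) x y :
  S \subset S' -> connect (within S) x y -> connect (within S') x y.
Proof.
move=> sSS'; apply: connect_sub => u v /and3P[uS vS ruv].
by apply: connect1; rewrite /within /= ruv !(subsetP sSS').
Qed.

Lemma linked_sub (S S' : {set T}) x y :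
  linked S -> S \subset S' -> x \in S -> y \in S -> connect (within S') x y.
Proof. by move=> lS sSS' xS yS; apply: connect_within sSS' (lS _ _ xS yS). Qed.

Lemma linked_attach (S S' : {set T}) :
    linked S -> S \subset S' ->
    {in S', forall x, x \notin S -> exists2 y, y \in S & r x y} ->
  linked S'.
Proof.
move=> lS sSS' att.
have reach x : x \in S' -> exists2 y, y \in S & connect (within S') x y.
  move=> xS'; case: (boolP (x \in S)) => [xS|xNS]; first by exists x.
  have [y yS rxy] := att x xS' xNS; exists y => //; apply: connect1.
  by rewrite /within /= xS' rxy (subsetP sSS').
move=> x y /reach[x' x'S cx] /reach[y' y'S cy].
apply: connect_trans cx _; rewrite linkedC in cy; apply: connect_trans _ cy.
exact: linked_sub lS sSS' x'S y'S.
Qed.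

Lemma linked_join (S1 S2 : {set T}) x y :
    linked S1 -> linked S2 -> x \in S1 -> y \in S2 -> r x y ->
  linked (S1 :|: S2).
Proof.
move=> l1 l2 xS1 yS2 rxy.
have cxy : connect (within (S1 :|: S2)) x y.
  by apply: connect1; rewrite /within /= rxy !inE xS1 yS2 orbT.
have reach z : z \in S1 :|: S2 -> connect (within (S1 :|: S2)) z x.
  case/setUP=> zS; first exact: linked_sub l1 (subsetUl _ _) zS xS1.
  rewrite linkedC; apply: connect_trans cxy _.
  exact: linked_sub l2 (subsetUr _ _) yS2 zS.
move=> u v /reach cu /reach cv; apply: connect_trans cu _.
by rewrite linkedC.
Qed.

Lemma linked1 x : linked [set x].
Proof. by move=> u v /set1P-> /set1P->. Qed.

End Linked.

(** The map goes against the transfer, from [S'] back to [S], because the label of a facet goes into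
    the cube; paths are lifted edge by edge. *)
Lemma linked_transfer (T U : finType) (r : rel T) (r' : rel U) (f : U -> T)
    (S : {set T}) (S' : {set U}) :
    {in S, forall x, exists2 u, u \in S' & f u = x} ->
    {in S', forall u, f u \in S} ->
    {in S' &, injective f} ->
    {in S' &, forall u v, r (f u) (f v) -> r' u v} ->
  linked r S -> linked r' S'.
Proof.
move=> fS' fS finj fr lS u v uS' vS'.
have /connectP[p] := lS _ _ (fS u uS') (fS v vS').
elim: p u uS' => [|x p IHp] u uS' /=.
  by move=> _ /finj-> //; apply: connect0.
case/andP=> /and3P[_ xS rux] px ev.
have [w wS' fw] := fS' x xS; rewrite -fw in px ev rux.
apply: connect_trans (IHp w wS' px ev); apply: connect1.
by rewrite /within /= uS' wS' fr.
Qed.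

(** * The [k]-cube on boolean words: subcubes and connectivity *)

Section Cube.
Variable k : nat.
Notation Q := {ffun 'I_k -> bool}.
Implicit Types (x y e : Q) (A : {set 'I_k}) (X Y : {set Q}).

Definition flip (i : 'I_k) x : Q := [ffun j => x j (+) (j == i)].

Definition cube_adj : rel Q := fun x y => [exists i, y == flip i x].

(** These are the nonempty faces of the cube; [A] is the set of free directions. *)
Definition subcube A e : {set Q} :=
  [set x : Q | [forall i, (i \notin A) ==> (x i == e i)]].

Lemma subcubeP A e x :
  reflect (forall i, i \notin A -> x i = e i) (x \in subcube A e).
Proof.
rewrite inE; apply: (iffP forallP) => H i; first by move=> iA; apply/eqP/(implyP (H i)).
by apply/implyP=> /H->.
Qed.

Lemma flipK i : involutive (flip i).
Proof. by move=> x; apply/ffunP=> j; rewrite !ffunE addbK. Qed.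

Lemma flip_inj i : injective (flip i).
Proof. exact: inv_inj (flipK i). Qed.

Lemma flip_neq i x : flip i x != x.
Proof. by apply/eqP=> /ffunP/(_ i); rewrite ffunE eqxx addbT; case: (x i). Qed.

Lemma flip_injl x : injective (flip^~ x).
Proof.
move=> i j /ffunP/(_ i); rewrite !ffunE eqxx.
by case: (x i); case: eqP.
Qed.

Lemma cube_adj_flip i x : cube_adj x (flip i x).
Proof. by apply/existsP; exists i. Qed.

Lemma cube_adj_sym : symmetric cube_adj.
Proof.
by move=> x y; apply/existsP/existsP=> -[i /eqP->]; exists i; rewrite flipK.
Qed.

Lemma cube_adjP x y : reflect (exists i, y = flip i x) (cube_adj x y).
Proof. by apply: (iffP existsP) => -[i /eqP]; exists i => //; apply/eqP. Qed.

Lemma subcube_refl A e : e \in subcube A e.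
Proof. exact/subcubeP. Qed.

Lemma subcubeT e : subcube [set: 'I_k] e = [set: Q].
Proof. by apply/setP=> x; rewrite in_setT; apply/subcubeP=> i; rewrite in_setT. Qed.

Lemma subcube0 e : subcube set0 e = [set e].
Proof.
apply/setP=> x; rewrite in_set1; apply/subcubeP/eqP=> [H|-> //].
by apply/ffunP=> i; apply: H; rewrite in_set0.
Qed.

Lemma subcube_half A i e x : i \in A ->
  (x \in subcube A e) = (x \in subcube (A :\ i) e) || (x \in subcube (A :\ i) (flip i e)).
Proof.
move=> iA; apply/subcubeP/orP=> [H|[]/subcubeP H j jA].
- have [xi|xi] := eqVneq (x i) (e i).
    left; apply/subcubeP=> j; rewrite !inE negb_and negbK => /orP[/eqP->//|].
    exact: H.
  right; apply/subcubeP=> j; rewrite !inE negb_and negbK ffunE => /orP[/eqP->|].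
    by rewrite eqxx; move: xi; case: (x i); case: (e i).
  move=> jA; rewrite (negPf (contraNneq _ jA)) ?addbF ?H // => -> //.
- by apply: H; rewrite !inE negb_and jA orbT.
- rewrite H ?ffunE ?(negPf (contraNneq _ jA)) ?addbF // => [->//|].
  by rewrite !inE negb_and jA orbT.
Qed.

Lemma subcube_flip A i e x :
  i \in A -> (flip i x \in subcube (A :\ i) (flip i e)) = (x \in subcube (A :\ i) e).
Proof.
move=> iA; apply/subcubeP/subcubeP=> H j /H; rewrite !ffunE; last by move->.
exact: addIb.
Qed.

Lemma subcube_disj A i e x :
  i \in A -> x \in subcube (A :\ i) e -> x \notin subcube (A :\ i) (flip i e).
Proof.
move=> iA /subcubeP H; apply/subcubeP=> /(_ i); rewrite H !inE ?eqxx // ffunE eqxx.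
by case: (e i) => /(_ isT).
Qed.

Lemma subcube_flipE A i e :
  i \in A -> subcube (A :\ i) (flip i e) = flip i @: subcube (A :\ i) e.
Proof.
move=> iA; apply/setP=> x; rewrite -[x](flipK i) subcube_flip //.
by rewrite mem_imset //; apply: flip_inj.
Qed.

Lemma subcube_split A i e : i \in A ->
  subcube A e = subcube (A :\ i) e :|: subcube (A :\ i) (flip i e).
Proof. by move=> iA; apply/setP=> x; rewrite in_setU -subcube_half. Qed.

Lemma subcube_disjI A i e : i \in A ->
  subcube (A :\ i) e :&: subcube (A :\ i) (flip i e) = set0.
Proof.
move=> iA; apply/setP=> x; rewrite in_set0 in_setI; apply/negbTE/andP=> -[x0].
by apply/negP; apply: subcube_disj x0.
Qed.

Lemma card_subcube A e : #|subcube A e| = 2 ^ #|A|.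
Proof.
have [n] := ubnP #|A|; elim: n => // n IHn in A e *; rewrite ltnS => leAn.
have [->|[i iA]] := set_0Vmem A; first by rewrite subcube0 cards1 cards0.
have cA := cardsD1 i A; rewrite iA add1n in cA.
rewrite (subcube_split e iA) cardsU (subcube_disjI e iA) cards0 subn0 subcube_flipE //.
rewrite card_imset; last exact: flip_inj.
by rewrite IHn ?cA ?expnS ?mul2n ?addnn // -ltnS -cA.
Qed.

Lemma ex_notin (T : finType) (S D : {set T}) :
  #|D| < #|S| -> exists2 x, x \in S & x \notin D.
Proof.
move=> lDS; apply/exists_inP; apply: contraLR lDS; rewrite negb_exists_in -leqNgt.
by move/forall_inP=> H; apply/subset_leq_card/subsetP=> x /H; rewrite negbK.
Qed.

(** Every vertex of the other half has its partner in direction [i] in the half that [X] misses. *)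
Lemma subcube_half_linked A i e X :
    i \in A -> linked cube_adj (subcube (A :\ i) e :\: X) ->
    subcube (A :\ i) e :&: X = set0 ->
  linked cube_adj (subcube A e :\: X).
Proof.
move=> iA l0 X0; apply: (linked_attach cube_adj_sym l0) => [|x].
  by rewrite (subcube_split e iA); apply: setSD; apply: subsetUl.
rewrite in_setD (subcube_half e x iA) => /andP[xX /orP[x0|x1]].
  by rewrite in_setD xX x0.
move=> _; exists (flip i x); last exact: cube_adj_flip.
have fx0 : flip i x \in subcube (A :\ i) e by rewrite -(subcube_flip e (flip i x) iA) flipK.
rewrite in_setD fx0 andbT; apply/negP=> fX.
by have := in_set0 (flip i x); rewrite -X0 in_setI fx0 fX.
Qed.

Lemma subcube_halves_linked A i e X :
    i \in A -> linked cube_adj (subcube (A :\ i) e :\: X) ->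
    linked cube_adj (subcube (A :\ i) (flip i e) :\: X) ->
    #|subcube A e :&: X| < 2 ^ #|A :\ i| ->
  linked cube_adj (subcube A e :\: X).
Proof.
move=> iA l0 l1 lX.
(* [D] marks the vertices of the first half whose edge in direction [i] meets [X]; they are too few
   to fill the half. *)
set D := (subcube (A :\ i) e :&: X) :|: flip i @: (subcube (A :\ i) (flip i e) :&: X).
have [x x0] : exists2 x, x \in subcube (A :\ i) e & x \notin D.
  apply: ex_notin; rewrite card_subcube; apply: leq_ltn_trans lX.
  rewrite (leq_trans (leq_card_setU _ _)) // card_imset; last exact: flip_inj.
  rewrite (subcube_split e iA) setIUl cardsU setIACA (subcube_disjI e iA) set0I cards0.
  by rewrite subn0.
have x1 : flip i x \in subcube (A :\ i) (flip i e) by rewrite subcube_flip.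
rewrite in_setU in_setI x0 -{2}[x](flipK i) mem_imset; last exact: flip_inj.
rewrite in_setI x1 /= => /norP[xX fX].
rewrite (subcube_split e iA) setDUl.
apply: (linked_join cube_adj_sym l0 l1 _ _ (cube_adj_flip i x)).
  by rewrite in_setD xX.
by rewrite in_setD fX.
Qed.

(** An [n]-cube is [n]-connected. If [X] meets both halves in some direction, each half contains
    fewer than [n - 1] of its vertices and induction applies; if it misses one half, the other
    attaches to that one. *)
Lemma subcube_linked A e X :
  #|subcube A e :&: X| < #|A| -> linked cube_adj (subcube A e :\: X).
Proof.
have [n] := ubnP #|A|; elim: n => // n IHn in A e *; rewrite ltnS => leAn lX.
have [A0|[i iA]] := set_0Vmem A; first by rewrite A0 cards0 in lX.
have cA := cardsD1 i A; rewrite iA add1n in cA.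
have cX : #|subcube A e :&: X| =
    #|subcube (A :\ i) e :&: X| + #|subcube (A :\ i) (flip i e) :&: X|.
  rewrite (subcube_split e iA) setIUl cardsU setIACA (subcube_disjI e iA) set0I.
  by rewrite cards0 subn0.
have empty e' : subcube (A :\ i) e' :&: X = set0 -> linked cube_adj (subcube (A :\ i) e' :\: X).
  move=> X0; have [A0|[j jA]] := set_0Vmem (A :\ i).
    rewrite A0 subcube0 in X0 *; rewrite setDE.
    have -> : [set e'] :&: ~: X = [set e'].
      by apply/setIidPl; rewrite sub1set inE; apply/negP=> eX; have := in_set0 e'; rewrite -X0 !inE eqxx eX.
    exact: linked1.
  apply: IHn; first by lia.
  by rewrite X0 cards0; apply/card_gt0P; exists j.
have [X0|X0] := eqVneq (subcube (A :\ i) e :&: X) set0.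
  exact: subcube_half_linked iA (empty _ X0) X0.
have [X1|X1] := eqVneq (subcube (A :\ i) (flip i e) :&: X) set0.
  have := subcube_half_linked iA (empty _ X1) X1.
  by rewrite (subcube_split (flip i e) iA) flipK setUC -(subcube_split e iA).
rewrite -card_gt0 in X0; rewrite -card_gt0 in X1.
apply: (subcube_halves_linked iA); try by apply: IHn; lia.
by apply: leq_trans (ltn_expl _ _) => //; lia.
Qed.

Lemma cube_linked X : #|X| < k -> linked cube_adj (~: X).
Proof.
move=> lX; have := @subcube_linked setT [ffun=> false] X.
by rewrite subcubeT cardsT card_ord setTI setTD; apply.
Qed.

(** Split the cube in a direction. To a half without vertices of [X] the other one attaches. A half
    with one vertex of [X] stays linked, and only the partner [w] of that vertex may fail to attach;
    it fails only if its [k] neighbours make up [X]. If both halves have at least two, each loses at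
    most [k - 2] vertices, so both stay linked and are joined. *)
Lemma cube_linked_or_corner X : 1 < k -> #|X| <= k ->
  linked cube_adj (~: X) \/
  exists w, [/\ w \notin X, X = [set x | cube_adj w x] & linked cube_adj (~: X :\ w)].
Proof.
move=> k_gt1 lX; pose i : 'I_k := Ordinal (ltnW k_gt1); pose A := [set: 'I_k].
have iA : i \in A by rewrite in_setT.
have cA : #|A :\ i| = k.-1 by have := cardsD1 i A; rewrite iA cardsT card_ord add1n => /(congr1 predn).
pose e : Q := [ffun=> false].
have eT e' : subcube A e' = setT by exact: subcubeT.
have toT e' : linked cube_adj (subcube A e' :\: X) -> linked cube_adj (~: X).
  by rewrite eT setTD.
have cX e' : #|X| = #|subcube (A :\ i) e' :&: X| + #|subcube (A :\ i) (flip i e') :&: X|.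
  rewrite -{1}[X]setTI -(eT e') (subcube_split e' iA) setIUl cardsU setIACA (subcube_disjI e' iA).
  by rewrite set0I cards0 subn0.
have half0 e' : #|subcube (A :\ i) e' :&: X| = 0 -> linked cube_adj (~: X).
  move=> X0; apply: (toT e'); apply: (subcube_half_linked iA).
    by apply: subcube_linked; rewrite X0 cA; lia.
  exact: cards0_eq.
have half1 e' : #|subcube (A :\ i) e' :&: X| = 1 ->
    linked cube_adj (~: X) \/
    exists w, [/\ w \notin X, X = [set x | cube_adj w x] & linked cube_adj (~: X :\ w)].
  move=> /eqP/cards1P[x X1].
  have [x1 xX] : x \in subcube (A :\ i) e' /\ x \in X.
    by apply/setIP; rewrite X1 set11.
  pose w := flip i x.
  have l0 : linked cube_adj (subcube (A :\ i) e' :\: X).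
    (* For [k = 2] the half is an edge, of which a single vertex remains. *)
    have [k2|k3] := ltnP 2 k; first by apply: subcube_linked; rewrite X1 cards1 cA; lia.
    have c2 : #|subcube (A :\ i) e' :\: X| == 1.
      by rewrite cardsD X1 cards1 card_subcube cA; have -> : k = 2 by lia.
    by case/cards1P: c2 => y ->; apply: linked1.
  have partner y : y \in subcube (A :\ i) (flip i e') -> y != w ->
      flip i y \in subcube (A :\ i) e' :\: X.
    move=> y1 yw; have fy : flip i y \in subcube (A :\ i) e'.
      by rewrite -(subcube_flip e' _ iA) flipK.
    rewrite in_setD fy andbT; apply: contra yw => fyX.
    have : flip i y \in [set x] by rewrite -X1 in_setI fy.
    by move/set1P=> fyx; rewrite /w -fyx flipK.
  have lw : linked cube_adj (~: X :\ w).
    apply: (linked_attach cube_adj_sym l0).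
      apply/subsetP=> y; rewrite !in_setD in_set1 in_setC => /andP[-> ye].
      rewrite andbT; apply: contraTneq ye => ->.
      apply/negP=> /(subcube_disj iA)/negP; apply.
      by rewrite /w subcube_flip.
    move=> y; rewrite in_setD1 in_setC => /andP[yw yX].
    have: y \in subcube A e' by rewrite eT.
    rewrite (subcube_half e' y iA) => /orP[y0|y1]; first by rewrite in_setD yX y0.
    by move=> _; exists (flip i y); [apply: partner|apply: cube_adj_flip].
  have [wX|wX] := boolP (w \in X).
    left; suff -> : ~: X = ~: X :\ w by [].
    by apply/setP=> y; rewrite !inE; case: eqP => [->|//]; rewrite wX.
  have [sub|] := boolP ([set x | cube_adj w x] \subset X).
    right; exists w; split=> //; apply/eqP; rewrite eq_sym eqEcard sub /=.
    suff -> : [set x | cube_adj w x] = (flip^~ w) @: 'I_k.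
      by rewrite card_imset ?card_ord //; apply: flip_injl.
    apply/setP=> y; rewrite inE; apply/cube_adjP/imsetP=> -[j]; first by exists j.
    by exists j.
  case/subsetPn=> y; rewrite inE => wy yX; left.
  apply: (linked_attach cube_adj_sym lw); first exact: subD1set.
  move=> z; rewrite inE => zX; rewrite !inE zX andbT negbK => /eqP->; exists y => //.
  by rewrite !inE yX andbT; apply: contraTneq wy => ->; apply/cube_adjP=> -[j /esym/eqP]; rewrite (negPf (flip_neq _ _)).
have [X0|X0] := posnP #|subcube (A :\ i) e :&: X|; first by left; apply: half0 X0.
have [X1|X1] := posnP #|subcube (A :\ i) (flip i e) :&: X|; first by left; apply: half0 X1.
have [X01|X01] := eqVneq #|subcube (A :\ i) e :&: X| 1; first exact: half1 X01.
have [X11|X11] := eqVneq #|subcube (A :\ i) (flip i e) :&: X| 1; first exact: half1 X11.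
have cXe := cX e.
have [lt0 lt1 lt01] : [/\ #|subcube (A :\ i) e :&: X| < k.-1,
    #|subcube (A :\ i) (flip i e) :&: X| < k.-1 & 2 < k].
  move: cXe X0 X1 X01 X11 lX; move: #|X| #|_ :&: _| #|_ :&: _| => a b c.
  by move=> *; split; lia.
left; apply: (toT e); apply: (subcube_halves_linked iA).
- by apply: subcube_linked; rewrite cA.
- by apply: subcube_linked; rewrite cA.
- rewrite eT setTI cA; have := ltn_expl k.-2 (isT : 1 < 2).
  have -> : k.-1 = k.-2.+1 by rewrite prednK // -ltnS prednK ?(ltnW k_gt1) // ltnW.
  rewrite expnS; move: lX lt01; move: #|X| (2 ^ _) => a b; clear; lia.
Qed.

(** The complement of a proper face is the union of the halves [B i] opposite to it, one for each
    frozen direction [i]. Each is a cube of dimension [k - 1] and survives the loss of [k - 2]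
    vertices; two of them share [2 ^ (k - 2) > k - 2] vertices, so one outside [Y]. *)
Lemma cube_minus_face_linked (S Y : {set Q}) :
    S = set0 \/ (exists A e, A != setT /\ S = subcube A e) -> #|Y| + 2 <= k ->
  linked cube_adj (~: (S :|: Y)).
Proof.
case=> [->|[A [e [AT ->]]]] lY.
  by rewrite set0U; apply: cube_linked; lia.
pose B i := subcube (setT :\ i) (flip i e).
have BS i : i \notin A -> B i :\: Y \subset ~: (subcube A e :|: Y).
  move=> iA; apply/subsetP=> x; rewrite !in_setD in_setC in_setU => /andP[xY xB].
  rewrite negb_or xY andbT; apply/negP=> /subcubeP/(_ i iA) xe.
  have /subcubeP/(_ i) := xB; rewrite !inE eqxx xe ffunE eqxx.
  by case: (e i) => /(_ isT).
have cT (i : 'I_k) : #|[set: 'I_k] :\ i| = k.-1.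
  by have := cardsD1 i setT; rewrite in_setT cardsT card_ord add1n => /(congr1 predn).
have lB i : linked cube_adj (B i :\: Y).
  apply: subcube_linked; apply: leq_ltn_trans (subset_leq_card (subsetIr _ _)) _.
  by rewrite cT; lia.
have inB x : x \in ~: (subcube A e :|: Y) -> exists2 i, i \notin A & x \in B i :\: Y.
  rewrite in_setC in_setU => /norP[]; rewrite inE => /forallPn[i].
  rewrite negb_imply => /andP[iA xi] xY; exists i => //; rewrite in_setD xY.
  apply/subcubeP=> j; rewrite !inE andbT negbK => /eqP->; rewrite ffunE eqxx.
  by move: xi; case: (x i); case: (e i).
move=> x y /inB[i iA xB] /inB[j jA yB].
have [eij|nij] := eqVneq i j.
  by rewrite -eij in yB; apply: (linked_sub (lB i) (BS i iA)).
have [z zB zY] : exists2 z, z \in subcube (setT :\ i :\ j) (flip i (flip j e)) & z \notin Y.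
  apply: ex_notin; rewrite card_subcube.
  have -> : #|[set: 'I_k] :\ i :\ j| = k.-2.
    by have := cardsD1 j (setT :\ i); rewrite !inE eq_sym nij cT add1n => /(congr1 predn).
  by apply: leq_ltn_trans (ltn_expl k.-2 (isT : 1 < 2)); lia.
have zBi : z \in B i :\: Y.
  rewrite in_setD zY; apply/subcubeP=> h; rewrite !inE andbT negbK => /eqP->.
  move/subcubeP: zB => ->; rewrite ?inE ?eqxx ?andbF // !ffunE eqxx.
  by rewrite (negPf nij) addbF.
have zBj : z \in B j :\: Y.
  rewrite in_setD zY; apply/subcubeP=> h; rewrite !inE andbT negbK => /eqP->.
  move/subcubeP: zB => ->; rewrite ?inE ?eqxx // !ffunE eqxx.
  by rewrite eq_sym (negPf nij) addbF.
apply: (connect_trans (linked_sub (lB i) (BS i iA) xB zBi)).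
exact: (linked_sub (lB j) (BS j jA)).
Qed.

End Cube.

Lemma in_preimset (aT rT : finType) (f : aT -> rT) (S : {set rT}) x :
  (x \in f @^-1: S) = (f x \in S).
Proof. exact: in_set. Qed.

(** * Facets whose faces are labelled by subcubes *)

Section CubeLabels.
Variables (T : finType) (k : nat) (adj : rel T) (face : {set T} -> Prop).
Notation Q := {ffun 'I_k -> bool}.

(** Ridges are maximal proper faces, so that no notion of dimension is needed here. *)
Definition ridge (F R : {set T}) : Prop :=
  [/\ face R, R \proper F &
      forall S, face S -> R \subset S -> S \proper F -> S = R].

(** The empty face is listed apart because a [subcube] is never empty. Values of [phi] outside [F]
    are arbitrary, hence the intersections with [F]. *)
Definition cube_label (F : {set T}) (phi : T -> Q) : Prop :=
  [/\ {in F &, injective phi},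
      forall q, exists2 v, v \in F & phi v = q &
      forall S : {set T}, S \subset F ->
        face S <-> (S = set0 \/ exists A e, S = F :&: phi @^-1: subcube A e)].

Hypothesis adjE : forall u v, adj u v <-> u != v /\ face [set u; v].
Hypothesis face_I : forall A B, face A -> face B -> face (A :&: B).
Variables (F : {set T}) (phi : T -> Q).
Hypothesis lab : cube_label F phi.

Lemma label_inj : {in F &, injective phi}. Proof. by case: lab. Qed.

Lemma label_surj q : exists2 v, v \in F & phi v = q. Proof. by case: lab. Qed.

Lemma label_face (S : {set T}) : S \subset F ->
  face S <-> (S = set0 \/ exists A e, S = F :&: phi @^-1: subcube A e).
Proof. by case: lab => _ _; apply. Qed.

Lemma label_im (S : {set Q}) : phi @: (F :&: phi @^-1: S) = S.
Proof.
apply/setP=> q; apply/imsetP/idP=> [[v /setIP[_]]|qS]; first by rewrite inE => ? ->.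
by have [v vF ev] := label_surj q; exists v; rewrite // !inE vF ev.
Qed.

Lemma card_label (S : {set Q}) : #|F :&: phi @^-1: S| = #|S|.
Proof.
rewrite -{2}(label_im S) card_in_imset // => x y /setIP[xF _] /setIP[yF _].
exact: label_inj.
Qed.

Lemma label_subcube A e : face (F :&: phi @^-1: subcube A e).
Proof. by apply/label_face; [apply: subsetIl|right; exists A, e]. Qed.

(** An edge is a subcube with two vertices, hence with one free direction. *)
Lemma adj_label : {in F &, forall u v, adj u v = cube_adj (phi u) (phi v)}.
Proof.
move=> u v uF vF; apply/idP/cube_adjP=> [/adjE[nuv]|[i ev]].
  have sF : [set u; v] \subset F by rewrite subUset !sub1set uF.
  case/(label_face sF)=> [/setP/(_ u)|[A [e E]]]; first by rewrite !inE eqxx.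
  have := card_label (subcube A e); rewrite -E cards2 nuv card_subcube.
  case cA: #|A| => [|[|n]] //; last by rewrite !expnS; lia.
  move=> _; have /cards1P[i Ai] : #|A| == 1 by rewrite cA.
  have uA : phi u \in subcube A e.
    by have := set21 u v; rewrite E => /setIP[_]; rewrite in_preimset.
  have vA : phi v \in subcube A e.
    by have := set22 u v; rewrite E => /setIP[_]; rewrite in_preimset.
  exists i; apply/ffunP=> j; rewrite ffunE.
  have [->|nji] := eqVneq j i; last first.
    by rewrite addbF (subcubeP _ _ _ uA) ?(subcubeP _ _ _ vA) ?Ai ?inE.
  have [eqi|] := eqVneq (phi u i) (phi v i); last by case: (phi u i); case: (phi v i).
  case/eqP: nuv; apply: label_inj => //; apply/ffunP=> h.
  have [->//|nhi] := eqVneq h i.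
  by rewrite (subcubeP _ _ _ uA) ?(subcubeP _ _ _ vA) ?Ai ?inE.
apply/adjE; split.
  by apply: contraTneq isT => euv; have := flip_neq i (phi u); rewrite -ev euv eqxx.
suff -> : [set u; v] = F :&: phi @^-1: subcube [set i] (phi u) by apply: label_subcube.
apply/setP=> x; rewrite in_setI in_preimset; apply/set2P/andP=> [[]->|[xF /subcubeP xA]].
- by rewrite uF subcube_refl.
- split=> //; apply/subcubeP=> j; rewrite in_set1 ev ffunE => /negPf->.
  by rewrite addbF.
- have [exu|] := eqVneq (phi x i) (phi u i).
    left; apply: label_inj => //; apply/ffunP=> j.
    by have [->//|nji] := eqVneq j i; apply: xA; rewrite in_set1.
  move=> nxu; right; apply: label_inj => //; rewrite ev; apply/ffunP=> j; rewrite ffunE.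
  have [->|nji] := eqVneq j i; last by rewrite addbF xA ?in_set1.
  by move: nxu; case: (phi x i); case: (phi u i).
Qed.

Lemma label_nbrs u : u \in F ->
  [set v in F | adj u v] = F :&: phi @^-1: [set q | cube_adj (phi u) q].
Proof.
move=> uF; apply/setP=> v; rewrite !inE; case: (boolP (v \in F)) => //= vF.
exact: adj_label.
Qed.

Lemma card_cube_nbrs (x : Q) : #|[set y | cube_adj x y]| = k.
Proof.
rewrite -[RHS]card_ord -(card_imset _ (@flip_injl k x)).
by apply: eq_card => y; rewrite inE; apply/cube_adjP/imsetP=> -[j]; exists j.
Qed.

Lemma card_nbrs u : u \in F -> #|[set v in F | adj u v]| = k.
Proof. by move=> uF; rewrite label_nbrs // card_label card_cube_nbrs. Qed.

Lemma card_facet : #|F| = 2 ^ k.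
Proof.
rewrite -[F]setIT -(preimsetT phi) card_label cardsT card_ffun card_bool.
by rewrite card_ord.
Qed.

(** The labels of [a] and [b] differ from that of [u] in two different coordinates, so in each
    coordinate frozen in [S] one of them agrees with [u]. *)
Lemma face_nbrs (S : {set T}) u a b : face S -> S \subset F -> u \in F ->
  a \in S -> b \in S -> a != b -> adj u a -> adj u b -> u \in S.
Proof.
move=> fS sSF uF aS bS nab; have aF := subsetP sSF a aS; have bF := subsetP sSF b bS.
rewrite !adj_label // => /cube_adjP[i ea] /cube_adjP[j eb].
have nij : i != j by apply: contra_neq nab => eij; apply: label_inj; rewrite // ea eb eij.
case/(label_face sSF): fS => [S0|[A [e SE]]]; first by rewrite S0 inE in aS.
move: aS bS; rewrite SE !in_setI uF aF bF !in_preimset.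
move=> /subcubeP aA /subcubeP bA; apply/subcubeP=> h hA.
have [ehi|nhi] := eqVneq h i.
  by rewrite -(bA h hA) eb ffunE ehi (negPf nij) addbF.
by rewrite -(aA h hA) ea ffunE (negPf nhi) addbF.
Qed.

Definition side (i : 'I_k) (c : bool) : {set T} := F :&: phi @^-1: [set q : Q | q i == c].

Lemma halfE i (e : Q) : [set q : Q | q i == e i] = subcube (setT :\ i) e.
Proof.
apply/setP=> q; rewrite inE; apply/eqP/subcubeP=> [qi j|-> //].
  by rewrite !inE andbT negbK => /eqP->.
by rewrite !inE eqxx.
Qed.

Lemma in_half i c v : (v \in side i c) = (v \in F) && (phi v i == c).
Proof. by rewrite in_setI in_preimset inE. Qed.

Lemma half_subcube i c : exists e : Q, e i = c /\ side i c = F :&: phi @^-1: subcube (setT :\ i) e.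
Proof. by exists [ffun=> c]; rewrite ffunE -halfE ffunE. Qed.

Lemma half_face i c : face (side i c).
Proof. by have [e [_ ->]] := half_subcube i c; apply: label_subcube. Qed.

Lemma half_proper i c : side i c \proper F.
Proof.
rewrite properE subsetIl; have [v vF ev] := label_surj [ffun=> ~~ c].
by apply/subsetPn; exists v => //; rewrite in_half vF ev ffunE; case: (c).
Qed.

Lemma proper_face_half (S : {set T}) : 0 < k -> face S -> S \proper F -> exists i c, S \subset side i c.
Proof.
move=> k0 fS pS; have sSF := proper_sub pS.
case/(label_face sSF): fS => [->|[A [e SE]]].
  by exists (Ordinal k0), true; apply: sub0set.
have [AT|] := eqVneq A setT.
  by move: pS; rewrite SE AT subcubeT preimsetT setIT properxx.
rewrite -subTset => /subsetPn[i _ iA]; exists i, (e i); apply/subsetP=> v.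
rewrite SE in_half in_setI in_preimset => /andP[-> /subcubeP-> //].
by rewrite eqxx.
Qed.

Lemma ridge_half (R : {set T}) : 0 < k -> ridge F R -> exists i c, R = side i c.
Proof.
move=> k0 [fR pR maxR]; have [i [c sRh]] := proper_face_half k0 fR pR.
by exists i, c; rewrite (maxR (side i c)) //; [apply: half_face|apply: half_proper].
Qed.

Lemma half_ridge i c : ridge F (side i c).
Proof.
split; [exact: half_face|exact: half_proper|].
move=> S fS shS pS; have [j [c' sSh]] := proper_face_half (leq_ltn_trans (leq0n i) (ltn_ord i)) fS pS.
suff [eij ec] : i = j /\ c = c' by apply/eqP; rewrite eqEsubset shS andbT eij ec.
have sh := subset_trans shS sSh.
have [v vF ev] := label_surj [ffun h => if h == i then c else ~~ c'].
have : v \in side j c' by apply: (subsetP sh); rewrite in_half vF ev ffunE !eqxx.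
rewrite in_half vF ev ffunE; have [<-|] := eqVneq j i; last by case: (c').
by move/eqP=> ->.
Qed.

Lemma card_half i c : #|side i c| = 2 ^ k.-1.
Proof.
have [e [_ ->]] := half_subcube i c; rewrite card_label card_subcube.
by have := cardsD1 i setT; rewrite in_setT cardsT card_ord add1n => /(congr1 predn)/= <-.
Qed.

Lemma half_nbrs i c v : v \in side i c -> #|[set u in side i c | adj v u]| = k.-1.
Proof.
rewrite in_half => /andP[vF /eqP vi].
have [f fF ef] := label_surj (flip i (phi v)).
have := cardsD1 f [set u in F | adj v u]; rewrite card_nbrs //.
rewrite inE fF adj_label // ef cube_adj_flip add1n => ->; apply: eq_card => u.
rewrite !inE; case: (boolP (u \in F)) => uF; rewrite ?andbF //=.
rewrite adj_label //; case: cube_adjP => [[j ej]|]; last by rewrite !andbF.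
rewrite !andbT ej ffunE vi.
have [eij|nij] := eqVneq i j.
  rewrite addbT; have -> : u = f by apply: label_inj; rewrite // ej ef eij.
  by rewrite eqxx; case: (c).
rewrite addbF eqxx; apply/esym; apply: contraTneq isT => euf.
by move: ej; rewrite euf ef => /flip_injl eij; rewrite eij eqxx in nij.
Qed.

Lemma exchange_half w b : w \in F -> b \in F -> adj w b ->
  exists i c, [/\ w \in side i c, b \notin side i c &
    forall u, u \in F -> adj w u -> u != b -> u \in side i c].
Proof.
move=> wF bF; rewrite adj_label // => /cube_adjP[i eb].
exists i, (phi w i); rewrite !in_half wF bF eqxx eb ffunE eqxx addbT; split=> //.
  by case: (phi w i).
move=> u uF; rewrite adj_label // => /cube_adjP[j eu] nub.
rewrite in_half uF eu ffunE; have [eij|] := eqVneq i j; last by rewrite addbF eqxx.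
by case/eqP: nub; apply: label_inj; rewrite // eu eb eij.
Qed.

(** Let [r] be a vertex of the side missed by [S]. Unless [S] misses [F], where [j = i] will do, it
    has a frozen coordinate [j] in which it differs from [r]. The vertices that agree with [r] in
    [i] and [j] lie in the side and outside [S]. *)
Lemma half_minus_face i c (S : {set T}) : face S -> ~~ (side i c \subset S) ->
  2 ^ k.-2 <= #|side i c :\: S|.
Proof.
move=> fS /subsetPn[r rh rS]; have := rh; rewrite in_half => /andP[rF /eqP ri].
have fSF : face (S :&: F).
  apply: face_I => //; apply/label_face => //; right.
  by exists setT, (phi r); rewrite subcubeT preimsetT setIT.
have [j Hj] : exists j, forall v, v \in F -> phi v j = phi r j -> v \notin S.
  case/(label_face (subsetIr S F)): fSF => [S0|[A [e SE]]].
    exists i => v vF _; apply/negP=> vS.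
    by have := in_set0 v; rewrite -S0 in_setI vS vF.
  have : r \notin S :&: F by rewrite in_setI rF andbT.
  rewrite SE in_setI rF in_preimset inE => /forallPn[j].
  rewrite negb_imply => /andP[jA nrj]; exists j => v vF evr; apply/negP=> vS.
  have : v \in S :&: F by rewrite in_setI vS.
  rewrite SE in_setI in_preimset => /andP[_ /subcubeP/(_ j jA)].
  by rewrite evr => /eqP; rewrite (negPf nrj).
have sub : F :&: phi @^-1: subcube (setT :\ i :\ j) (phi r) \subset side i c :\: S.
  apply/subsetP=> v; rewrite in_setI in_preimset in_setD in_half => /andP[vF /subcubeP vr].
  rewrite vF -ri vr ?inE ?eqxx ?andbF //= andbT; apply: Hj => //.
  by rewrite vr // !inE eqxx.
apply: leq_trans (subset_leq_card sub); rewrite card_label card_subcube.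
apply: leq_pexp2l => //.
have := cardsD1 i [set: 'I_k]; have := cardsD1 j ([set: 'I_k] :\ i).
rewrite in_setT cardsT card_ord add1n => cj ci.
move: #|_ :\ j| #|_ :\ i| (j \in _) cj ci => a b [] /=; clear; lia.
Qed.

Lemma facet_linked_or_corner (X : {set T}) : 1 < k -> #|X :&: F| <= k ->
  linked adj (F :\: X) \/
  exists w, [/\ w \in F, w \notin X, X :&: F = [set u in F | adj w u]
              & linked adj (F :\: X :\ w)].
Proof.
move=> k1 lX; pose Y := phi @: (X :&: F).
have cY : #|Y| <= k by apply: leq_trans (leq_imset_card _ _) lX.
have inY v : v \in F -> (phi v \in Y) = (v \in X).
  move=> vF; apply/imsetP/idP=> [[u /setIP[uX uF]]|vX]; last by exists v; rewrite // in_setI vX.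
  by move/label_inj=> -> //.
have transfer (Z : {set T}) (Z' : {set Q}) : linked (@cube_adj k) Z' ->
    (forall v, (v \in Z) = (v \in F) && (phi v \in Z')) -> linked adj Z.
  move=> lZ' ZE; apply: (linked_transfer (f := phi) _ _ _ _ lZ').
  - move=> q qZ; have [v vF ev] := label_surj q; exists v => //.
    by rewrite ZE vF ev.
  - by move=> u; rewrite ZE => /andP[].
  - by move=> u v; rewrite !ZE => /andP[uF _] /andP[vF _]; apply: label_inj.
  - by move=> u v; rewrite !ZE => /andP[uF _] /andP[vF _]; rewrite adj_label.
have [lY|[q [qY YE lY]]] := cube_linked_or_corner k1 cY.
  left; apply: transfer lY _ => v; rewrite in_setD in_setC andbC.
  by case: (boolP (v \in F)) => //= vF; rewrite inY.
right; have [w wF ew] := label_surj q; exists w; split=> //.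
- by rewrite -inY // ew.
- apply/setP=> v; rewrite in_setI [in RHS]inE andbC; case: (boolP (v \in F)) => //= vF.
  by rewrite -inY // YE inE -ew adj_label.
- apply: transfer lY _ => v; rewrite in_setD1 in_setD in_setD1 in_setC.
  case: (boolP (v \in F)) => vF; rewrite ?andbF //= andbT inY // -ew; congr (~~ _ && _).
  by apply/eqP/eqP=> [->|/label_inj->].
Qed.

Lemma facet_minus_face_linked (S X : {set T}) :
    face S -> ~~ (F \subset S) -> #|(X :&: F) :\: S| + 2 <= k ->
  linked adj (F :\: (S :|: X)).
Proof.
move=> fS nFS lX; pose Y := phi @: (X :&: F :\: S).
have cY : #|Y| + 2 <= k by apply: leq_trans lX; rewrite leq_add2r leq_imset_card.
have inY v : v \in F -> (phi v \in Y) = (v \in X) && (v \notin S).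
  move=> vF; apply/imsetP/andP=> [[u]|[vX vS]]; last by exists v; rewrite // in_setD in_setI vX vF vS.
  rewrite in_setD in_setI => /and3P[uS uX uF].
  by move/label_inj=> -> //.
pose S' := phi @: (S :&: F).
have inS v : v \in F -> (phi v \in S') = (v \in S).
  move=> vF; apply/imsetP/idP=> [[u /setIP[uX uF]]|vX]; last by exists v; rewrite // in_setI vX.
  by move/label_inj=> -> //.
have HS' : S' = set0 \/ exists A e, A != setT /\ S' = subcube A e.
  have [r rF _] := label_surj [ffun=> true].
  have fSF : face (S :&: F).
    apply: face_I => //; apply/label_face => //; right.
    by exists setT, (phi r); rewrite subcubeT preimsetT setIT.
  case/(label_face (subsetIr S F)): fSF => [S0|[A [e SE]]].
    by left; rewrite /S' S0 imset0.
  right; exists A, e; split; last by rewrite /S' SE label_im.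
  apply/eqP=> AT; case/negP: nFS; move: SE.
  by rewrite AT subcubeT preimsetT setIT => <-; apply: subsetIl.
have lS' := cube_minus_face_linked HS' cY.
apply: (linked_transfer (f := phi) _ _ _ _ lS').
- move=> q; have [v vF <-] := label_surj q; rewrite in_setC in_setU inS // inY // => H.
  by exists v; rewrite // in_setD in_setU vF andbT; move: H; case: (v \in S); rewrite ?andbT.
- move=> u; rewrite in_setD in_setU in_setC in_setU => /andP[H uF].
  by rewrite inS // inY //; move: H; case: (u \in S); rewrite ?andbT.
- by move=> u v; rewrite !in_setD => /andP[_ uF] /andP[_ vF]; apply: label_inj.
- by move=> u v; rewrite !in_setD => /andP[_ uF] /andP[_ vF]; rewrite adj_label.
Qed.

End CubeLabels.

(** * Graphs of cubical lattices *)

(** [cl_dual] states connectivity of facets as an induction: [C] passes across ridges that lie in no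
    facet containing [A]. With [A] a facet, this concerns the other facets and the ridges not
    contained in it; with [A = setT], which no facet contains, it reaches all facets. *)
Record cubical_lattice (T : finType) (k : nat) (adj : rel T)
    (face facet : {set T} -> Prop) : Prop := CubicalLattice {
  cl_adjE : forall u v, adj u v <-> u != v /\ face [set u; v];
  cl_faceI : forall A B, face A -> face B -> face (A :&: B);
  cl_face1 : forall v, face [set v];
  cl_label : forall F, facet F -> exists phi : T -> {ffun 'I_k -> bool}, cube_label face F phi;
  cl_facet_face : forall F, facet F -> face F;
  cl_facet_max : forall F F', facet F -> facet F' -> F \subset F' -> F = F';
  cl_cover : forall S : {set T}, face S -> #|S| <= 2 -> exists2 F, facet F & S \subset F;
  cl_cross : forall F R, facet F -> ridge face F R -> exists2 F', facet F' & F :&: F' = R;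
  cl_dual : forall (A : {set T}) (C : {set T} -> Prop) G0,
    facet G0 -> ~~ (A \subset G0) -> C G0 ->
    (forall G G', facet G -> facet G' -> ~~ (A \subset G) -> ~~ (A \subset G') -> C G ->
       ridge face G (G :&: G') ->
       (forall F, facet F -> A \subset F -> ~~ (G :&: G' \subset F)) -> C G') ->
    forall G, facet G -> ~~ (A \subset G) -> C G
}.

(** * Deleting vertices from the graph of a cubical lattice *)

Section CubicalGraph.
Variables (T : finType) (k : nat) (adj : rel T) (face facet : {set T} -> Prop).
Hypothesis str : cubical_lattice k adj face facet.
Hypothesis k_gt1 : 1 < k.

Let adjE := cl_adjE str.
Let faceI := cl_faceI str.
Let k_gt0 : 0 < k := ltnW k_gt1.

Lemma adj_sym : symmetric adj.
Proof.
by move=> u v; apply/idP/idP=> /adjE[nuv fuv]; apply/adjE; rewrite eq_sym setUC.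
Qed.

Lemma vertex_in_facet v : exists2 F, facet F & v \in F.
Proof.
have [|F fF] := cl_cover str (cl_face1 str v); first by rewrite cards1.
by rewrite sub1set; exists F.
Qed.

Lemma edge_in_facet u v : adj u v -> exists F, [/\ facet F, u \in F & v \in F].
Proof.
case/adjE=> nuv fuv; have [|F fF] := cl_cover str fuv; first by rewrite cards2 nuv.
by rewrite subUset !sub1set => /andP[uF vF]; exists F.
Qed.

Lemma facet_nbrs F u : facet F -> u \in F -> #|[set v in F | adj u v]| = k.
Proof. by move=> fF uF; have [phi lab] := cl_label str fF; apply: (card_nbrs adjE lab). Qed.

Lemma facet_face_nbrs F S u a b : facet F -> face S -> u \in F ->
  a \in F -> b \in F -> a \in S -> b \in S -> a != b -> adj u a -> adj u b -> u \in S.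
Proof.
move=> fF fS uF aF bF aS bS nab ua ub; have [phi lab] := cl_label str fF.
have fSF : face (S :&: F) by apply: faceI => //; apply: cl_facet_face str _ fF.
have : u \in S :&: F; last by case/setIP.
by apply: (face_nbrs adjE lab fSF (subsetIr _ _) uF _ _ nab ua ub); rewrite in_setI ?aS ?bS.
Qed.

(** Cross the ridge of [F] that contains [w] and not [b]; it is the half of the cube with all other
    neighbours of [w] in [F]. *)
Lemma facet_exchange F w b : facet F -> w \in F -> b \in F -> adj w b ->
  exists F', [/\ facet F', ridge face F (F :&: F'), w \in F', b \notin F' &
    forall u, u \in F -> adj w u -> u != b -> u \in F'].
Proof.
move=> fF wF bF wb; have [phi lab] := cl_label str fF.
have [i [c [wR bR H]]] := exchange_half adjE lab wF bF wb.
have rR := half_ridge lab i c; have [F' fF' E] := cl_cross str fF rR.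
exists F'; split=> //; first by rewrite E.
- by move: wR; rewrite -E => /setIP[].
- by move: bR; rewrite -E in_setI bF.
- by move=> u uF wu nub; move: (H u uF wu nub); rewrite -E => /setIP[].
Qed.

Lemma ridge_card F R : facet F -> ridge face F R -> #|R| = 2 ^ k.-1.
Proof.
move=> fF rR; have [phi lab] := cl_label str fF.
by have [i [c ->]] := ridge_half lab k_gt0 rR; apply: (card_half lab).
Qed.

Lemma ridge_nbrs F R v : facet F -> ridge face F R -> v \in R ->
  #|[set u in R | adj v u]| = k.-1.
Proof.
move=> fF rR; have [phi lab] := cl_label str fF.
by have [i [c ->]] := ridge_half lab k_gt0 rR; apply: (half_nbrs adjE lab).
Qed.

Lemma ridge_minus_face F R S : facet F -> ridge face F R -> face S ->
  ~~ (R \subset S) -> 2 ^ k.-2 <= #|R :\: S|.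
Proof.
move=> fF rR; have [phi lab] := cl_label str fF.
by have [i [c ->]] := ridge_half lab k_gt0 rR; apply: (half_minus_face faceI lab).
Qed.

(** A facet at [v] has a neighbour [b] of [v]; a facet at [v] that avoids [b] contributes [k]
    further ones. *)
Lemma min_degree v : k < #|[set u | adj v u]|.
Proof.
have [F fF vF] := vertex_in_facet v.
have [b] : exists b, b \in [set u in F | adj v u].
  by apply/card_gt0P; rewrite facet_nbrs.
rewrite inE => /andP[bF vb].
have [F' [fF' _ vF' bF' _]] := facet_exchange fF vF bF vb.
have H : b |: [set u in F' | adj v u] \subset [set u | adj v u].
  by apply/subsetP=> u; rewrite !inE => /orP[/eqP->|/andP[]].
by have := subset_leq_card H; rewrite cardsU1 inE (negPf bF') facet_nbrs.
Qed.

(** Each facet other than [F] stays linked without [F] and [X], and [cl_dual] with [A = F] chains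
    these pieces. The vertices of [F] attach from outside. *)
Lemma avoid_facet (F X : {set T}) : facet F -> #|X :\: F| + 2 <= k ->
    (forall v, v \in F -> v \notin X ->
       exists u, [/\ adj v u, u \notin F & u \notin X]) ->
  linked adj (~: X).
Proof.
move=> fF lX out; have faF := cl_facet_face str fF.
have lW : linked adj (~: (F :|: X)).
  move=> u v; rewrite !in_setC !in_setU => /norP[uF uX] /norP[vF vX].
  have [G0 fG0 uG0] := vertex_in_facet u; have [G fG vG] := vertex_in_facet v.
  have nF x H : facet H -> x \in H -> x \notin F -> ~~ (F \subset H).
    move=> fH xH xF; apply/negP=> /(cl_facet_max str fF fH) FH.
    by rewrite FH xH in xF.
  have lG H x : facet H -> x \in H -> x \notin F -> linked adj (H :\: (F :|: X)).
    move=> fH xH xF; have [phi lab] := cl_label str fH.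
    apply: (facet_minus_face_linked adjE faceI lab faF).
      by apply/subsetPn; exists x.
    apply: leq_trans lX; rewrite leq_add2r; apply/subset_leq_card.
    by apply: setSD; apply: subsetIl.
  have sub (H : {set T}) : H :\: (F :|: X) \subset ~: (F :|: X) by rewrite setDE subsetIr.
  pose C (H : {set T}) := forall x, x \in H -> x \notin F -> x \notin X ->
    connect (within adj (~: (F :|: X))) u x.
  suff /(_ v vG vF vX) : C G by [].
  apply: (cl_dual str (A := F) (C := C) fG0) => //.
  - exact: nF uG0 uF.
  - move=> x xG0 xF xX; apply: (linked_sub (lG _ _ fG0 uG0 uF) (sub _)).
      by rewrite in_setD in_setU negb_or uF uX.
    by rewrite in_setD in_setU negb_or xF xX.
  - move=> H H' fH fH' _ _ CH rH nR x xH' xF xX.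
    (* The shared ridge is not contained in [F], so at least [2 ^ (k - 2) > k - 2] of its vertices
       lie outside [F]. *)
    have [z] : exists2 z, z \in (H :&: H') :\: F & z \notin X :\: F.
      apply: ex_notin; apply: leq_trans (ridge_minus_face fH rH faF (nR F fF (subxx _))).
      have := ltn_expl k.-2 (isT : 1 < 2); move: lX; move: #|_| (2 ^ _) => a b; clear; lia.
    rewrite !in_setD in_setI => /and3P[zF zH zH']; rewrite zF /= => zX.
    apply: connect_trans (CH z zH zF zX) _.
    apply: (linked_sub (lG _ _ fH' zH' zF) (sub _)).
      by rewrite in_setD in_setU negb_or zF zX.
    by rewrite in_setD in_setU negb_or xF xX.
  - exact: nF vG vF.
apply: (linked_attach adj_sym lW).
  by rewrite setCS subsetUr.
move=> v; rewrite !in_setC in_setU => vX; rewrite (negPf vX) orbF negbK => vF.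
have [u [vu uF uX]] := out v vF vX; exists u => //.
by rewrite in_setC in_setU negb_or uF.
Qed.

Lemma exchange_pair F S w u b : facet F -> face S -> w \in F -> u \in F -> b \in F ->
  w \in S -> u \in S -> w != u -> adj w b -> adj u b -> b \in S.
Proof.
move=> fF fS wF uF bF wS uS nwu wb ub.
by apply: (facet_face_nbrs fF fS bF wF uF wS uS nwu); rewrite adj_sym.
Qed.

(* Facets at [w] and at [w'] share at most one vertex of [X], so the bound on
   [#|X|] makes their union contain [X]; a facet at [w] that avoids a given [a]
   in [X] then forces [a] into every facet at [w']. *)
Lemma no_twins (X : {set T}) w w' : 2 < k -> #|X| <= 2 * k - 1 -> w != w' ->
  w \notin X -> X = [set u | adj w u] -> X = [set u | adj w' u] -> False.
Proof.
move=> k2 lX nww wX Nw Nw'.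
have XF v F : facet F -> v \in F -> X = [set u | adj v u] -> #|X :&: F| = k.
  move=> fF vF Nv; rewrite -(facet_nbrs fF vF); apply: eq_card => u.
  by rewrite Nv !inE andbC.
(* Otherwise cross from [F] to a facet at [w] that avoids one common neighbour [a]. It keeps two
   others, hence contains [w'] too; but a face with [w] and [w'] contains their common neighbour
   [a]. *)
have sep F : facet F -> w \in F -> w' \notin F.
  move=> fF wF; apply/negP=> w'F.
  have [a] : exists a, a \in X :&: F by apply/card_gt0P; rewrite (XF w).
  case/setIP=> aX aF; have wa : adj w a by move: aX; rewrite Nw inE.
  have w'a : adj w' a by move: aX; rewrite Nw' inE.
  have [F' [fF' _ wF' aF' H]] := facet_exchange fF wF aF wa.
  have faF' := cl_facet_face str fF'.
  suff w'F' : w' \in F'.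
    by have := exchange_pair fF faF' wF w'F aF wF' w'F' nww wa w'a; apply/negP.
  have : 1 < #|(X :&: F) :\ a|.
    by have := cardsD1 a (X :&: F); rewrite (XF w) // in_setI aX aF add1n => E; move: k2; rewrite E.
  case/card_gt1P=> b [c []]; rewrite !in_setD1 !in_setI => /and3P[nba bX bF] /and3P[nca cX cF] nbc.
  have wb : adj w b by move: bX; rewrite Nw inE.
  have wc : adj w c by move: cX; rewrite Nw inE.
  apply: (facet_face_nbrs fF faF' w'F bF cF (H b bF wb nba) (H c cF wc nca) nbc).
    by move: bX; rewrite Nw' inE.
  by move: cX; rewrite Nw' inE.
have le1 F F' : facet F -> w \in F -> facet F' -> w' \in F' -> #|X :&: F :&: F'| <= 1.
  move=> fF wF fF' w'F'; rewrite leqNgt; apply/negP=> /card_gt1P[b [c []]].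
  rewrite !in_setI => /andP[/andP[bX bF] bF'] /andP[/andP[cX cF] cF'] nbc.
  have : w \in F'.
    apply: (facet_face_nbrs fF (cl_facet_face str fF') wF bF cF bF' cF' nbc).
      by move: bX; rewrite Nw inE.
    by move: cX; rewrite Nw inE.
  by move=> wF'; have := sep F' fF' wF'; rewrite w'F'.
have cov F F' : facet F -> w \in F -> facet F' -> w' \in F' -> X \subset F :|: F'.
  move=> fF wF fF' w'F'; have := le1 F F' fF wF fF' w'F'.
  have cU := cardsU (X :&: F) (X :&: F'); rewrite setIACA setIid (XF w) // (XF w') // in cU.
  rewrite -setIA => l1.
  rewrite -[F :|: F']setIid; apply/setIidPl/eqP; rewrite eqEcard setIid subsetIl /= setIUr cU.
  by move: l1 lX; move: #|_| #|X| => a b; move: k_gt1; clear; lia.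
have [F fF wF] := vertex_in_facet w; have [F' fF' w'F'] := vertex_in_facet w'.
have := le1 F F' fF wF fF' w'F'; rewrite leqNgt => /negP; apply.
rewrite (setIidPl (_ : X :&: F \subset F')) ?(XF w) //.
apply/subsetP=> a /setIP[aX aF]; have wa : adj w a by move: aX; rewrite Nw inE.
have [Fa [fFa _ wFa aFa _]] := facet_exchange fF wF aF wa.
by have := subsetP (cov Fa F' fFa wFa fF' w'F') a aX; rewrite in_setU (negPf aFa).
Qed.

(** * Cores of facets and how they join across ridges *)

Section Separator.
Variable X : {set T}.
Notation conn := (connect (within adj (~: X))).

Lemma connC u v : conn u v = conn v u. Proof. exact: linkedC adj_sym _ _ _. Qed.

Definition corner (F : {set T}) w :=
  [/\ w \in F, w \notin X & X :&: F = [set u in F | adj w u]].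

(* What is left of [F] after deleting [X] and the possible isolated corner. *)
Definition core (F B : {set T}) : Prop :=
  [/\ B \subset F :\: X, linked adj B &
    forall v, v \in F -> v \notin X -> v \notin B -> corner F v /\ F :\: X :\ v = B].

Lemma ex_core F : facet F -> #|X :&: F| <= k -> exists B, core F B.
Proof.
move=> fF lX; have [phi lab] := cl_label str fF.
have [lF|[w [wF wX XE lF]]] := facet_linked_or_corner adjE lab k_gt1 lX.
  by exists (F :\: X); split=> // v vF vX; rewrite in_setD vF vX.
exists (F :\: X :\ w); split=> //; first exact: subD1set.
move=> v vF vX; rewrite in_setD1 in_setD vX vF !andbT negbK => /eqP->.
by split.
Qed.

Lemma core_conn F B : core F B -> {in B &, forall u v, conn u v}.
Proof.
case=> BF lB _ u v uB vB; apply: (linked_sub lB) => //.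
by apply: subset_trans BF _; rewrite setDE subsetIr.
Qed.

(** A cube has [2 ^ k > k + 1] vertices, more than [X] and one corner can take away. *)
Lemma core_card F B : facet F -> #|X :&: F| <= k -> core F B -> 0 < #|B|.
Proof.
move=> fF lX [_ _ H]; rewrite lt0n; apply/negP=> /eqP B0.
have c1 : #|F :\: X| <= 1.
  have [->|[v]] := set_0Vmem (F :\: X); first by rewrite cards0.
  rewrite in_setD => /andP[vX vF]; have vB : v \notin B by rewrite (cards0_eq B0) in_set0.
  have [_ E] := H v vF vX vB.
  by have := cardsD1 v (F :\: X); rewrite E B0 => ->; case: (v \in _).
have [phi lab] := cl_label str fF.
have := cardsID X F; rewrite (card_facet lab) setIC => E.
have := ltn_expl k.-1 (isT : 1 < 2); move: E; rewrite -{1}(prednK k_gt0) expnS.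
by move: c1 lX k_gt1; move: #|_ :\: _| #|_ :&: _| (2 ^ _) => a b c; clear; lia.
Qed.

(* [F] and [F'] share the square [{w, a, u, b}]; [X] cuts off the corner [w] of
   [F] and the opposite corner [u] of [F'], and [w], [u] lie in different
   components. By counting, this is the only way in which two adjacent facets may
   fail to have linked cores, and it requires facets of dimension 3. *)
Definition flipped F F' w u a b x y : Prop :=
  [/\ [/\ facet F, facet F', w \in F, w \in F' & u \in F] /\
      [/\ u \in F', w != u, w \notin X, u \notin X & ~~ conn w u],
      [/\ a \in F, a \in F', b \in F, b \in F' & a != b] /\ [/\ x \in F & y \in F'],
      [/\ x \notin F', y \notin F, X :&: F = [set a; b; x] & X :&: F' = [set a; b; y]],
      X :&: F = [set v in F | adj w v] /\ X :&: F' = [set v in F' | adj u v] &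
      (forall v, v \in F -> v \notin X -> v != w -> conn u v) /\
      (forall v, v \in F' -> v \notin X -> v != u -> conn w v)].

Lemma flipped_sym F F' w u a b x y :
  flipped F F' w u a b x y -> flipped F' F u w a b y x.
Proof.
case=> [[[? ? ? ? ?] [? ? ? ? ?]] [[? ? ? ? ?] [? ?]] [? ? ? ?] [? ?] [? ?]].
by do !split=> //; rewrite 1?eq_sym 1?connC.
Qed.

Lemma flipped_swap F F' w u a b x y :
  flipped F F' w u a b x y -> flipped F F' w u b a x y.
Proof.
case=> [[[? ? ? ? ?] [? ? ? ? ?]] [[? ? ? ? ?] [? ?]] [? ? E E'] [? ?] [? ?]].
do !split=> //; rewrite 1?eq_sym //.
  by rewrite E -!setUA; rewrite setUCA.
by rewrite E' -!setUA; rewrite setUCA.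
Qed.

Hypothesis X_facet : forall F, facet F -> #|X :&: F| <= k.

(** Cross from [F] at [w] away from [b]. The ridge retains [w] and one more vertex [s] outside [X],
    in different components, so one of them is a corner of the new facet [F1]. Then [F1] has three
    vertices of [X]: [a], [x] and a new one [z]. It is not [y], since [a] and [y] in [F1] would
    force [u], and [w] and [u] would force [b]. *)
Lemma flipped_ridge F F' w u a b x y : k = 3 ->
    flipped F F' w u a b x y ->
  exists F1 z, [/\ [/\ facet F1, w \in F1, b \notin F1 & a \in F1], [/\ x \in F1, z \in F1 & z \in X],
    [/\ z != a, z != b, z != x & z != y] &
    corner F1 w \/ exists s, [/\ s \in F, s \in F1, s != w & corner F1 s]].
Proof.
move=> k3 [[[fF fF' wF wF' uF] [uF' nwu wX uX nwc]] [[aF aF' bF bF' nab] [xF yF']]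
  [xF' yF EF EF'] [Nw Nu] [connF connF']].
have inX v : v \in [set a; b; x] -> v \in X by rewrite -EF => /setIP[].
have inX' v : v \in [set a; b; y] -> v \in X by rewrite -EF' => /setIP[].
have aX : a \in X by apply: inX; rewrite !inE eqxx.
have bX : b \in X by apply: inX; rewrite !inE eqxx orbT.
have xX : x \in X by apply: inX; rewrite !inE eqxx orbT.
have yX : y \in X by apply: inX'; rewrite !inE eqxx orbT.
have adjw v : v \in X -> v \in F -> adj w v.
  by move=> vX vF; have := in_setI v X F; rewrite Nw inE vX vF.
have adju v : v \in X -> v \in F' -> adj u v.
  by move=> vX vF; have := in_setI v X F'; rewrite Nu inE vX vF.
have nxb : x != b by apply: contraNneq xF' => ->.
have nxa : x != a by apply: contraNneq xF' => ->.
have [F1 [fF1 rR wF1 bF1 H]] := facet_exchange fF wF bF (adjw b bX bF).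
have faF1 := cl_facet_face str fF1.
have aF1 : a \in F1 by apply: H; rewrite ?adjw.
have xF1 : x \in F1 by apply: H; rewrite ?adjw.
have uF1 : u \notin F1.
  apply/negP=> uF1; have := exchange_pair fF faF1 wF uF bF wF1 uF1 nwu (adjw b bX bF) (adju b bX bF').
  exact/negP.
have yF1 : y \notin F1.
  apply/negP=> yF1; case/negP: uF1.
  apply: (facet_face_nbrs fF' faF1 uF' aF' yF' aF1 yF1 _ (adju _ aX aF') (adju _ yX yF')).
  by apply: contraNneq yF => <-.
(* The ridge is a square in which [X] consists of the two neighbours of [w]; so one vertex besides
   [w] is left. *)
have [s [sF sF1 sX nsw]] : exists s, [/\ s \in F, s \in F1, s \notin X & s != w].
  have wR : w \in F :&: F1 by rewrite in_setI wF.
  have : 0 < #|(F :&: F1) :\: X :\ w|.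
    have XR : (F :&: F1) :&: X = [set v in F :&: F1 | adj w v].
      apply/setP=> v; rewrite !inE; have /setP/(_ v) := Nw; rewrite !inE.
      by case: (v \in F); case: (v \in F1); case: (v \in X).
    have := cardsID X (F :&: F1); rewrite XR (ridge_card fF rR) (ridge_nbrs fF rR wR) k3.
    have := cardsD1 w ((F :&: F1) :\: X).
    by rewrite in_setD wX wR /=; move: #|_| #|_| => p q; clear; lia.
  case/card_gt0P=> s; rewrite in_setD1 in_setD in_setI => /and4P[? ? ? ?].
  by exists s.
have us : conn u s by apply: connF.
have [B1 cB1] := ex_core fF1 (X_facet fF1).
have cor v : v \in F1 -> v \notin X -> v \notin B1 -> corner F1 v.
  by move=> vF1 vX vB; case: cB1 => _ _ /(_ v vF1 vX vB)[].
have corner1 : corner F1 w \/ exists s, [/\ s \in F, s \in F1, s != w & corner F1 s].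
  have [wB|wB] := boolP (w \in B1); last by left; apply: cor.
  right; exists s; split=> //; apply: cor => //; apply/negP=> sB.
  case/negP: nwc; apply: connect_trans (core_conn cB1 wB sB) _.
  by rewrite connC.
have [t [tF1 tX]] : exists t, [/\ t \in F1, t \in X & t \notin [set a; x]].
  have cX : #|X :&: F1| = 3.
    by case: corner1 => [[? _ ->]|[t [_ _ _ [? _ ->]]]]; rewrite facet_nbrs.
  have [|t] := @ex_notin _ (X :&: F1) [set a; x].
    by rewrite cX cards2 eq_sym nxa.
  by rewrite in_setI => /andP[? ?] ?; exists t.
rewrite !inE => /norP[nta ntx].
exists F1, t; do !split=> //; first by apply: contraNneq bF1 => <-.
by apply: contraNneq yF1 => <-.
Qed.

(** [a], [b], [x] and [y] are four distinct vertices of [X], which leaves room for one more. *)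
Lemma flipped_fifth F F' w u a b x y z z' : k = 3 -> #|X| <= 5 ->
    flipped F F' w u a b x y -> z \in X -> z' \in X ->
    [/\ z != a, z != b, z != x & z != y] -> [/\ z' != a, z' != b, z' != x & z' != y] ->
  z = z'.
Proof.
move=> k3 lX [_ [[aF aF' bF bF' nab] [xF yF']] [xF' yF EF EF'] _ _] zX z'X.
move=> [za zb zx zy] [z'a z'b z'x z'y]; apply/eqP; apply: contraTT lX => nzz.
have nxa : x != a by apply: contraNneq xF' => ->.
have nxb : x != b by apply: contraNneq xF' => ->.
have nya : y != a by apply: contraNneq yF => ->.
have nyb : y != b by apply: contraNneq yF => ->.
have nxy : x != y by apply: contraNneq yF => <-.
have u6 : uniq [:: z; z'; a; b; x; y].
  by rewrite /= !inE !negb_or nzz za zb zx zy z'a z'b z'x z'y nab !(eq_sym _ x) nxa nxb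
    !(eq_sym _ y) nya nyb (eq_sym y x) nxy.
rewrite -ltnNge; apply: leq_trans (_ : #|[:: z; z'; a; b; x; y]| <= _).
  by rewrite (card_uniqP u6).
apply/subset_leq_card/subsetP=> v.
have inX v' : v' \in [set a; b; x] -> v' \in X by rewrite -EF => /setIP[].
have inX' v' : v' \in [set a; b; y] -> v' \in X by rewrite -EF' => /setIP[].
rewrite !inE => /or4P[/eqP->|/eqP->|/eqP->|/or3P[]/eqP->] //.
- by apply: inX; rewrite !inE eqxx.
- by apply: inX; rewrite !inE eqxx orbT.
- by apply: inX; rewrite !inE eqxx orbT.
- by apply: inX'; rewrite !inE eqxx orbT.
Qed.

(** The corner of [F1] has to be [w]. Exchanging [a] and [b] gives a facet [F2] at [w] without [a]
    but with the same [z]. A corner [s] of [F1] is adjacent to [x] and [z], so it would lie in [F2];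
    then [w] and [s] would force their common neighbour [a] into [F2]. *)
Lemma flipped_corner F F' w u a b x y : k = 3 -> #|X| <= 5 ->
    flipped F F' w u a b x y ->
  exists F1 z, [/\ facet F1, w \in F1, b \notin F1, a \in F1 & z \in F1] /\
    [/\ z \in X, [/\ z != a, z != b, z != x & z != y], adj w a & adj w z].
Proof.
move=> k3 lX fl; have [F1 [z [[fF1 wF1 bF1 aF1] [xF1 zF1 zX] nz cor]]] := flipped_ridge k3 fl.
have [F2 [z2 [[fF2 wF2 aF2 bF2] [xF2 zF2 z2X] [zb za zx zy] _]]] := flipped_ridge k3 (flipped_swap fl).
have ez : z = z2 by apply: (flipped_fifth k3 lX fl).
rewrite -{}ez in zF2 za zb zx zy z2X; exists F1, z.
case: fl => [[[fF fF' wF wF' uF] [uF' nwu wX uX nwc]] [[aF aF' bF bF' nab] [xF yF']]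
  [xF' yF EF EF'] [Nw Nu] [connF connF']].
have aX : a \in X by have := in_setI a X F; rewrite EF !inE eqxx aF andbT.
have xX : x \in X by have := in_setI x X F; rewrite EF !inE eqxx orbT xF andbT.
have wa : adj w a by have := in_setI a X F; rewrite Nw inE aX aF.
do !split=> //.
case: cor => [[_ _ E]|[s [sF sF1 nsw [_ _ E]]]].
  by have := in_setI z X F1; rewrite E inE zX zF1.
have adjs v : v \in X -> v \in F1 -> adj s v.
  by move=> vX vF; have := in_setI v X F1; rewrite E inE vX vF.
have faF2 := cl_facet_face str fF2.
have sF2 : s \in F2.
  apply: (facet_face_nbrs fF1 faF2 sF1 xF1 zF1 xF2 zF2) (adjs _ xX xF1) (adjs _ zX zF1).
  by rewrite eq_sym.
have := exchange_pair fF faF2 wF sF aF wF2 sF2 _ wa (adjs _ aX aF1).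
by rewrite (negPf aF2) eq_sym nsw => /(_ isT).
Qed.

(** By symmetry [u] too is adjacent to [a] and to the fifth vertex [z], within a facet. Both lie in
    [F1], so [u] does; then [w] and [u] force [b] into [F1]. *)
Lemma not_flipped F F' w u a b x y : k = 3 -> #|X| <= 5 -> ~ flipped F F' w u a b x y.
Proof.
move=> k3 lX fl; have [F1 [z [[fF1 wF1 bF1 aF1 zF1] [zX nz wa wz]]]] := flipped_corner k3 lX fl.
have fl' := flipped_sym fl.
have [F2 [z2 [[fF2 uF2 bF2 aF2 zF2] [z2X [za zb zy zx] ua uz]]]] := flipped_corner k3 lX fl'.
have ez : z = z2 by apply: (flipped_fifth k3 lX fl).
rewrite -{}ez in zF2 z2X za zb zx zy uz.
have faF1 := cl_facet_face str fF1.
have uF1 : u \in F1.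
  by apply: (facet_face_nbrs fF2 faF1 uF2 aF2 zF2 aF1 zF1 _ ua uz); rewrite eq_sym.
case: fl => [[[fF fF' wF wF' uF] [uF' nwu wX uX nwc]] [[aF aF' bF bF' nab] [xF yF']]
  [xF' yF EF EF'] [Nw Nu] [connF connF']].
have bX : b \in X by have := in_setI b X F; rewrite EF !inE eqxx orbT bF andbT.
have wb : adj w b by have := in_setI b X F; rewrite Nw inE bX bF.
have ub : adj u b by have := in_setI b X F'; rewrite Nu inE bX bF'.
by have := exchange_pair fF faF1 wF uF bF wF1 uF1 nwu wb ub; rewrite (negPf bF1).
Qed.

(** If the cores are not joined, each vertex of the ridge outside [X] is missing from one of them
    and is a corner there. So there are at most two, and if there is one, [X] meets the ridge in its
    [k - 1] neighbours. Hence [2 ^ (k - 1) <= k + 1], which leaves [k = 3] with equality, the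
    configuration [flipped]. If there is none, [2 ^ (k - 1) <= k], which fails. *)
Lemma ridge_cores F F' B B' : 2 < k -> #|X| <= 2 * k - 1 -> facet F -> facet F' ->
    ridge face F (F :&: F') -> core F B -> core F' B' ->
  exists u v, [/\ u \in B, v \in B' & conn u v].
Proof.
move=> k2 lX fF fF' rR cB cB'; apply: contrapT => nlink.
set R := F :&: F' in rR; pose D := R :\: X.
have DB r : r \in D -> r \notin B -> corner F r /\ F :\: X :\ r = B.
  rewrite in_setD in_setI => /and3P[rX rF rF'] rB.
  by case: cB => _ _ /(_ r rF rX rB).
have DB' r : r \in D -> r \notin B' -> corner F' r /\ F' :\: X :\ r = B'.
  rewrite in_setD in_setI => /and3P[rX rF rF'] rB.
  by case: cB' => _ _ /(_ r rF' rX rB).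
have nBB r : r \in D -> r \in B -> r \in B' -> False.
  by move=> _ rB rB'; apply: nlink; exists r, r; split=> //; apply: connect0.
have c1 : #|D :\: B| <= 1.
  rewrite leqNgt; apply/negP=> /card_gt1P[r [r' [+ + nrr]]].
  rewrite 2!in_setD => /andP[rB rD] /andP[r'B r'D].
  have [_ E] := DB r rD rB; case/negP: r'B; rewrite -E in_setD1 eq_sym nrr.
  by move: r'D; rewrite !in_setD in_setI => /and3P[-> ->].
have c1' : #|D :\: B'| <= 1.
  rewrite leqNgt; apply/negP=> /card_gt1P[r [r' [+ + nrr]]].
  rewrite 2!in_setD => /andP[rB rD] /andP[r'B r'D].
  have [_ E] := DB' r rD rB; case/negP: r'B; rewrite -E in_setD1 eq_sym nrr.
  by move: r'D; rewrite !in_setD in_setI => /and3P[-> _ ->].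
have DU : D \subset (D :\: B) :|: (D :\: B').
  apply/subsetP=> r rD; rewrite in_setU (in_setD D B) (in_setD D B') rD !andbT -negb_and.
  by apply/andP=> -[]; apply: nBB.
have cD : #|D| <= #|D :\: B| + #|D :\: B'|.
  by apply: leq_trans (subset_leq_card DU) _; rewrite leq_card_setU.
have cR := cardsID X R; rewrite (ridge_card fF rR) in cR.
have exp2 := ltn_expl k.-2 (isT : 1 < 2).
have kE : 2 ^ k.-1 = 2 * 2 ^ k.-2 by rewrite -expnS prednK // -ltnS prednK.
have XR r : r \in D -> R :&: X = [set v in R | adj r v].
  move=> rD; have [rB|rB] := boolP (r \in B).
    have rB' : r \notin B' by apply/negP=> /(nBB r rD rB).
    have [[_ _ /setP E] _] := DB' r rD rB'; apply/setP=> v; move: (E v); rewrite !inE.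
    by case: (v \in F); case: (v \in F'); case: (v \in X).
  have [[_ _ /setP E] _] := DB r rD rB; apply/setP=> v; move: (E v); rewrite !inE.
  by case: (v \in F); case: (v \in F'); case: (v \in X).
have [D0|[r rD]] := set_0Vmem D.
  have : #|R :&: X| <= k.
    apply: leq_trans (X_facet fF); apply/subset_leq_card.
    by rewrite setIC; apply: setIS; apply: subsetIl.
  move: cR; rewrite -/D D0 cards0 addn0 kE => ->; move: exp2 k2.
  by move: (2 ^ _) => e; clear; lia.
have cRX r' : r' \in D -> #|R :&: X| = k.-1.
  move=> r'D; rewrite (XR r') // (ridge_nbrs fF rR) //.
  by move: r'D; rewrite in_setD => /andP[].
have [k3 cB1 cB1' cRX2] : [/\ k = 3, #|D :\: B| = 1, #|D :\: B'| = 1 & #|R :&: X| = 2].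
  move: cR (cRX r rD) exp2 k2 cD c1 c1'; rewrite -/D kE.
  move: #|R :&: X| #|D| #|D :\: B| #|D :\: B'| => p q s t; clear.
  case: (k) => [|[|[|[|n]]]] //=; first by rewrite (_ : 2 ^ 1 = 2) // => *; split; lia.
  have := ltn_expl n.+1 (isT : 1 < 2); rewrite !expnS.
  by move: (2 ^ n) => e *; split; lia.
have /cards1P[w Ew] : #|D :\: B| == 1 by rewrite cB1.
have /cards1P[u Eu] : #|D :\: B'| == 1 by rewrite cB1'.
have /setDP[wD wB] : w \in D :\: B by rewrite Ew set11.
have /setDP[uD uB'] : u \in D :\: B' by rewrite Eu set11.
have cD2 : #|D| = 2.
  by move: cR; rewrite -/D cRX2 k3 (_ : 2 ^ 3.-1 = 4) //; move: #|D| => p; clear; lia.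
have nwu : w != u.
  apply: contra_eqN cD2 => /eqP ewu; rewrite neq_ltn; apply/orP; left.
  by move: (subset_leq_card DU); rewrite Ew Eu ewu setUid cards1.
have uB : u \in B by apply: contraNT nwu => uB; rewrite eq_sym -in_set1 -Ew in_setD uB.
have wB' : w \in B' by apply: contraNT nwu => wB'; rewrite -in_set1 -Eu in_setD wB'.
have [wX /setIP[wF wF']] : w \notin X /\ w \in F :&: F' by apply/andP; move: wD; rewrite in_setD.
have [uX /setIP[uF uF']] : u \notin X /\ u \in F :&: F' by apply/andP; move: uD; rewrite in_setD.
have [[_ _ Nw] FB] := DB w wD wB; have [[_ _ Nu] FB'] := DB' u uD uB'.
have /cards2P[a [b [nab Eab]]] : #|R :&: X| == 2 by rewrite cRX2.
have third G : facet G -> R \subset G -> #|X :&: G| = 3 ->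
    exists x, [/\ x \in G, x \notin R & X :&: G = [set a; b; x]].
  move=> fG sRG c3; have sub : R :&: X \subset X :&: G by rewrite setIC setIS.
  have /cards1P[x Ex] : #|(X :&: G) :\: (R :&: X)| == 1.
    by have := cardsID (R :&: X) (X :&: G); rewrite (setIidPr sub) c3 cRX2 => /eqP; rewrite (_ : 3 = 2 + 1) // eqn_add2l.
  have : x \in (X :&: G) :\: (R :&: X) by rewrite Ex set11.
  rewrite in_setD !in_setI => /and3P[xRX xX xG].
  rewrite xX andbT in xRX; exists x; split=> //; first by rewrite in_setI.
  by rewrite -(setID (X :&: G) (R :&: X)) Ex (setIidPr sub) Eab.
have cF : #|X :&: F| = 3 by rewrite Nw (facet_nbrs fF wF) k3.
have cF' : #|X :&: F'| = 3 by rewrite Nu (facet_nbrs fF' uF') k3.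
have [x [xF xR EF]] := third F fF (subsetIl _ _) cF.
have [y [yF' yR EF']] := third F' fF' (subsetIr _ _) cF'.
rewrite in_setI xF /= in xR; rewrite in_setI yF' andbT in yR.
have aRX : a \in R :&: X by rewrite Eab set21.
have bRX : b \in R :&: X by rewrite Eab set22.
rewrite !in_setI in aRX bRX.
have /andP[/andP[aF aF'] aX] := aRX; have /andP[/andP[bF bF'] bX] := bRX.
have [] := @not_flipped F F' w u a b x y k3; first by move: lX; rewrite k3.
do !split=> //.
- by apply/negP=> cwu; apply: nlink; exists u, w; split=> //; rewrite connC.
- move=> v vF vX nvw; apply: (core_conn cB uB); rewrite -FB in_setD1 nvw in_setD vX vF //.
- move=> v vF vX nvw; apply: (core_conn cB' wB'); rewrite -FB' in_setD1 nvw in_setD vX vF //.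
Qed.

End Separator.

Lemma separator_corner (X : {set T}) : 2 < k -> #|X| <= 2 * k - 1 ->
    (forall v, #|X| <= #|[set u | adj v u]|) -> ~ linked adj (~: X) ->
  exists w, [/\ w \notin X, X = [set u | adj w u] & linked adj (~: X :\ w)].
Proof.
move=> k2 lX degX nl.
have X_facet F : facet F -> #|X :&: F| <= k.
  move=> fF; rewrite leqNgt; apply/negP=> gtX; apply: nl.
  have cX := cardsID F X.
  apply: (avoid_facet fF).
    by move: cX gtX lX; move: #|_| #|_| #|_| => p q r; clear; lia.
  move=> v vF vX.
  have [u uN uX] : exists2 u, u \in [set u | adj v u] :\: F & u \notin X :\: F.
    apply: ex_notin; have := cardsID F [set u | adj v u]; have := degX v.
    have -> : [set u | adj v u] :&: F = [set u in F | adj v u].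
      by apply/setP=> u; rewrite !inE andbC.
    rewrite (facet_nbrs fF vF); move: cX gtX.
    by move: #|_| #|_| #|_| #|_| #|_| => p q r s t; clear; lia.
  move: uN uX; rewrite !in_setD inE => /andP[uF vu]; rewrite uF => uX.
  by exists u.
have [b0 [B [bB lB [b0X all_core]]]] : exists b0 (B : {set T}), [/\ b0 \in B, linked adj B &
    B \subset ~: X /\ forall v, v \notin X -> v \notin B -> [set u | adj v u] \subset X].
  have [F0 fF0] : exists F0, facet F0.
    apply: contrapT => nF; apply: nl => u; have [F fF _] := vertex_in_facet u.
    by case: nF; exists F.
  have [B0 cB0] := ex_core fF0 (X_facet _ fF0).
  have /card_gt0P[b0 b0B] := core_card fF0 (X_facet _ fF0) cB0.
  have b0X : b0 \notin X by case: cB0 => /subsetP/(_ _ b0B); rewrite in_setD => /andP[].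
  pose C F := exists2 B, core X F B & {in B, forall v, connect (within adj (~: X)) b0 v}.
  have allC F : facet F -> C F.
    move=> fF.
    have nT G : facet G -> ~~ ([set: T] \subset G).
      move=> fG; have [phi lab] := cl_label str fG; rewrite subTset.
      apply/negP=> /eqP GT; have := min_degree b0.
      suff : [set u | adj b0 u] = [set u in G | adj b0 u].
        by move=> ->; rewrite (facet_nbrs fG) ?ltnn // GT in_setT.
      by apply/setP=> u; rewrite !inE GT in_setT.
    apply: (cl_dual str (A := setT) (C := C) fF0); rewrite ?nT //.
      by exists B0 => // v vB; apply: (core_conn cB0).
    move=> G G' fG fG' _ _ [BG cBG CG] rR _.
    have [B' cB'] := ex_core fG' (X_facet _ fG'); exists B' => // v vB'.
    have [x [y [xB yB' cxy]]] := ridge_cores X_facet k2 lX fG fG' rR cBG cB'.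
    apply: connect_trans (CG _ xB) _; apply: connect_trans cxy _.
    by apply: (core_conn cB').
  (* [B] is the component of [b0]; by [allC] each facet has a core inside it. *)
  pose B := [set v | (v \notin X) && connect (within adj (~: X)) b0 v].
  exists b0, B; split; first by rewrite inE b0X connect0.
  - move=> u v; rewrite !inE => /andP[uX cu] /andP[vX cv].
    have keep x p : path (within adj (~: X)) x p -> x \in B -> path (within adj B) x p.
      elim: p x => //= y p IHp x /andP[xy py] xB.
      have yB : y \in B.
        move: (xy) xB; rewrite /within /= !inE => /and3P[_ yX _] /andP[_ cx].
        by rewrite yX; apply: connect_trans cx (connect1 xy).
      rewrite IHp // andbT; move: xy; rewrite /within /= xB yB.
      by case/and3P.
    have toB x : connect (within adj (~: X)) b0 x -> connect (within adj B) b0 x.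
      case/connectP=> p pp ex; apply/connectP; exists p => //.
      by apply: keep; rewrite // inE b0X connect0.
    by apply: connect_trans (toB v cv); rewrite linkedC ?toB //; apply: adj_sym.
  - split; first by apply/subsetP=> v; rewrite !inE => /andP[].
  (* Take a facet with the edge from [v] to [u]. As [v] is not in its core, [v] is its corner, and
     [u] lies in [X]. *)
  move=> v vX vB; apply/subsetP=> u; rewrite inE => vu.
  have [F [fF vF uF]] := edge_in_facet vu; have [BF cBF BFB] := allC F fF.
  have vBF : v \notin BF.
    apply: contra vB => vBF; rewrite inE vX; exact: BFB vBF.
  have [[_ _ E] _] := (let: And3 _ _ H := cBF in H) v vF vX vBF.
  have : u \in [set u in F | adj v u] by rewrite inE uF.
  by rewrite -E => /setIP[].
have XE v : v \notin X -> v \notin B -> X = [set u | adj v u].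
  by move=> vX vB; apply/eqP; rewrite eq_sym eqEcard (all_core v vX vB) degX.
have [|/subsetPn[w]] := boolP (~: X \subset B).
  move=> sXB; case: nl; suff -> : ~: X = B by [].
  by apply/eqP; rewrite eqEsubset sXB.
rewrite in_setC => wX wB; exists w; split=> //; first exact: XE.
suff -> : ~: X :\ w = B by [].
apply/eqP; rewrite eqEsubset; apply/andP; split; apply/subsetP=> v.
  rewrite in_setD1 in_setC => /andP[nvw vX]; apply: contraT => vB.
  by have := no_twins k2 lX nvw vX (XE v vX vB) (XE w wX wB).
move=> vB; rewrite in_setD1 (subsetP b0X) // andbT.
by apply: contraNneq wB => <-.
Qed.

(** If a square contains [X], it can be avoided, since degrees are at least 3. Otherwise each square
    has at most one vertex of [X], so it stays linked, and each ridge, an edge, keeps a vertex. *)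
Lemma small_linked (X : {set T}) : k = 2 -> #|X| <= 2 -> linked adj (~: X).
Proof.
move=> k2 lX.
have [[F [fF XF]]|nF] := pselect (exists F, facet F /\ X \subset F).
  apply: (avoid_facet fF).
    by have -> : X :\: F = set0; [apply/eqP; rewrite setD_eq0|rewrite cards0 k2].
  move=> v vF vX; have := min_degree v; rewrite k2.
  have [u uN uF] : exists2 u, u \in [set u | adj v u] & u \notin [set u in F | adj v u].
    by apply: ex_notin; rewrite (facet_nbrs fF vF) min_degree.
  rewrite !inE in uN uF; rewrite uN andbT in uF.
  by exists u; split=> //; apply: contra uF => /(subsetP XF).
have X1 F : facet F -> #|X :&: F| <= 1.
  move=> fF; rewrite leqNgt; apply/negP=> X2; apply: nF; exists F; split=> //.
  apply/setIidPl/eqP; rewrite eqEcard subsetIl.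
  exact: leq_trans lX X2.
have lF F : facet F -> linked adj (F :\: X).
  move=> fF; have [phi lab] := cl_label str fF.
  have [//|[w [wF _ E _]]] := facet_linked_or_corner adjE lab k_gt1 (leq_trans (X1 F fF) k_gt0).
  by have := X1 F fF; rewrite E (facet_nbrs fF wF) k2.
have sub (F : {set T}) : F :\: X \subset ~: X by rewrite setDE subsetIr.
move=> u v uX vX.
have [F fF uF] := vertex_in_facet u; have [G fG vG] := vertex_in_facet v.
pose C H := forall x, x \in H :\: X -> connect (within adj (~: X)) u x.
have nT H : facet H -> ~~ ([set: T] \subset H).
  move=> fH; have [phi lab] := cl_label str fH; rewrite subTset.
  apply/negP=> /eqP HT; have := min_degree u.
  suff : [set x | adj u x] = [set x in H | adj u x].
    by move=> ->; rewrite (facet_nbrs fH) ?ltnn // HT in_setT.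
  by apply/setP=> x; rewrite !inE HT in_setT.
rewrite in_setC in uX; rewrite in_setC in vX.
suff : C G by apply; rewrite in_setD vX.
apply: (cl_dual str (A := setT) (C := C) fF); rewrite ?nT //.
  by move=> x xF; apply: (linked_sub (lF F fF)) => //; rewrite in_setD uX.
move=> H H' fH fH' _ _ CH rR _ x xH'.
have [z] : exists2 z, z \in H :&: H' & z \notin X :&: H.
  by apply: ex_notin; rewrite (ridge_card fH rR) k2; apply: leq_ltn_trans (X1 H fH) _.
rewrite !in_setI => /andP[zH zH']; rewrite zH andbT => zX.
apply: connect_trans (CH z _) _; first by rewrite in_setD zX.
by apply: (linked_sub (lF H' fH')) => //; rewrite in_setD zX.
Qed.

End CubicalGraph.

Lemma double_count (I J : finType) (A : {set I}) (B : {set J}) (r : I -> J -> bool) :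
  \sum_(i in A) #|[set j in B | r i j]| = \sum_(j in B) #|[set i in A | r i j]|.
Proof.
have E (K : finType) (C : {set K}) (q : pred K) : #|[set x in C | q x]| = \sum_(x in C) q x.
  by rewrite -sum1_card big_mkcond [RHS]big_mkcond; apply: eq_bigr => x _; rewrite inE; case: (x \in C); case: (q x).
rewrite (eq_bigr _ (fun i _ => E _ _ _)) exchange_big.
by apply: eq_bigr => j _; rewrite E.
Qed.

(** * Dimension 3: a vertex of degree at most 3 *)

Section CubicalSphere.
Import Order.TTheory.
Variables (T : finType) (adj : rel T) (face facet : {set T} -> Prop).
Variables (disp : Order.disp_t) (R : orderType disp) (h : T -> R).
Hypothesis str : cubical_lattice 2 adj face facet.

(** For a square these are the angles that the level plane through [v] enters, which is why a vertex
    of a 3-polytope has at most two of them. *)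
Definition mixed (F : {set T}) v : bool :=
  [exists u in F, exists u' in F, [&& adj v u, adj v u' & (h u < h v < h u')%O]].

Hypothesis mixed_facet : forall F, facet F -> 1 < #|[set v in F | mixed F v]|.
Hypothesis mixed_vertex : forall v,
  #|[set F : {set T} | [&& `[< facet F >], v \in F & mixed F v]]| <= 2.

(** A square at [v] contains two edges at [v], and each edge lies in at least two squares. *)
Lemma facets_at v :
  #|[set u | adj v u]| <= #|[set F : {set T} | `[< facet F >] & v \in F]|.
Proof.
set S := [set F : {set T} | _].
have := double_count S [set u | adj v u] (fun F u => u \in F).
have -> : \sum_(F in S) #|[set u in [set u | adj v u] | u \in F]| = 2 * #|S|.
  rewrite mulnC -sum_nat_const; apply: eq_bigr => F; rewrite inE => /andP[/asboolP fF vF].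
  by rewrite -(facet_nbrs str fF vF); apply: eq_card => u; rewrite !inE andbC.
move=> E; rewrite -(leq_pmul2l (isT : 0 < 2)) E mulnC -sum_nat_const.
apply: leq_sum => u; rewrite inE => vu.
have [F [fF vF uF]] := edge_in_facet str vu.
have /card_gt0P[b] : 0 < #|[set x in F | adj v x] :\ u|.
  by have := cardsD1 u [set x in F | adj v x]; rewrite (facet_nbrs str fF vF) inE uF vu; case: #|_|.
rewrite !inE => /and3P[nbu bF vb].
have [F' [fF' _ vF' bF' H]] := facet_exchange str fF vF bF vb.
have uF' : u \in F' by apply: H => //; rewrite eq_sym.
apply/card_gt1P; exists F, F'; rewrite !inE vF uF vF' uF'; split; rewrite ?andbT; try exact/asboolP.
by apply: contraNneq bF' => <-.
Qed.

(* If all degrees were at least 4, the [f] squares would satisfy [f >= #|T|]. But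
   a square has at least two mixed angles, a vertex at most two and the highest
   vertex none, so [f <= #|T| - 1]. *)
Lemma exists_degree_le3 (v0 : T) : exists v, #|[set u | adj v u]| <= 3.
Proof.
apply: contrapT => /forallNP H.
have deg4 v : 4 <= #|[set F : {set T} | `[< facet F >] & v \in F]|.
  by apply: leq_trans (facets_at v); rewrite ltnNge; apply/negP.
pose S := [set F : {set T} | `[< facet F >]].
have E1 : \sum_(F in S) #|[set v in [set: T] | v \in F]| = 4 * #|S|.
  rewrite mulnC -sum_nat_const; apply: eq_bigr => F; rewrite inE => /asboolP fF.
  have [phi lab] := cl_label str fF; rewrite -[RHS](card_facet lab).
  by apply: eq_card => v; rewrite !inE.
have l1 : 4 * #|T| <= 4 * #|S|.
  rewrite -E1 double_count [X in X <= _]mulnC -cardsT -sum_nat_const.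
  apply: leq_sum => v _; apply: leq_trans (deg4 v) _.
  by apply/eq_leq/eq_card=> F; rewrite !inE.
have E2 : 2 * #|S| <= \sum_(F in S) #|[set v in [set: T] | (v \in F) && mixed F v]|.
  rewrite mulnC -sum_nat_const; apply: leq_sum => F; rewrite inE => /asboolP fF.
  apply: leq_trans (mixed_facet fF) _.
  by apply/eq_leq/eq_card=> v; rewrite !inE.
have [vm _ vmP] := Order.TotalTheory.arg_maxP h (isT : predT v0).
have m0 : #|[set F in S | (vm \in F) && mixed F vm]| = 0.
  apply/eqP; rewrite cards_eq0; apply/eqP/setP=> F; rewrite !inE.
  apply/negbTE/negP=> /and3P[_ _ /exists_inP[u _ /exists_inP[u' _ /and4P[_ _ _ hv]]]].
  by have := vmP u' isT; rewrite /= leNgt hv.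
move: E2; rewrite double_count (big_setD1 vm) ?in_setT //= m0 add0n.
have : \sum_(v in [set: T] :\ vm) #|[set F in S | (v \in F) && mixed F v]| <= #|[set: T] :\ vm| * 2.
  rewrite -sum_nat_const; apply: leq_sum => v _.
  by apply: leq_trans (mixed_vertex v); apply/eq_leq/eq_card=> F; rewrite !inE.
have := cardsD1 vm [set: T]; rewrite in_setT cardsT add1n.
by move: l1; move: #|T| #|S| #|_| (\sum_(_ in _) _) => p q r s; clear; lia.
Qed.

End CubicalSphere.

(** * Faces and linear functionals *)

Import Order.TTheory GRing.Theory Num.Theory.
Local Open Scope ring_scope.

(** * Evaluation of functionals and Farkas' lemma *)

Section Functionals.
Variables (R : realFieldType) (m : nat).
Implicit Types (c f g h : 'cV[R]_m) (x y z : 'rV[R]_m).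

Definition ev c x : R := (x *m c) 0 0.

Lemma ev0 c : ev c 0 = 0. Proof. by rewrite /ev mul0mx mxE. Qed.
Lemma evD c x y : ev c (x + y) = ev c x + ev c y.
Proof. by rewrite /ev mulmxDl mxE. Qed.
Lemma evZ c a x : ev c (a *: x) = a * ev c x.
Proof. by rewrite /ev -scalemxAl mxE. Qed.
Lemma evN c x : ev c (- x) = - ev c x.
Proof. by rewrite -scaleN1r evZ mulN1r. Qed.
Lemma evB c x y : ev c (x - y) = ev c x - ev c y.
Proof. by rewrite evD evN. Qed.
Lemma ev_sum c (I : Type) (r : seq I) (P : pred I) (F : I -> 'rV[R]_m) :
  ev c (\sum_(i <- r | P i) F i) = \sum_(i <- r | P i) ev c (F i).
Proof. by apply: (big_morph (ev c)); [apply: evD|apply: ev0]. Qed.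
Lemma evDl c g x : ev (c + g) x = ev c x + ev g x.
Proof. by rewrite /ev mulmxDr mxE. Qed.
Lemma evZl c a x : ev (a *: c) x = a * ev c x.
Proof. by rewrite /ev -scalemxAr mxE. Qed.
Lemma evNl c x : ev (- c) x = - ev c x.
Proof. by rewrite -scaleN1r evZl mulN1r. Qed.
Definition evE := (evD, evZ, evN, evDl, evZl, evNl).

Lemma ev_eq0 c x : (ev c x == 0) = (x *m c == 0).
Proof.
apply/eqP/eqP=> [E|]; last by rewrite /ev => ->; rewrite mxE.
by apply/matrixP=> i j; rewrite !ord1 [RHS]mxE.
Qed.

Lemma ev_sub0 k (M : 'M_(k, m)) c x : (M <= kermx c)%MS -> (x <= M)%MS -> ev c x = 0.
Proof. by move=> Mc xM; apply/eqP; rewrite ev_eq0 -sub_kermx (submx_trans xM). Qed.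

Lemma sub_ker_ev c x : (x <= kermx c)%MS = (ev c x == 0).
Proof. by rewrite sub_kermx ev_eq0. Qed.

Lemma separating_functional k (M : 'M_(k, m)) x :
  ~~ (x <= M)%MS -> exists c, (M <= kermx c)%MS /\ ev c x != 0.
Proof.
rewrite submxE => nx; have [j nj] : exists j, (x *m cokermx M) 0 j != 0.
  apply: contrapT => /forallNP H; case/eqP: nx; apply/rowP=> j; rewrite [RHS]mxE.
  by apply/eqP; apply: contrapT => /negP; apply: H.
exists (col j (cokermx M)); split.
  by rewrite sub_kermx colE mulmxA mulmx_coker mul0mx.
by rewrite /ev colE mulmxA -colE mxE.
Qed.

Lemma dependent n k (M : 'M_(k, m)) (y : 'I_n -> 'rV[R]_m) :
  (forall i, (y i <= M)%MS) -> (\rank M < n)%N ->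
  exists2 t : 'I_n -> R, exists i, t i != 0 & \sum_i t i *: y i = 0.
Proof.
move=> yM rM; pose Y := \matrix_i y i.
have YM : (Y <= M)%MS by apply/row_subP=> i; rewrite rowK.
have : kermx Y != 0.
  by rewrite kermx_eq0 /row_free neq_ltn (leq_ltn_trans (mxrankS YM) rM).
rewrite -nz_row_eq0; set t := nz_row _ => nt; exists (fun i => t 0 i).
  apply: contrapT => /forallNP H; case/eqP: nt; apply/rowP=> i; rewrite [RHS]mxE.
  by apply/eqP; apply: contrapT => /negP; apply: H.
have : t *m Y = 0 by apply/sub_kermxP; apply: nz_row_sub.
rewrite mulmx_sum_row => E; rewrite -[RHS]E.
by apply: eq_bigr => i _; rewrite rowK.
Qed.

(** Passing to signs makes later contradictions linear: for instance, three pairwise opposite signs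
    all vanish. *)
Lemma opposite_sg (a b s t : R) : 0 < a -> 0 < b -> s * a + t * b = 0 -> Num.sg t = - Num.sg s.
Proof.
move=> a0 b0 E; have {E} -> : t = - s * (a / b).
  by apply: (mulIf (lt0r_neq0 b0)); rewrite -mulrA divfK ?lt0r_neq0 // mulNr; apply/eqP; rewrite -addr_eq0 addrC E.
by rewrite sgrM sgrN (gtr0_sg (divr_gt0 a0 b0)) mulr1.
Qed.

(* Induction on the generators (Bartl): a functional [x0] that violates the claim
   only because of the generator [t] serves to project along [p t]. *)
Lemma farkas (T : finType) (A : {set T}) (p : T -> 'rV[R]_m) x :
    (forall c, (forall v, v \in A -> 0 <= ev c (p v)) -> 0 <= ev c x) ->
  exists a : T -> R, [/\ forall v, 0 <= a v, forall v, v \notin A -> a v = 0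
                       & x = \sum_v a v *: p v].
Proof.
have [n] := ubnP #|A|; elim: n => // n IHn in A p x *; rewrite ltnS => leAn H.
have [A0|[t tA]] := set_0Vmem A.
  exists (fun=> 0); split=> //; rewrite big1 => [|v _]; last by rewrite scale0r.
  apply/eqP; rewrite -submx0; apply: contrapT => /negP/separating_functional[c [_ /eqP]].
  apply; apply/eqP; rewrite eq_le; apply/andP; split; last by apply: H => v; rewrite A0 inE.
  by rewrite -oppr_ge0 -evNl; apply: H => v; rewrite A0 inE.
have cA : (#|A :\ t| < n)%N by have := cardsD1 t A; rewrite tA; lia.
have [H'|] := pselect (forall c, (forall v, v \in A :\ t -> 0 <= ev c (p v)) -> 0 <= ev c x).
  have [a [a0 aA ->]] := IHn _ _ _ cA H'; exists a; split=> // v vA; apply: aA.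
  by rewrite in_setD1 negb_and vA orbT.
case/existsNP=> x0 /not_implyP[x0p /negP]; rewrite -ltNge => x0x.
have pt0 : ev x0 (p t) < 0.
  rewrite ltNge; apply/negP=> pt; move: x0x; rewrite ltNge H // => v vA.
  by have [->//|nvt] := eqVneq v t; apply: x0p; rewrite in_setD1 nvt.
pose r y := y - (ev x0 y / ev x0 (p t)) *: p t.
have H' c : (forall v, v \in A :\ t -> 0 <= ev c (r (p v))) -> 0 <= ev c (r x).
  (* [c'] is [c] composed with the projection, so it vanishes at [p t] and the hypothesis on all of
     [A] applies. *)
  pose c' := c - (ev c (p t) / ev x0 (p t)) *: x0.
  have c'E y : ev c' y = ev c (r y) by rewrite /c' /r !evE; ring.
  have c't : ev c' (p t) = 0 by rewrite /c' !evE divfK ?subrr // lt_eqF.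
  move=> Hc; rewrite -c'E; apply: H => v vA.
  have [->|nvt] := eqVneq v t; first by rewrite c't.
  by rewrite c'E; apply: Hc; rewrite in_setD1 nvt.
have [a [a0 aA E]] := IHn _ (fun v => r (p v)) (r x) cA H'.
have at0 : a t = 0 by apply: aA; rewrite !inE eqxx.
(* The multiple of [p t] lost by projecting: a quotient of two negative numbers, as [x0] is
   nonnegative at the other generators. *)
pose s := (ev x0 x - \sum_v a v * ev x0 (p v)) / ev x0 (p t).
exists (fun v => if v == t then s else a v); split.
- move=> v; case: eqP => // _; rewrite /s mulr_le0 ?invr_le0 ?(ltW pt0) //.
  rewrite subr_le0 (le_trans (ltW x0x)) // sumr_ge0 // => u _.
  have [->|nut] := eqVneq u t; first by rewrite at0 mul0r.
  have [uA|uA] := boolP (u \in A); first by rewrite mulr_ge0 ?x0p // in_setD1 nut.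
  by rewrite aA ?mul0r // in_setD1 negb_and uA orbT.
- move=> v vA; case: eqP => [evt|_]; first by rewrite evt tA in vA.
  by apply: aA; rewrite in_setD1 negb_and vA orbT.
rewrite (bigD1 t) //= eqxx.
have -> : \sum_(i | i != t) (if i == t then s else a i) *: p i = \sum_v a v *: p v.
  rewrite [RHS](bigD1 t) //= at0 scale0r add0r.
  by apply: eq_bigr => v /negPf->.
move: E; rewrite /r; under eq_bigr do rewrite scalerBr scalerA.
rewrite sumrB -scaler_suml => /eqP; rewrite subr_eq => /eqP->.
rewrite /s mulrBl scalerBl mulr_suml [RHS]addrC addrA addrAC; congr (_ - _ *: _ + _).
by apply: eq_bigr => v _; rewrite mulrA.
Qed.

End Functionals.

(** * Faces as zero sets of nonnegative functionals *)

Section FaceLattice.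
Variables (R : realFieldType) (m : nat) (T : finType) (p : T -> 'rV[R]_m).
Implicit Types (A B D F G : {set T}) (c f g h : 'cV[R]_m) (x y z : 'rV[R]_m).

Definition sp A : 'M[R]_m := (\sum_(v in A) <<p v>>)%MS.

Definition zeros c A := [set v in A | ev c (p v) == 0].

Definition nonneg c A := forall v, v \in A -> 0 <= ev c (p v).

Definition exposes c A := nonneg c setT /\ A = zeros c setT.

Definition lface A := exists c, exposes c A.

Definition lfacet A := lface A /\ (\rank (sp A)).+1 = \rank (sp setT).

Lemma p_sp A v : v \in A -> (p v <= sp A)%MS.
Proof. by move=> vA; rewrite /sp (sumsmx_sup v) // genmxE. Qed.

Lemma sp_subP k A (M : 'M_(k, m)) :
  reflect (forall v, v \in A -> (p v <= M)%MS) (sp A <= M)%MS.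
Proof. by apply: (iffP sumsmx_subP) => H v /H; rewrite genmxE. Qed.

Lemma spS A B : A \subset B -> (sp A <= sp B)%MS.
Proof. by move=> sAB; apply/sp_subP=> v /(subsetP sAB); apply: p_sp. Qed.

Lemma sp_ker c A : A \subset zeros c A -> (sp A <= kermx c)%MS.
Proof.
by move=> H; apply/sp_subP=> v /(subsetP H); rewrite inE sub_ker_ev => /andP[].
Qed.

Lemma zerosP c A v : (v \in zeros c A) = (v \in A) && (ev c (p v) == 0).
Proof. by rewrite inE. Qed.

Lemma zeros_ker c A : (sp (zeros c A) <= kermx c)%MS.
Proof. by apply: sp_ker; apply/subsetP=> v; rewrite !zerosP => /andP[-> ->]. Qed.

Lemma exposes_gt0 c A v : exposes c A -> v \notin A -> 0 < ev c (p v).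
Proof.
case=> c0 ->; rewrite zerosP in_setT /= => nv.
by rewrite lt_neqAle eq_sym nv c0 ?in_setT.
Qed.

Lemma exposes_eq0 c A v : exposes c A -> v \in A -> ev c (p v) = 0.
Proof. by case=> _ ->; rewrite zerosP => /andP[_ /eqP]. Qed.

Lemma exposes_ge0 c A v : exposes c A -> 0 <= ev c (p v).
Proof. by case=> c0 _; apply: c0; rewrite in_setT. Qed.

Lemma exposesP c A : (forall v, 0 <= ev c (p v)) ->
  (forall v, (v \in A) = (ev c (p v) == 0)) -> exposes c A.
Proof.
move=> c0 cA; split=> [v _|]; first exact: c0.
by apply/setP=> v; rewrite zerosP in_setT cA.
Qed.

Lemma exposes_ker c A : exposes c A -> (sp A <= kermx c)%MS.
Proof. by case=> _ ->; apply: zeros_ker. Qed.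

Lemma exposes_notin c A v : exposes c A -> v \notin A -> ~~ (p v <= sp A)%MS.
Proof.
move=> cA vA; apply/negP=> pv; have := exposes_gt0 cA vA.
by rewrite (ev_sub0 (exposes_ker cA) pv) ltxx.
Qed.

Lemma lface_I A B : lface A -> lface B -> lface (A :&: B).
Proof.
move=> [c cA] [d dB]; exists (c + d); apply: exposesP => v; rewrite evDl.
  by rewrite addr_ge0 ?(exposes_ge0 _ cA) ?(exposes_ge0 _ dB).
rewrite paddr_eq0 ?(exposes_ge0 _ cA) ?(exposes_ge0 _ dB) // in_setI.
by case: cA dB => _ -> [_ ->]; rewrite !zerosP in_setT.
Qed.

(* Add a large multiple of the functional exposing [A]. *)
Lemma lface_zeros A c : lface A -> nonneg c A -> lface (zeros c A).
Proof.
case=> f fA c0; pose N := 1 + \sum_(v in ~: A) `|ev c (p v)| / ev f (p v).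
have big v : v \notin A -> 0 < N * ev f (p v) + ev c (p v).
  move=> vA; have f0 := exposes_gt0 fA vA.
  have : `|ev c (p v)| / ev f (p v) < N.
    rewrite /N (bigD1 v) ?inE //= addrCA ltrDl ltr_pwDl ?ltr01 // sumr_ge0 // => u.
    by rewrite inE => /andP[uA _]; rewrite divr_ge0 // ltW // (exposes_gt0 fA).
  rewrite ltr_pdivrMr // => lN.
  by have := ler_norm (- ev c (p v)); rewrite normrN; lra.
exists (N *: f + c); apply: exposesP => v; rewrite !evE; have [vA|vA] := boolP (v \in A).
- by rewrite (exposes_eq0 fA vA) mulr0 add0r c0.
- exact: ltW (big v vA).
- by rewrite (exposes_eq0 fA vA) mulr0 add0r zerosP vA.
- by rewrite zerosP (negPf vA) /= gt_eqF // big.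
Qed.

(** The ratio test: [t] is the least [ev c / - ev g] over the vertices where [g] is negative, the
    last moment before [c + t *: g] becomes negative. It is positive because [c] vanishes at none of
    these vertices. *)
Lemma tilt A c g :
    nonneg c A -> nonneg g (zeros c A) -> (exists2 v, v \in A & ev g (p v) < 0) ->
  exists t v, [/\ 0 < t, nonneg (c + t *: g) A, v \in A, ev g (p v) < 0
                & ev (c + t *: g) (p v) = 0].
Proof.
move=> c0 g0 [v0 v0A gv0].
pose Q v := (v \in A) && (ev g (p v) < 0).
pose q v := ev c (p v) / - ev g (p v).
have [v /andP[vA gv] vmin] := Order.TotalTheory.arg_minP q (introT andP (conj v0A gv0) : Q v0).
have cpos u : Q u -> 0 < ev c (p u).
  case/andP=> uA gu; rewrite lt_neqAle c0 // andbT eq_sym.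
  by apply: contraTN gu => /eqP cu; rewrite -leNgt g0 // zerosP uA cu eqxx.
have cv : 0 < ev c (p v) by apply: cpos; rewrite /Q vA gv.
exists (q v), v; split=> //.
- by rewrite divr_gt0 // oppr_gt0.
- move=> u uA; rewrite !evE.
  have [gu|gu] := ltP (ev g (p u)) 0; last first.
    by rewrite addr_ge0 ?c0 // mulr_ge0 // ltW // divr_gt0 ?oppr_gt0.
  have := vmin u; rewrite /Q uA gu => /(_ isT); rewrite /= {2}/q ler_pdivlMr ?oppr_gt0 //.
  by rewrite mulrN -subr_ge0 opprK.
- by rewrite !evE /q invrN mulrN mulNr divfK ?subrr // lt_eqF.
Qed.

(** While the zeros of [c] have corank at least 2 in [D], some functional vanishes on them and at
    [z] but not on all of [D]; tilting by it adds a zero and keeps the value at [z]. That value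
    keeps the zeros from filling [D], and its sign steers the dual simplex step. *)
Lemma facet_extension D c z :
    nonneg c D -> (z <= sp D)%MS -> ev c z != 0 ->
  exists c', [/\ nonneg c' D, ev c' z = ev c z, zeros c D \subset zeros c' D
               & (\rank (sp (zeros c' D))).+1 = \rank (sp D)].
Proof.
have [n] := ubnP (\rank (sp D) - \rank (sp (zeros c D))).
elim: n => // n IHn in c *; rewrite ltnS => len c0 zD cz.
have sZD : (sp (zeros c D) <= sp D)%MS by apply: spS; apply/subsetP=> v; rewrite zerosP => /andP[].
have ltr : (\rank (sp (zeros c D)) < \rank (sp D))%N.
  apply: rank_ltmx; rewrite ltmxE sZD; apply/negP=> sDZ.
  by case/eqP: cz; apply: ev_sub0 (zeros_ker c D) (submx_trans zD sDZ).
have [eqr|neqr] := eqVneq (\rank (sp (zeros c D))).+1 (\rank (sp D)).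
  by exists c.
pose M := (sp (zeros c D) + z)%MS.
have [v vD vM] : exists2 v, v \in D & ~~ (p v <= M)%MS.
  apply: contrapT => H; have : (sp D <= M)%MS.
    apply/sp_subP=> v vD; apply: contrapT => /negP vM; apply: H; by exists v.
  move/mxrankS; have := mxrank_adds_leqif (sp (zeros c D)) z; rewrite -/M => /leqifP.
  have := rank_leq_row z; move: neqr ltr; case: ifP => _; lia.
have [g [Mg gv]] := separating_functional vM.
have [g' [Mg' g'v]] : exists g', (M <= kermx g')%MS /\ ev g' (p v) < 0.
  have [gneg|gpos|g0] := ltgtP (ev g (p v)) 0; last by rewrite g0 eqxx in gv.
    by exists g.
  exists (- g); rewrite evNl oppr_lt0; split=> //.
  by rewrite sub_kermx mulmxN oppr_eq0 -sub_kermx.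
have Zg' u : u \in zeros c D -> ev g' (p u) = 0.
  by move=> uZ; apply: ev_sub0 Mg' _; apply: submx_trans (p_sp uZ) (addsmxSl _ _).
have [||t [v1 [t0 ct0 v1D gv1 cv1]]] := tilt c0 (g := g').
- by move=> u /Zg'->.
- by exists v.
have sZ : zeros c D \subset zeros (c + t *: g') D.
  apply/subsetP=> u uZ; rewrite zerosP !evE Zg' // mulr0 addr0.
  by move: uZ; rewrite zerosP.
have ltZ : (\rank (sp (zeros c D)) < \rank (sp (zeros (c + t *: g') D)))%N.
  apply: rank_ltmx; rewrite ltmxE spS //=; apply/negP=> sub.
  have : (p v1 <= M)%MS.
    apply: submx_trans (addsmxSl _ _); apply: submx_trans sub; apply: p_sp.
    by rewrite zerosP v1D cv1 eqxx.
  by move/(ev_sub0 Mg') => g10; rewrite g10 ltxx in gv1.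
have zt : ev (c + t *: g') z = ev c z.
  by rewrite !evE (ev_sub0 Mg' (addsmxSr _ _)) mulr0 addr0.
have [||//||c' [c'0 c'z sZ' rk]] := IHn (c + t *: g').
- by move: len ltr ltZ; clear; lia.
- exact: ct0.
- by rewrite zt.
by exists c'; split=> //; [rewrite c'z zt|apply: subset_trans sZ'].
Qed.

Lemma rank_lt_exposes c A v : exposes c A -> v \notin A -> (\rank (sp A) < \rank (sp setT))%N.
Proof.
move=> cA vA; apply: rank_ltmx; rewrite ltmxE spS ?subsetT //=.
apply/negP=> sub; case/negP: (exposes_notin cA vA).
by apply: submx_trans sub; rewrite p_sp ?in_setT.
Qed.

Lemma facet_missing A : lfacet A -> exists v, v \notin A.
Proof.
case=> _ rA; apply: contrapT => /forallNP H.
have AT : A = setT by apply/setP=> v; rewrite in_setT; apply/negPn/negP; apply: H.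
by move: rA; rewrite AT => /eqP; rewrite eqn_leq ltnn.
Qed.

(** Within the span of all vertices, the kernel of [f] is proper and contains [sp A], which has
    corank 1; so they coincide. *)
Lemma facet_span f A x : exposes f A -> lfacet A ->
  (x <= sp setT)%MS -> ev f x = 0 -> (x <= sp A)%MS.
Proof.
move=> fA lA xT fx; apply: contrapT => /negP nx.
have [v vA] := facet_missing lA.
have lt : (sp A < sp A + x)%MS.
  rewrite ltmxE addsmxSl /=; apply: contra nx => H; apply: submx_trans H; exact: addsmxSr.
have sub : (sp A + x <= sp setT)%MS by rewrite addsmx_sub xT spS ?subsetT.
have := rank_ltmx lt; rewrite (lA.2) => le.
have : (sp setT <= sp A + x)%MS by rewrite -(mxrank_leqif_sup sub).2 eqn_leq le mxrankS.
move=> TA; have := exposes_gt0 fA vA.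
have -> : ev f (p v) = 0; last by rewrite ltxx.
apply: ev_sub0 (submx_trans (p_sp (in_setT v)) TA).
by rewrite addsmx_sub exposes_ker // sub_ker_ev fx eqxx.
Qed.

Lemma facet_max A B : lfacet A -> lface B -> A \subset B -> (exists v, v \notin B) -> A = B.
Proof.
move=> lA [c cB] sAB [v vB]; apply/eqP; rewrite eqEsubset sAB; apply/subsetP=> u uB.
apply: contrapT => /negP uA; have [f fA] := lA.1.
have lt : (sp A < sp B)%MS.
  rewrite ltmxE spS //=; apply/negP=> BA; case/negP: (exposes_notin fA uA).
  exact: submx_trans (p_sp uB) BA.
by have := rank_ltmx lt; rewrite (lA.2) leqNgt (rank_lt_exposes cB vB).
Qed.

Lemma lfacet_max A B : lfacet A -> lfacet B -> A \subset B -> A = B.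
Proof. by move=> lA lB sAB; apply: facet_max lB.1 sAB (facet_missing lB). Qed.

(* Rotating the supporting hyperplane of [F] about its ridge [zeros h F]. *)
Lemma pivot F f h : exposes f F -> lfacet F -> nonneg h F ->
    (\rank (sp (zeros h F))).+1 = \rank (sp F) ->
  exists f' G s t, [/\ exposes f' G, lfacet G, F :&: G = zeros h F, 0 < t
                     & f' = s *: f + t *: h].
Proof.
move=> fF lF h0 rR; have [v vF] := facet_missing lF; have fv := exposes_gt0 fF vF.
(* [g] agrees with [h] on [F], where [f] vanishes, and [K] makes it [-1] at [v], so that the tilt by
   [g] stops. *)
pose K := (ev h (p v) + 1) / ev f (p v); pose g := h - K *: f.
have gF u : u \in F -> ev g (p u) = ev h (p u).
  by move=> uF; rewrite /g !evE (exposes_eq0 fF uF) mulr0 subr0.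
have zF : zeros f setT = F by case: fF.
have [|||t [v1 [t0 f'0 _ gv1 f'v1]]] := @tilt setT f g.
- by move=> u _; apply: exposes_ge0 fF.
- by move=> u; rewrite zF => uF; rewrite gF ?h0.
- exists v; rewrite ?in_setT // /g !evE divfK ?gt_eqF //.
  by rewrite opprD addNKr oppr_lt0 ltr01.
set f' := f + t *: g in f'0 f'v1 *; pose G := zeros f' setT.
have f'G : exposes f' G by [].
have f'F u : u \in F -> ev f' (p u) = t * ev h (p u).
  by move=> uF; rewrite /f' evDl evZl gF // (exposes_eq0 fF uF) add0r.
have FG : F :&: G = zeros h F.
  apply/setP=> u; rewrite in_setI !zerosP in_setT /=; have [uF|//] := boolP (u \in F).
  by rewrite f'F // mulf_eq0 gt_eqF.
have v1F : v1 \notin F by apply/negP=> v1F; move: gv1; rewrite gF // ltNge h0.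
have ltRG : (\rank (sp (zeros h F)) < \rank (sp G))%N.
  apply: rank_ltmx; rewrite ltmxE -FG spS ?subsetIr //=; apply/negP=> sub.
  case/negP: (exposes_notin fF v1F); apply: submx_trans (spS (subsetIl F G)).
  by apply: submx_trans sub; rewrite p_sp // zerosP in_setT f'v1 eqxx.
have [w wF wG] : exists2 w, w \in F & w \notin G.
  apply: contrapT => H; have : F = zeros h F.
    rewrite -FG; apply/esym/setIidPl/subsetP=> u uF; apply: contrapT => /negP uG.
    by apply: H; exists u.
  by move=> E; move: rR; rewrite -E => /eqP; rewrite eqn_leq ltnn.
have ltG := rank_lt_exposes f'G wG.
exists f', G, (1 - t * K), t; split=> //.
  split; first by exists f'.
  by apply/eqP; rewrite eqn_leq ltG -(lF.2) -rR !ltnS.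
by rewrite /f' /g scalerBr scalerBl scale1r scalerA addrA addrAC.
Qed.

Notation ridge := (ridge lface).

Lemma sum_sp A B : A \subset B -> ((\sum_(v in A) p v)%R <= sp B)%MS.
Proof. by move=> sAB; apply: summx_sub => v vA; rewrite p_sp // (subsetP sAB). Qed.

(** The sum over [A] stands for a relative interior point: a functional nonnegative on [A] vanishes
    there only if it vanishes on [A]. *)
Lemma ev_sum_gt0 c A v : nonneg c A -> v \in A -> ev c (p v) != 0 ->
  0 < ev c (\sum_(u in A) p u).
Proof.
move=> c0 vA cv; rewrite ev_sum (bigD1 v) //= ltr_pwDl //.
  by rewrite lt_neqAle eq_sym cv c0.
by rewrite sumr_ge0 // => u /andP[uA _]; apply: c0.
Qed.

Lemma exposes_sum_gt0 c A B : exposes c B -> ~~ (A \subset B) -> 0 < ev c (\sum_(u in A) p u).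
Proof.
move=> cB /subsetPn[v vA vB]; apply: (ev_sum_gt0 _ vA).
  by move=> u _; apply: exposes_ge0 cB.
by rewrite gt_eqF // (exposes_gt0 cB).
Qed.

Lemma exposes_sum_eq0 c A B : exposes c B -> A \subset B -> ev c (\sum_(u in A) p u) = 0.
Proof.
by move=> cB sAB; rewrite ev_sum big1 // => u /(subsetP sAB); apply: exposes_eq0.
Qed.

Lemma exposes_sum_ge0 c A B : exposes c B -> 0 <= ev c (\sum_(u in A) p u).
Proof. by move=> cB; rewrite ev_sum sumr_ge0 // => u _; apply: exposes_ge0 cB. Qed.

Lemma face_in_facet A : lface A -> (\rank (sp A) < \rank (sp setT))%N ->
  exists2 F, lfacet F & A \subset F.
Proof.
case=> c cA rA.
have nT : ~~ (setT \subset A) by apply: contraTN rA; rewrite subTset => /eqP->; rewrite ltnn.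
have [||c' [c'0 c'z sub rk]] := facet_extension (c := c) _ (sum_sp (subxx setT)).
- by move=> v _; apply: exposes_ge0 cA.
- by rewrite gt_eqF // (exposes_sum_gt0 cA).
exists (zeros c' setT); last by move: sub; case: cA => _ ->.
by split=> //; exists c'.
Qed.

(** Extend the functional exposing [R0] until its zeros in [F] have corank 1. They form a face
    containing [R0], proper because the value at the sum over [F] is kept; so they equal [R0] by
    maximality. *)
Lemma ridge_rank F R0 : lface F -> ridge F R0 ->
  exists h, [/\ nonneg h F, R0 = zeros h F & (\rank (sp (zeros h F))).+1 = \rank (sp F)].
Proof.
move=> lF [[c cR] pR maxR].
have nF : ~~ (F \subset R0) by case/andP: pR.
have cF : nonneg c F by move=> v _; apply: exposes_ge0 cR.
have [|c' [c'0 c'z sub rk]] := facet_extension cF (sum_sp (subxx F)).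
  by rewrite gt_eqF // (exposes_sum_gt0 cR).
exists c'; split=> //; apply/esym/maxR.
- exact: lface_zeros.
- apply: subset_trans sub; apply/subsetP=> v vR.
  by rewrite zerosP (subsetP (proper_sub pR)) //= (exposes_eq0 cR) ?eqxx.
- rewrite properE; apply/andP; split; first by apply/subsetP=> v; rewrite zerosP => /andP[].
  apply/negP=> FZ; have := exposes_sum_gt0 cR nF; rewrite -c'z ev_sum big1 ?ltxx //.
  by move=> u /(subsetP FZ); rewrite zerosP => /andP[_ /eqP].
Qed.

Lemma rank_ridge F h : lface F -> nonneg h F ->
  (\rank (sp (zeros h F))).+1 = \rank (sp F) -> ridge F (zeros h F).
Proof.
move=> lF h0 rk; have sub : zeros h F \subset F by apply/subsetP=> v; rewrite zerosP => /andP[].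
split; first exact: lface_zeros.
  rewrite properEneq sub andbT; apply: contra_eqN rk => /eqP ->.
  by rewrite neq_ltn ltnSn orbT.
move=> S [c cS] RS pS; apply/eqP; rewrite eqEsubset RS andbT.
have /properP[_ [w wF wS]] := pS.
have ltS : (\rank (sp S) < \rank (sp F))%N.
  apply: rank_ltmx; rewrite ltmxE spS ?proper_sub //=; apply/negP=> FS.
  by case/negP: (exposes_notin cS wS); apply: submx_trans FS; apply: p_sp.
have SR : (sp S <= sp (zeros h F))%MS.
  by rewrite -(mxrank_leqif_sup (spS RS)).2 eqn_leq mxrankS ?spS //= -ltnS rk.
apply/subsetP=> v vS; rewrite zerosP (subsetP (proper_sub pS)) //=.
by apply/eqP; apply: ev_sub0 (zeros_ker h F) (submx_trans (p_sp vS) SR).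
Qed.

Lemma facet_cross F R0 : lfacet F -> ridge F R0 -> exists2 G, lfacet G & F :&: G = R0.
Proof.
move=> lF rR; have [h [h0 -> rk]] := ridge_rank lF.1 rR.
have [f fF] := lF.1; have [f' [G [s [t [_ lG E _ _]]]]] := pivot fF lF h0 rk.
by exists G.
Qed.

(** * Dual connectivity of facets avoiding a set *)

Section DualConnectivity.
Variables (A G2 : {set T}).
Let o := \sum_(v in A) p v.
Let q := \sum_(v in G2) p v.
Hypotheses (lG2 : lfacet G2) (AG2 : ~~ (A \subset G2)).

(* The dual simplex method: [ev f q / ev f o] decreases along a suitable ridge
   until it vanishes at [G2]. *)
Lemma dual_step G f : exposes f G -> lfacet G -> ~~ (A \subset G) -> G != G2 ->
  exists f' G', [/\ exposes f' G', lfacet G', ~~ (A \subset G'), 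
      ridge G (G :&: G') /\ (forall F, lfacet F -> A \subset F -> ~~ (G :&: G' \subset F))
    & ev f' q / ev f' o < ev f q / ev f o].
Proof.
move=> fG lG AG nG; have [f2 f2G2] := lG2.1.
have fo : 0 < ev f o by apply: exposes_sum_gt0 fG AG.
have fq : 0 < ev f q.
  apply: (exposes_sum_gt0 fG); apply: contra nG => sG.
  by rewrite (lfacet_max lG2 lG sG).
pose mu := ev f q / ev f o; have mu0 : 0 < mu by apply: divr_gt0.
(* [f] vanishes at [z], so [z] lies in the span of [G]; a functional positive at [o] has a smaller
   ratio than [f] exactly if it is negative at [z]. *)
pose z := q - mu *: o.
have zE c : ev c z = ev c q - mu * ev c o by rewrite /z evB evZ.
have fz : ev f z = 0 by rewrite zE divfK ?subrr // gt_eqF.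
have zT : (z <= sp setT)%MS.
  by rewrite addmx_sub ?eqmx_opp ?scalemx_sub ?sum_sp ?subsetT.
have zG := facet_span fG lG zT fz.
have f2z : ev f2 z < 0.
  rewrite zE (exposes_sum_eq0 f2G2 (subxx G2)) sub0r oppr_lt0 mulr_gt0 //.
  exact: exposes_sum_gt0 f2G2 AG2.
have f2G : nonneg f2 G by move=> v _; apply: exposes_ge0 f2G2.
(* [f2] is nonnegative on [G] and negative at [z]; extending it selects the ridge of [G] to
   cross. *)
have [|h [h0 hz _ rk]] := facet_extension f2G zG; first by rewrite lt_eqF.
rewrite -{}hz in f2z.
have [f' [G' [s [t [f'G' lG' E t0 f'E]]]]] := pivot fG lG h0 rk.
have f'z : ev f' z < 0.
  by rewrite f'E !evDl !evZl fz mulr0 add0r pmulr_rlt0.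
have rR := rank_ridge lG.1 h0 rk.
have AG' : ~~ (A \subset G').
  apply/negP=> AG'; move: f'z; rewrite zE (exposes_sum_eq0 f'G' AG') mulr0 subr0.
  by rewrite ltNge (exposes_sum_ge0 _ f'G').
have f'o := exposes_sum_gt0 f'G' AG'.
exists f', G'; split=> //.
  (* If [F] contained [A] and the ridge, its functional would be nonnegative at [z]. But [z] is a
     vector in the span of the ridge plus a negative multiple of [p v], so this functional vanishes
     at [p v] and [F] contains [G], hence equals it. *)
  split=> [|F lF AF]; rewrite E //; apply/negP=> RF; have [fF fFF] := lF.1.
  have fFz : 0 <= ev fF z.
    by rewrite zE (exposes_sum_eq0 fFF AF) mulr0 subr0 (exposes_sum_ge0 _ fFF).
  have [v vG vR] : exists2 v, v \in G & v \notin zeros h G.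
    by case: rR => _ /properP[_ [v vG vR]] _; exists v.
  have hv : 0 < ev h (p v).
    by move: vR; rewrite zerosP vG /= => nv; rewrite lt_neqAle eq_sym nv h0.
  have Gv : (sp G <= sp (zeros h G) + p v)%MS.
    have sub : (sp (zeros h G) + p v <= sp G)%MS.
      by rewrite addsmx_sub p_sp // spS //; apply/subsetP=> u; rewrite zerosP => /andP[].
    rewrite -(mxrank_leqif_sup sub).2 eqn_leq mxrankS //= -rk.
    apply: rank_ltmx; rewrite ltmxE addsmxSl /=; apply/negP=> H.
    have := ev_sub0 (zeros_ker h G) (submx_trans (addsmxSr _ _) H).
    by move=> hv0; rewrite hv0 ltxx in hv.
  have /sub_addsmxP[[u w] /= zuw] := submx_trans zG Gv.
  have zuE c : (sp (zeros h G) <= kermx c)%MS -> ev c z = w 0 0 * ev c (p v).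
    move=> cR; rewrite zuw evD (ev_sub0 cR (submxMl _ _)) add0r.
    by rewrite [w]mx11_scalar mul_scalar_mx evZ mxE eqxx mulr1n.
  have w0 : w 0 0 < 0 by move: f2z; rewrite zuE ?zeros_ker // pmulr_llt0.
  have fFR : (sp (zeros h G) <= kermx fF)%MS.
    exact: submx_trans (spS RF) (exposes_ker fFF).
  have fFv : ev fF (p v) = 0.
    apply/eqP; rewrite eq_le (exposes_ge0 v fFF) andbT.
    by move: fFz; rewrite zuE // nmulr_rge0.
  have GF : G \subset F.
    apply/subsetP=> x xG; case: fFF => _ ->; rewrite zerosP in_setT /=.
    apply/eqP; apply: ev_sub0 (submx_trans (p_sp xG) Gv).
    by rewrite addsmx_sub fFR sub_ker_ev fFv eqxx.
  by move: AG; rewrite (lfacet_max lG lF GF) AF.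
rewrite ltr_pdivrMr // -/mu; move: f'z; rewrite zE; lra.
Qed.

(** Functionals exposing one facet are proportional on the span. So the ratio belongs to the facet,
    and finiteness makes its descent stop. *)
Lemma ratio_unique G f f' : exposes f G -> exposes f' G -> lfacet G -> ~~ (A \subset G) ->
  ev f q / ev f o = ev f' q / ev f' o.
Proof.
move=> fG f'G lG AG; have fo := exposes_sum_gt0 fG AG; have f'o := exposes_sum_gt0 f'G AG.
pose s := ev f q / ev f o; pose z := q - s *: o.
have zT : (z <= sp setT)%MS.
  by rewrite addmx_sub ?eqmx_opp ?scalemx_sub ?sum_sp ?subsetT.
have fz : ev f z = 0 by rewrite evB evZ divfK ?subrr // gt_eqF.
have := ev_sub0 (exposes_ker f'G) (facet_span fG lG zT fz).
rewrite evB evZ => /eqP; rewrite subr_eq0 => /eqP->.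
by rewrite mulfK // gt_eqF.
Qed.

Lemma dual_connected (C : {set T} -> Prop) G0 :
    lfacet G0 -> ~~ (A \subset G0) -> C G0 ->
    (forall G G', lfacet G -> lfacet G' -> ~~ (A \subset G) -> ~~ (A \subset G') -> C G ->
       ridge G (G :&: G') ->
       (forall F, lfacet F -> A \subset F -> ~~ (G :&: G' \subset F)) -> C G') ->
  C G2.
Proof.
move=> lG0 AG0 CG0 step.
have /choice[phi phiP] G : exists f, lface G -> exposes f G.
  have [[f fG]|nG] := pselect (lface G); first by exists f.
  by exists 0.
pose ratio G := ev (phi G) q / ev (phi G) o.
pose P G := `[< [/\ lfacet G, ~~ (A \subset G) & C G] >].
have P0 : P G0 by apply/asboolP.
have [G /asboolP[lG AG CG] Gmin] := Order.TotalTheory.arg_minP ratio P0.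
have [<-//|nG] := eqVneq G G2.
have fG := phiP G lG.1.
have [f' [G' [f'G' lG' AG' [rG nR] lt]]] := dual_step fG lG AG nG.
have PG' : P G' by apply/asboolP; split=> //; apply: step rG nR.
have := Gmin G' PG'; rewrite /= leNgt /ratio.
by rewrite (ratio_unique (phiP G' lG'.1) f'G' lG' AG') lt.
Qed.

End DualConnectivity.

End FaceLattice.

(** * Heights that separate the vertices *)

Section GenericFunctional.
Variables (R : realFieldType) (m : nat).

Lemma generic_functional (s : seq 'rV[R]_m) :
  all (fun x => x != 0) s -> exists c, all (fun x => ev c x != 0) s.
Proof.
elim: s => [|x s IHs] /=; first by exists 0.
case/andP=> nx /IHs[c cs].
have /separating_functional[d [_ dx]] : ~~ (x <= (0 : 'M[R]_m))%MS by rewrite submx0.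
(* Each vector rules out at most one [t]. If [ev d y = 0], division gives 0 by default, a harmless
   extra exclusion. The witness below exceeds all of them. *)
pose bad := [seq - ev c y / ev d y | y <- x :: s].
have [t tbad] : exists t, t \notin bad.
  exists (1 + \sum_(y <- bad) `|y|); apply/negP=> H.
  have : \sum_(y <- bad) `|y| < 1 + \sum_(y <- bad) `|y| by rewrite ltrDr ltr01.
  rewrite ltNge; case/negP; apply: le_trans (ler_norm _) _.
  by rewrite [leRHS](big_rem _ H) /= lerDl sumr_ge0.
exists (c + t *: d); apply/andP; split.
  apply: contra tbad; rewrite evDl evZl addrC addr_eq0 => /eqP E.
  apply/mapP; exists x; rewrite ?mem_head //.
  by rewrite -E mulfK.
apply/allP=> y ys; apply: contra tbad; rewrite evDl evZl addrC addr_eq0 => /eqP E.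
have [dy|dy] := eqVneq (ev d y) 0.
  by move: E; rewrite dy mulr0 => /esym/eqP; rewrite oppr_eq0 (negPf (allP cs y ys)).
by apply/mapP; exists y; rewrite ?inE ?ys ?orbT // -E mulfK.
Qed.

Lemma injective_functional (T : finType) (p : T -> 'rV[R]_m) :
  injective p -> exists c, injective (fun v => ev c (p v)).
Proof.
move=> pinj; pose s := [seq p uv.1 - p uv.2 | uv <- enum {: T * T} & uv.1 != uv.2].
have [|c cs] := @generic_functional s.
  apply/allP=> w /mapP[[u v]]; rewrite mem_filter => /andP[/= nuv _] ->.
  by rewrite subr_eq0; apply: contra nuv => /eqP/pinj->.
exists c => u v /eqP; rewrite -subr_eq0 -evB => E; apply/eqP; apply: contraTT E => nuv.
by apply: (allP cs); apply/mapP; exists (u, v); rewrite // mem_filter /= nuv mem_enum.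
Qed.

End GenericFunctional.

(** * Mixed angles of squares in a 3-polytope *)

Section MixedAngles.
Variables (R : realFieldType) (m : nat) (T : finType) (p : T -> 'rV[R]_m).
Variables (adj : rel T) (one c : 'cV[R]_m).
Hypothesis one_p : forall v, ev one (p v) = 1.
Hypothesis str : cubical_lattice 2 adj (lface p) (lfacet p).
Hypothesis rank4 : \rank (sp p setT) = 4%N.
Notation h := (fun v => ev c (p v)).
Hypothesis h_inj : injective h.

(** The fourth vertex is not adjacent to [v], so its two neighbours in the square are [u] and [u'],
    and a face with both contains it. *)
Lemma square_face F S v u u' : lfacet p F -> lface p S -> v \in F -> u \in F -> u' \in F ->
  u != u' -> adj v u -> adj v u' -> v \in S -> u \in S -> u' \in S -> F \subset S.
Proof.
move=> fF fS vF uF u'F nuu vu vu' vS uS u'S.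
have Nv : [set x in F | adj v x] = [set u; u'].
  apply/esym/eqP; rewrite eqEcard (facet_nbrs str) // cards2 nuu andbT.
  by apply/subsetP=> x /set2P[]->; rewrite inE ?uF ?u'F.
apply/subsetP=> w wF; apply: contraT => wS.
have nwv : w != v by apply: contraNneq wS => ->.
have nwu : w != u by apply: contraNneq wS => ->.
have nwu' : w != u' by apply: contraNneq wS => ->.
have nvu x : adj v x -> v != x by case/(cl_adjE str).
have FE : F = [set v; u; u'; w].
  apply/esym/eqP; rewrite eqEcard; apply/andP; split.
    by apply/subsetP=> x; rewrite !inE -!orbA => /or4P[]/eqP->.
  have [phi lab] := cl_label str fF; rewrite (card_facet lab).
  rewrite (_ : [set v; u; u'; w] = [set w; v] :|: [set u; u']); last first.
    by apply/setP=> x; rewrite !inE; do 4!case: (x == _).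
  rewrite cardsU !cards2 nuu nwv (_ : _ :&: _ = set0) ?cards0 //.
  apply/setP=> x; rewrite !inE; apply/negbTE/andP=> -[/orP[]/eqP->].
    by rewrite (negPf nwu) (negPf nwu').
  by rewrite (negPf (nvu _ vu)) (negPf (nvu _ vu')).
have sub : [set x in F | adj w x] \subset [set u; u'].
  apply/subsetP=> x; rewrite inE => /andP[+ wx]; rewrite FE !inE -!orbA.
  case/or4P=> /eqP ex; rewrite ex ?eqxx ?orbT //.
    have : w \in [set x in F | adj v x] by rewrite inE wF (adj_sym str) -ex.
    by rewrite Nv !inE (negPf nwu) (negPf nwu').
  by move: wx; rewrite ex => /(cl_adjE str)[]; rewrite eqxx.
have Nw : [set x in F | adj w x] = [set u; u'].
  by apply/eqP; rewrite eqEcard sub (facet_nbrs str) // cards2 nuu.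
have wadj x : x \in [set u; u'] -> adj w x by rewrite -Nw inE => /andP[].
case/negP: wS; apply: (facet_face_nbrs str fF fS wF uF u'F uS u'S nuu); apply: wadj.
  by rewrite set21.
by rewrite set22.
Qed.

(* Three mixed facets at [v] would give three vectors [y1], [y2], [y3] in the
   plane of directions at height [h v], each exposed against the other two. *)
Lemma mixed_vertex v :
  (#|[set F : {set T} | [&& `[< lfacet p F >], v \in F & mixed adj h F v]]| <= 2)%N.
Proof.
rewrite leqNgt; apply/negP=> /card_gt2P[F1 [F2 [F3 [[+ + +] [n12 n23 n31]]]]].
have data F : F \in [set F : {set T} | [&& `[< lfacet p F >], v \in F & mixed adj h F v]] ->
    exists f y, [/\ lfacet p F, exposes p f F, (y <= sp p F)%MS, ev c y = 0 /\ ev one y = 0 &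
      forall g G, exposes p g G -> lfacet p G -> v \in G -> G != F -> 0 < ev g y].
  rewrite inE => /and3P[/asboolP fF vF /exists_inP[u uF /exists_inP[u' u'F]]].
  case/and4P=> vu vu' huv hvu'; have [f fFF] := fF.1.
  (* The positive combination of [p u - p v] and [p u' - p v] whose height cancels: a level
     direction into the angle. *)
  pose y := (h u' - h v) *: p u + (h v - h u) *: p u' - (h u' - h u) *: p v.
  exists f, y; split=> //.
  - by rewrite !(addmx_sub, eqmx_opp, scalemx_sub, p_sp).
  - by split; rewrite /y evB evD !evZ ?one_p; ring.
  - move=> g G gG fG vG nGF; rewrite /y evB evD !evZ (exposes_eq0 gG vG) mulr0 subr0.
    have nuu : u != u' by apply: contraTneq huv => ->; rewrite -leNgt ltW.
    have a0 : 0 < h u' - h v by rewrite subr_gt0.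
    have b0 : 0 < h v - h u by rewrite subr_gt0.
    have gu := exposes_ge0 u gG; have gu' := exposes_ge0 u' gG.
    have [uG|uG] := boolP (u \in G); last first.
      by rewrite ltr_pwDl ?mulr_ge0 ?(ltW b0) // mulr_gt0 // (exposes_gt0 gG).
    have [u'G|u'G] := boolP (u' \in G); last first.
      by rewrite ltr_wpDl ?mulr_ge0 ?(ltW a0) // mulr_gt0 // (exposes_gt0 gG).
    have sFG := square_face fF fG.1 vF uF u'F nuu vu vu' vG uG u'G.
    by rewrite (lfacet_max fF fG sFG) eqxx in nGF.
have vin F : F \in [set F : {set T} | [&& `[< lfacet p F >], v \in F & mixed adj h F v]] -> v \in F.
  by rewrite inE => /and3P[].
move=> /[dup] /vin v1 /data[f1 [y1 [lF1 fF1 y1F [c1 o1] pos1]]].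
move=> /[dup] /vin v2 /data[f2 [y2 [lF2 fF2 y2F [c2 o2] pos2]]].
move=> /[dup] /vin v3 /data[f3 [y3 [lF3 fF3 y3F [c3 o3] pos3]]].
have [u vu] : exists u, adj v u.
  have /card_gt0P[u] : (0 < #|[set u | adj v u]|)%N by apply: leq_trans (min_degree str isT v).
  by rewrite inE; exists u.
(* Imposing [one = 0] and then [c = 0] lowers the rank twice, to at most 2; so three vectors are
   dependent. *)
pose W1 := (sp p setT :&: kermx one)%MS; pose W2 := (W1 :&: kermx c)%MS.
have rW1 : (\rank W1 < 4)%N.
  rewrite -rank4; apply: rank_ltmx; rewrite ltmxE capmxSl /=; apply/negP=> H.
  have := submx_trans (p_sp p (in_setT v)) (submx_trans H (capmxSr _ _)).
  by rewrite sub_ker_ev one_p oner_eq0.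
have rW2 : (\rank W2 < \rank W1)%N.
  apply: rank_ltmx; rewrite ltmxE capmxSl /=; apply/negP=> H.
  have pW : (p v - p u <= W1)%MS.
    by rewrite sub_capmx sub_ker_ev evB !one_p subrr eqxx addmx_sub ?eqmx_opp ?p_sp ?in_setT.
  have := submx_trans pW (submx_trans H (capmxSr _ _)).
  rewrite sub_ker_ev evB subr_eq0 => /eqP/h_inj euv.
  by case: (cl_adjE str v u).1 => //; rewrite euv eqxx.
pose y (i : 'I_3) := nth 0 [:: y1; y2; y3] i.
have inW i : (y i <= W2)%MS.
  by rewrite !sub_capmx !sub_ker_ev; case: i => [[|[|[|i]]] //= lti]; rewrite /y /=
    ?c1 ?c2 ?c3 ?o1 ?o2 ?o3 !eqxx !andbT; apply: submx_trans (spS p (subsetT _));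
    [exact: y1F|exact: y2F|exact: y3F].
have [|t [i ti]] := dependent inW; first by move: rW1 rW2; clear; lia.
rewrite !big_ord_recl big_ord0 addr0 /y /= => E.
(* [f1] kills [y1] and is positive at [y2] and [y3], whose coefficients thus have opposite signs;
   the same holds for [f2] and [f3]. *)
have E1 : t (lift ord0 ord0) * ev f1 y2 + t (lift ord0 (lift ord0 ord0)) * ev f1 y3 = 0.
  have := congr1 (ev f1) E; rewrite !evD !evZ ev0 (ev_sub0 (exposes_ker fF1) y1F).
  by rewrite mulr0 add0r.
have E2 : t ord0 * ev f2 y1 + t (lift ord0 (lift ord0 ord0)) * ev f2 y3 = 0.
  have := congr1 (ev f2) E; rewrite !evD !evZ ev0 (ev_sub0 (exposes_ker fF2) y2F).
  by rewrite mulr0 add0r.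
have E3 : t ord0 * ev f3 y1 + t (lift ord0 ord0) * ev f3 y2 = 0.
  have := congr1 (ev f3) E; rewrite !evD !evZ ev0 (ev_sub0 (exposes_ker fF3) y3F).
  by rewrite mulr0 addr0.
have [n13 n21 n32] : [/\ F1 != F3, F2 != F1 & F3 != F2] by split; rewrite eq_sym.
have S1 := opposite_sg (pos2 _ _ fF1 lF1 v1 n12) (pos3 _ _ fF1 lF1 v1 n13) E1.
have S2 := opposite_sg (pos1 _ _ fF2 lF2 v2 n21) (pos3 _ _ fF2 lF2 v2 n23) E2.
have S3 := opposite_sg (pos1 _ _ fF3 lF3 v3 n31) (pos2 _ _ fF3 lF3 v3 n32) E3.
have s0 : Num.sg (t ord0) = 0 by move: S1 S2 S3; lra.
have t0 : t ord0 = 0 by apply/eqP; rewrite -sgr_eq0 s0.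
have t1 : t (lift ord0 ord0) = 0 by apply/eqP; rewrite -sgr_eq0 S3 s0 oppr0.
have t2 : t (lift ord0 (lift ord0 ord0)) = 0 by apply/eqP; rewrite -sgr_eq0 S2 s0 oppr0.
case/eqP: ti; move: i => [[|[|[|i]]] //= ilt].
- by rewrite -t0; congr t; apply: val_inj.
- by rewrite -t1; congr t; apply: val_inj.
- by rewrite -t2; congr t; apply: val_inj.
Qed.

(** Measure heights from the larger of [n] and [y]: no term of the relation is negative, and two are
    positive. *)
Lemma alternating_sums (M n x y tM tn tx ty : R) :
    tM + (tn + (tx + ty)) = 0 -> tM * M + (tn * n + (tx * x + ty * y)) = 0 ->
    n < M -> y < M -> n < x -> y < x -> 0 < tM -> 0 < tx -> tn < 0 -> ty < 0 ->
  False.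
Proof.
move=> E1 E2 nM yM nx yx tM0 tx0 tn0 ty0.
wlog lny : n y tn ty E1 E2 nM yM nx yx tn0 ty0 / n <= y => [H|].
  have [lny|/ltW lyn] := leP n y; first exact: (H n y tn ty).
  by apply: (H y n ty tn) => //; [move: E1|move: E2]; lra.
have M0 : 0 < tM * (M - y) by rewrite mulr_gt0 // subr_gt0.
have x0 : 0 < tx * (x - y) by rewrite mulr_gt0 // subr_gt0.
have n0 : 0 <= tn * (n - y) by rewrite nmulr_rge0 // subr_le0.
have Ey : y * (tM + (tn + (tx + ty))) = 0 by rewrite E1 mulr0.
by move: M0 x0 n0 Ey E2; lra.
Qed.

(** A convex quadrilateral has no two local maxima of height. Its four vertices span rank 3, so they
    are dependent; functionals exposing edges show that the coefficients alternate in sign around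
    the square. *)
Lemma no_zigzag F M n x y : lfacet p F -> F = [set M; n; x; y] ->
    adj M n -> adj n x -> adj x y -> adj y M -> M != x -> n != y ->
  ~ [/\ h n < h M, h y < h M, h n < h x & h y < h x].
Proof.
move=> fF FE Mn nx xy yM nMx nny [hnM hyM hnx hyx].
have adjn u v : adj u v -> u != v by case/(cl_adjE str).
pose z (i : 'I_4) := nth 0 [:: p M; p n; p x; p y] i.
have inF i : (z i <= sp p F)%MS.
  by case: i => [[|[|[|[|i]]]] //= lti]; rewrite /z /= p_sp // FE !inE eqxx ?orbT.
have [|t [i ti]] := dependent inF; first by have := fF.2; rewrite rank4 => -[->].
rewrite !big_ord_recl big_ord0 addr0 /z /=.
have nt : ~ [/\ t ord0 = 0, t (lift ord0 ord0) = 0, t (lift ord0 (lift ord0 ord0)) = 0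
    & t (lift ord0 (lift ord0 (lift ord0 ord0))) = 0].
  case=> t0 t1 t2 t3; case/eqP: ti; move: i => [[|[|[|[|i]]]] //= ilt].
  - by rewrite -t0; congr t; apply: val_inj.
  - by rewrite -t1; congr t; apply: val_inj.
  - by rewrite -t2; congr t; apply: val_inj.
  - by rewrite -t3; congr t; apply: val_inj.
move=> E; move: nt E; move: (t (lift ord0 (lift ord0 (lift ord0 ord0)))) => ty.
move: (t (lift ord0 (lift ord0 ord0))) (t (lift ord0 ord0)) (t ord0) => tx tn tM nt E.
have Eg g : tM * ev g (p M) + (tn * ev g (p n) + (tx * ev g (p x) + ty * ev g (p y))) = 0.
  by have := congr1 (ev g) E; rewrite !evD !evZ ev0.
have opp a b a' b' ta tb : adj a b -> a' \notin [set a; b] -> b' \notin [set a; b] ->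
    (forall g, exposes p g [set a; b] -> ta * ev g (p a') + tb * ev g (p b') = 0) ->
    Num.sg tb = - Num.sg ta.
  move=> /(cl_adjE str)[_ [g gab]] a'n b'n H.
  by apply: opposite_sg (H g gab); apply: (exposes_gt0 gab).
have nMn := adjn _ _ Mn; have nnx := adjn _ _ nx; have nxy := adjn _ _ xy; have nyM := adjn _ _ yM.
have [nnM nxn nyx nMy] : [/\ n != M, x != n, y != x & M != y] by split; rewrite eq_sym.
have [nxM nyn] : x != M /\ y != n by split; rewrite eq_sym.
have S1 : Num.sg ty = - Num.sg tx.
  apply: (opp M n x y) => //; rewrite ?inE ?negb_or ?nxM ?nxn ?nyM ?nyn //.
  move=> g gF; have := Eg g; rewrite (exposes_eq0 gF (set21 _ _)) (exposes_eq0 gF (set22 _ _)).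
  by rewrite !mulr0 !add0r.
have S2 : Num.sg ty = - Num.sg tM.
  apply: (opp n x M y) => //; rewrite ?inE ?negb_or ?nMn ?nMx ?nyn ?nyx //.
  move=> g gF; have := Eg g; rewrite (exposes_eq0 gF (set21 _ _)) (exposes_eq0 gF (set22 _ _)).
  by rewrite !mulr0 !add0r.
have S3 : Num.sg tn = - Num.sg tM.
  apply: (opp x y M n) => //; rewrite ?inE ?negb_or ?nMx ?nMy ?nnx ?nny //.
  move=> g gF; have := Eg g; rewrite (exposes_eq0 gF (set21 _ _)) (exposes_eq0 gF (set22 _ _)).
  by rewrite !mulr0 !addr0.
have Eone := Eg one; rewrite !one_p !mulr1 in Eone.
have Ec := Eg c.
have [t0|tneg|tpos] := ltrgtP tM 0.
- have sM : Num.sg tM = -1 by rewrite ltr0_sg.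
  apply: (@alternating_sums (h M) (h n) (h x) (h y) (- tM) (- tn) (- tx) (- ty)) => //.
  + by move: Eone; lra.
  + by move: Ec; lra.
  + by rewrite oppr_gt0.
  + by rewrite oppr_gt0 -sgr_lt0 -[Num.sg tx]opprK -S1 S2 sM; lra.
  + by rewrite oppr_lt0 -sgr_gt0 S3 sM; lra.
  + by rewrite oppr_lt0 -sgr_gt0 S2 sM; lra.
- have sM : Num.sg tM = 1 by rewrite gtr0_sg.
  apply: (@alternating_sums (h M) (h n) (h x) (h y) tM tn tx ty) => //.
  + by rewrite -sgr_gt0 -[Num.sg tx]opprK -S1 S2 sM; lra.
  + by rewrite -sgr_lt0 S3 sM; lra.
  + by rewrite -sgr_lt0 S2 sM; lra.
- rewrite tpos sgr0 oppr0 in S2 S3; rewrite S2 in S1.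
  have S4 : Num.sg tx = 0 by lra.
  move/eqP: S2; move/eqP: S3; move/eqP: S4; rewrite !sgr_eq0 => /eqP tx0 /eqP tn0 /eqP ty0.
  by apply: nt.
Qed.

Lemma square_cycle F M : lfacet p F -> M \in F -> exists n x y,
  [/\ F = [set M; n; x; y], [/\ adj M n, adj n x, adj x y & adj y M], M != x & n != y].
Proof.
move=> fF MF; have [phi lab] := cl_label str fF.
pose i0 : 'I_2 := ord0; pose i1 : 'I_2 := lift ord0 ord0.
have [n nF en] := label_surj lab (flip i0 (phi M)).
have [y yF ey] := label_surj lab (flip i1 (phi M)).
have [x xF ex] := label_surj lab (flip i1 (flip i0 (phi M))).
have ex' : phi x = flip i0 (phi y).
  by rewrite ex ey; apply/ffunP=> i; rewrite !ffunE -!addbA [(i == i0) (+) _]addbC.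
have adjF u v i : u \in F -> v \in F -> phi v = flip i (phi u) -> adj u v.
  by move=> uF vF E; rewrite (adj_label (cl_adjE str) lab) // E cube_adj_flip.
have Mn := adjF _ _ _ MF nF en; have nx : adj n x by apply: (adjF _ _ i1); rewrite // ex en.
have yM : adj y M by rewrite (adj_sym str); apply: adjF ey.
have xy : adj x y by rewrite (adj_sym str); apply: adjF ex'.
have nMx : M != x.
  apply/eqP=> eMx; have : flip i1 (phi M) = flip i1 (flip i1 (flip i0 (phi M))) by rewrite -ex -eMx.
  by rewrite flipK => /flip_injl.
have nny : n != y.
  by apply/eqP=> eny; move: ey; rewrite -eny en => /flip_injl.
exists n, x, y; split=> //; apply/esym/eqP; rewrite eqEcard (card_facet lab).
apply/andP; split; first by apply/subsetP=> z; rewrite !inE -!orbA => /or4P[]/eqP->.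
have adjn u v : adj u v -> u != v by case/(cl_adjE str).
have u4 : uniq [:: M; n; x; y].
  rewrite /= !inE !negb_or (adjn _ _ Mn) nMx [M == y]eq_sym (adjn _ _ yM) nny.
  by rewrite (adjn _ _ nx) (adjn _ _ xy).
have -> : [set M; n; x; y] = [set z in [:: M; n; x; y]].
  by apply/setP=> z; rewrite !inE -!orbA.
by rewrite cardsE (card_uniqP u4).
Qed.

(** Both neighbours of the highest vertex [M] are lower. Unless the opposite vertex [x] is above
    both, a zigzag, two of [n], [x], [y] lie between their neighbours. *)
Lemma mixed_facet F : lfacet p F -> (1 < #|[set v in F | mixed adj h F v]|)%N.
Proof.
move=> fF; have [phi lab] := cl_label str fF.
have [M0 M0F _] := label_surj lab [ffun=> true].
have [M MF Mmax] := Order.TotalTheory.arg_maxP h (M0F : mem F M0).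
have [n [x [y [FE [Mn nx xy yM] nMx nny]]]] := square_cycle fF MF.
have nF : n \in F by rewrite FE !inE eqxx ?orbT.
have xF : x \in F by rewrite FE !inE eqxx ?orbT.
have yF : y \in F by rewrite FE !inE eqxx ?orbT.
have adjC := adj_sym str.
have lt_h u v : u != v -> h u <= h v -> h u < h v.
  by move=> nuv le; rewrite lt_neqAle le andbT; apply: contra nuv => /eqP/h_inj->.
have adjn u v : adj u v -> u != v by case/(cl_adjE str).
have hnM : h n < h M by apply: lt_h; [rewrite eq_sym adjn|apply: (Mmax n nF)].
have hyM : h y < h M by apply: lt_h; [rewrite adjn|apply: (Mmax y yF)].
have mix v u u' : v \in F -> u \in F -> u' \in F -> adj v u -> adj v u' ->
    h u < h v -> h v < h u' -> v \in [set v in F | mixed adj h F v].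
  move=> vF uF u'F vu vu' huv hvu'; rewrite inE vF; apply/exists_inP; exists u => //.
  by apply/exists_inP; exists u' => //; rewrite vu vu' huv.
apply/card_gt1P; have [hxn|hnx] := leP (h x) (h n); have [hxy|hyx] := leP (h x) (h y).
- exists n, y; split=> //.
    by apply: (mix n x M); rewrite // 1?adjC // lt_h // eq_sym adjn.
  by apply: (mix y x M); rewrite // 1?adjC // lt_h // adjn.
- exists n, x; split; last by rewrite adjn.
    by apply: (mix n x M); rewrite // 1?adjC // lt_h // eq_sym adjn.
  by apply: (mix x y n); rewrite // 1?adjC // lt_h // eq_sym adjn.
- exists y, x; split; last by rewrite eq_sym adjn.
    by apply: (mix y x M); rewrite // 1?adjC // lt_h // adjn.
  by apply: (mix x n y); rewrite // 1?adjC // lt_h // adjn.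
- by have [] := no_zigzag fF FE Mn nx xy yM nMx nny.
Qed.

End MixedAngles.

(** * Polytopes *)

(* Imported only here because it shadows names of [finset], such as [set0]. *)
From mathcomp Require Import classical_sets functions cardinality reals.

(** * Convex hulls as cones over the vectors [(1, x)] *)

Section Homogenization.
Variables (R : realType) (n : nat).
Implicit Types (x : 'rV[R]_n) (y : 'rV[R]_(1 + n)) (P F : set 'rV[R]_n) (d : 'cV[R]_(1 + n)).

Definition homog x : 'rV[R]_(1 + n) := row_mx 1%:M x.

Definition hone : 'cV[R]_(1 + n) := col_mx 1%:M 0.

Lemma ev_hone (M : 'rV[R]_1) x : ev hone (row_mx M x) = M 0 0.
Proof. by rewrite /ev /hone mul_row_col mulmx1 mulmx0 addr0. Qed.

Lemma ev_hone_homog x : ev hone (homog x) = 1.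
Proof. by rewrite ev_hone mxE. Qed.

Lemma homog_inj : injective homog.
Proof. by move=> x y /eq_row_mx[]. Qed.

Lemma homog_sum (I : Type) (r : seq I) (Q : pred I) (a : I -> R) (q : I -> 'rV[R]_n) :
  \sum_(i <- r | Q i) a i *: homog (q i) =
  row_mx (\sum_(i <- r | Q i) a i)%:M (\sum_(i <- r | Q i) a i *: q i).
Proof.
elim/big_rec3: _ => [|i u v w _ ->]; first by rewrite raddf0 row_mx0.
by rewrite /homog scale_row_mx add_row_mx scale_scalar_mx mulr1 raddfD.
Qed.

Lemma homog_comb (I : finType) (a : I -> R) (q : I -> 'rV[R]_n) x :
  (\sum_i a i = 1 /\ x = \sum_i a i *: q i) <-> homog x = \sum_i a i *: homog (q i).
Proof.
rewrite homog_sum /homog; split=> [[-> ->] //|/eq_row_mx[/matrixP/(_ 0 0)]].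
by rewrite !mxE.
Qed.

Lemma ev_homog d x : ev d (homog x) = usubmx d 0 0 + \sum_i dsubmx d i 0 * x 0 i.
Proof.
rewrite /ev -{1}[d]vsubmxK /homog mul_row_col mul1mx [LHS]mxE; congr (_ + _).
by rewrite mxE; apply: eq_bigr => i _; rewrite mulrC.
Qed.

Lemma face_ev P F : face P F <-> exists d,
  (forall x, P x -> 0 <= ev d (homog x)) /\ F = (P `&` [set x | ev d (homog x) = 0])%classic.
Proof.
split=> [[c [b [cP ->]]]|[d [dP ->]]].
  have E x : ev (col_mx b%:M (- c^T)) (homog x) = b - \sum_i c 0 i * x 0 i.
    rewrite ev_homog col_mxKu col_mxKd mxE eqxx mulr1n; congr (_ + _).
    by rewrite -sumrN; apply: eq_bigr => i _; rewrite !mxE mulNr.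
  exists (col_mx b%:M (- c^T)); split=> [x /cP|]; first by rewrite E subr_ge0.
  congr (_ `&` _)%classic; apply/seteqP; split=> x /=; rewrite E.
    by move=> ->; rewrite subrr.
  by move/eqP; rewrite subr_eq0 => /eqP.
have E x : \sum_i (- (dsubmx d)^T) 0 i * x 0 i = usubmx d 0 0 - ev d (homog x).
  rewrite ev_homog opprD addNKr -sumrN; apply: eq_bigr => i _.
  by rewrite !mxE mulNr.
exists (- (dsubmx d)^T), (usubmx d 0 0); split=> [x /dP|].
  by rewrite E gerBl.
congr (_ `&` _)%classic; apply/seteqP; split=> x /=; rewrite E.
  by move=> ->; rewrite subr0.
by move/eqP; rewrite -subr_eq0 addrAC subrr sub0r oppr_eq0 => /eqP.
Qed.

Section Hull.
Variables (I : finType) (q : I -> 'rV[R]_n).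
Implicit Types A B : {set I}.

Definition hull A : set 'rV[R]_n := conv_hull (q @` [set` A])%classic.

Definition conic A (y : 'rV[R]_(1 + n)) := exists a : I -> R,
  [/\ forall v, 0 <= a v, forall v, v \notin A -> a v = 0 & y = \sum_v a v *: homog (q v)].

(** The first coordinate encodes that the coefficients sum to 1. Coefficients of repeated points are
    added up. *)
Lemma hullP A x : hull A x <-> conic A (homog x).
Proof.
split=> [[m [a [v [vA a0 sa ->]]]]|[a [a0 aA /homog_comb[sa ->]]]].
  have /choice[u uP] i : exists u, u \in A /\ q u = v i.
    by have [u uA <-] := vA i; exists u.
  exists (fun w => \sum_(i | u i == w) a i); split=> [w|w wA|].
  - by rewrite sumr_ge0.
  - rewrite big_pred0 // => i; apply: contraNF wA => /eqP <-.
    by case: (uP i).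
  apply/homog_comb; split.
    by rewrite -sa (partition_big u predT).
  rewrite (partition_big u predT) //=; apply: eq_bigr => w _.
  rewrite scaler_suml; apply: eq_bigr => i /eqP <-.
  by case: (uP i) => _ ->.
exists #|A|, (fun i => a (enum_val i)), (fun i => q (enum_val i)); split=> //.
- by move=> i; exists (enum_val i) => //; apply: enum_valP.
- rewrite -(big_enum_val (fun v => a v)) -sa [RHS](bigID (mem A)) /=.
  by rewrite [X in _ = _ + X]big1 ?addr0.
- rewrite -(big_enum_val (fun v => a v *: q v)) [LHS](bigID (mem A)) /=.
  by rewrite [X in _ + X]big1 ?addr0 // => v /aA ->; rewrite scale0r.
Qed.

Lemma conicS A B y : A \subset B -> conic A y -> conic B y.
Proof.
move=> sAB [a [a0 aA ->]]; exists a; split=> // v vB.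
by apply: aA; apply: contra vB; apply: (fintype.subsetP sAB).
Qed.

Lemma hullS A B x : A \subset B -> hull A x -> hull B x.
Proof. by move=> sAB /hullP/(conicS sAB)/hullP. Qed.

Lemma conic_gen A v : v \in A -> conic A (homog (q v)).
Proof.
move=> vA; exists (fun u => (u == v)%:R); split=> [u|u uA|].
- exact: ler0n.
- by case: eqP => // euv; rewrite euv vA in uA.
- by rewrite (bigD1 v) //= eqxx scale1r big1 ?addr0 // => u /negPf->; rewrite scale0r.
Qed.

Lemma hull_gen A v : v \in A -> hull A (q v).
Proof. by move=> vA; apply/hullP/conic_gen. Qed.

Lemma conic_ge0 A d y : nonneg (homog \o q) d A -> conic A y -> 0 <= ev d y.
Proof.
move=> d0 [a [a0 aA ->]]; rewrite ev_sum sumr_ge0 // => v _; rewrite evZ.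
have [vA|vA] := boolP (v \in A); first by rewrite mulr_ge0 ?d0.
by rewrite aA // mul0r.
Qed.

Lemma conic_zeros A d y : nonneg (homog \o q) d A -> conic A y -> ev d y = 0 ->
  conic (zeros (homog \o q) d A) y.
Proof.
move=> d0 [a [a0 aA ->]]; rewrite ev_sum => /eqP; rewrite psumr_eq0; last first.
  move=> v _; rewrite evZ; have [vA|vA] := boolP (v \in A); first by rewrite mulr_ge0 ?d0.
  by rewrite aA // mul0r.
move/allP=> H; exists a; split=> // v; rewrite zerosP negb_and => /orP[/aA //|nv].
have := H v (mem_index_enum v); rewrite evZ mulf_eq0 (negPf nv) orbF.
by move/eqP.
Qed.

Lemma conic_ev0 A d y : (forall v, v \in A -> ev d (homog (q v)) = 0) -> conic A y -> ev d y = 0.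
Proof.
move=> d0 [a [a0 aA ->]]; rewrite ev_sum big1 // => v _; rewrite evZ.
have [vA|vA] := boolP (v \in A); first by rewrite d0 ?mulr0.
by rewrite aA // mul0r.
Qed.

Lemma conic_sp A y : conic A y -> (y <= sp (homog \o q) A)%MS.
Proof.
move=> [a [a0 aA ->]]; apply: summx_sub => v _.
have [vA|vA] := boolP (v \in A); last by rewrite aA // scale0r sub0mx.
by rewrite scalemx_sub //; apply: (p_sp (homog \o q) vA).
Qed.

Lemma face_hull A F : face (hull A) F ->
  exists2 d, nonneg (homog \o q) d A & F = hull (zeros (homog \o q) d A).
Proof.
case/face_ev=> d [dP ->]; have d0 : nonneg (homog \o q) d A.
  by move=> v vA; apply: dP; apply: hull_gen.
exists d => //; apply/seteqP; split=> x.
  by case=> /hullP cx /= dx; apply/hullP; apply: conic_zeros.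
move=> cx; split; first by apply: hullS cx; apply/fintype.subsetP=> v; rewrite zerosP => /andP[].
move/hullP: cx; apply: conic_ev0 => v; rewrite zerosP => /andP[_ /eqP].
by [].
Qed.

Lemma hull_face A d : nonneg (homog \o q) d A -> face (hull A) (hull (zeros (homog \o q) d A)).
Proof.
move=> d0; apply/face_ev; exists d; split=> [x /hullP|]; first exact: conic_ge0.
apply/seteqP; split=> x; last first.
  by case=> /hullP cx /= dx; apply/hullP; apply: conic_zeros.
move=> cx; split; first by apply: hullS cx; apply/fintype.subsetP=> v; rewrite zerosP => /andP[].
move/hullP: cx; apply: conic_ev0 => v; rewrite zerosP => /andP[_ /eqP].
by [].
Qed.

End Hull.

(** Take a minimal generating set: a generator that is a conic combination of the others could be
    substituted away. *)
Lemma exists_irredundant P : polytope P ->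
  exists (I : finType) (q : I -> 'rV[R]_n) (A : {set I}),
    P = hull q A /\ forall v, v \in A -> ~ conic q (A :\ v) (homog (q v)).
Proof.
case=> V0 [/finite_fsetP[V EV] PV]; rewrite {}EV in PV.
pose q := (val : V -> 'rV[R]_n); pose Q A := `[< P = hull q A >].
have QT : Q [set: V]%SET.
  apply/asboolP; rewrite PV; congr conv_hull; apply/seteqP; split=> x /=.
    by move=> xV; exists (FSetSub xV); rewrite ?inE.
  by case=> v _ <-; apply: valP.
have [A /minsetP[/asboolP PA Amin] _] := minset_exists QT.
exists V, q, A; split=> // v vA [b [b0 bA vE]].
have : Q (A :\ v)%SET.
  apply/asboolP; rewrite PA; apply/seteqP; split=> x; last first.
    by apply: hullS; apply: subD1set.
  case/hullP=> a [a0 aA xE]; apply/hullP.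
  exists (fun u => if u == v then 0 else a u + a v * b u).
  have bv0 : b v = 0 by apply: bA; rewrite !inE eqxx.
  split=> [u|u|].
  - by case: eqP => // _; rewrite addr_ge0 ?mulr_ge0.
  - rewrite !inE negb_and negbK; case: eqP => //= _ uA.
    by rewrite aA // add0r bA ?mulr0 // !inE negb_and uA orbT.
  rewrite xE (bigD1 v) //= [RHS](bigD1 v) //= eqxx scale0r add0r.
  under [RHS]eq_bigr => u nuv do rewrite (negPf nuv) scalerDl.
  rewrite big_split /= addrC; congr (_ + _).
  rewrite {1}vE scaler_sumr (bigD1 v) //= bv0 scale0r scaler0 add0r.
  by apply: eq_bigr => u _; rewrite scalerA.
by move/Amin => /(_ (subD1set _ _)) E; have := vA; rewrite -E !inE eqxx.
Qed.

(** [farkas] gives a functional negative at [v] and nonnegative at the other generators; a multiple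
    of [hone], constant on the vectors [(1, x)], shifts its value at [v] to 0. *)
Lemma irredundant_exposed (I : finType) (q : I -> 'rV[R]_n) (A : {set I}) v : v \in A ->
    ~ conic q (A :\ v) (homog (q v)) ->
  exists2 d, nonneg (homog \o q) d A & zeros (homog \o q) d A = [set v]%SET.
Proof.
move=> vA nv.
have [d d0 dv] : exists2 d, nonneg (homog \o q) d (A :\ v)%SET & ev d (homog (q v)) < 0.
  apply: contrapT => H; apply: nv; apply: (@farkas _ _ _ _ (homog \o q)) => c c0.
  by rewrite leNgt; apply/negP=> cv; apply: H; exists c.
have dE u : ev (d - ev d (homog (q v)) *: hone) (homog (q u)) = ev d (homog (q u)) - ev d (homog (q v)).
  by rewrite evDl evNl evZl ev_hone_homog mulr1.
have pos u : u \in A -> u != v -> 0 < ev (d - ev d (homog (q v)) *: hone) (homog (q u)).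
  move=> uA nuv; rewrite dE subr_gt0; apply: lt_le_trans dv _.
  by apply: d0; rewrite !inE nuv.
exists (d - ev d (homog (q v)) *: hone).
  move=> u uA; have [->|nuv] := eqVneq u v; first by rewrite /= dE subrr.
  by rewrite /= ltW // pos.
apply/setP=> u; rewrite zerosP inE; have [->|nuv] := eqVneq u v.
  by rewrite vA /= dE subrr eqxx.
by have [uA|//] := boolP (u \in A); rewrite /= gt_eqF // pos.
Qed.

Lemma hull1 (I : finType) (q : I -> 'rV[R]_n) v : hull q [set v]%SET = [set q v]%classic.
Proof.
apply/seteqP; split=> [x /hullP[a [a0 aA /homog_comb[sa ->]]]|_ ->]; last first.
  by apply: hull_gen; rewrite inE.
have a1 u : u != v -> a u = 0 by move=> nuv; apply: aA; rewrite inE.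
rewrite (bigD1 v) //= big1 ?addr0 => [|u /a1->]; last by rewrite scale0r.
by move: sa; rewrite (bigD1 v) //= big1 ?addr0 // => ->; rewrite scale1r.
Qed.

Lemma vertices_irredundant P (I : finType) (q : I -> 'rV[R]_n) (A : {set I}) :
    P = hull q A -> (forall v, v \in A -> ~ conic q (A :\ v) (homog (q v))) ->
  [set x | face P [set x]]%classic = (q @` [set` A])%classic.
Proof.
move=> -> irr; apply/seteqP; split=> [x /= /face_hull[d d0 xE]|_ [v /= vA <-]].
  have [Z0|[v vZ]] := set_0Vmem (zeros (homog \o q) d A).
    have : [set x]%classic x by [].
    rewrite xE Z0 => /hullP[a [_ aA /homog_comb[]]].
    rewrite big1 => [/eqP|v _]; last by rewrite aA ?inE.
    by rewrite eq_sym oner_eq0.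
  exists v; first by move: vZ; rewrite zerosP => /andP[].
  by have := hull_gen q vZ; rewrite -xE.
have [d d0 dZ] := irredundant_exposed vA (irr v vA).
by rewrite -hull1 -dZ; apply: hull_face.
Qed.

(** Finiteness shows that [fset_set] in [vertices] does not take its default value; an irredundant
    generating set then is the set of vertices. *)
Lemma polytope_vertices P : polytope P ->
  [/\ finite_set [set x | face P [set x]]%classic, P = hull (val : vertices P -> _) [set: vertices P]%SET
    & forall x : vertices P, face P [set val x]%classic].
Proof.
case/exists_irredundant=> I [q [A [PA irr]]].
have VE := vertices_irredundant PA irr.
have fin : finite_set [set x | face P [set x]]%classic.
  by rewrite VE; apply: finite_image; apply: finite_finset.
have VP : [set` vertices P]%classic = [set x | face P [set x]]%classic by apply: fset_setK.
split=> //; last by move=> x; have := valP x; rewrite /= in_fset_set // inE.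
rewrite {1}PA; congr conv_hull; rewrite -VE -VP; apply/seteqP; split=> x /=.
  by move=> xV; exists (FSetSub xV); rewrite ?inE.
by case=> v _ <-; apply: valP.
Qed.

End Homogenization.

(** * Affine dimension as linear rank minus one *)

Section Dimension.
Variables (R : realType) (n : nat).

Lemma vspace_of_mx k m (B : 'M[R]_(k, m)) :
  exists2 U : {vspace 'rV[R]_m}, \dim U = \rank B & forall u, (u \in U) = (u <= B)%MS.
Proof.
pose C := row_base B; pose X := [tuple row i C | i < \rank B].
have sumX (a : 'I_(\rank B) -> R) : \sum_i a i *: X`_i = (\row_i a i) *m C.
  rewrite mulmx_sum_row; apply: eq_bigr => i _.
  by rewrite -tnth_nth tnth_mktuple mxE.
have freeX : free X.
  apply/freeP=> a; rewrite sumX => aC i.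
  have : \row_i a i == 0 by rewrite -(mulmx_free_eq0 _ (row_base_free B)) -/C aC.
  by move/eqP/rowP/(_ i); rewrite !mxE.
exists <<X>>%VS; first by move: freeX; rewrite /free size_tuple => /eqP.
move=> u; apply/idP/idP=> [/coord_span ->|].
  by rewrite sumX -(eq_row_base B) submxMl.
rewrite -(eq_row_base B) => /submxP[D ->]; rewrite -/C.
have -> : D *m C = \sum_i D 0 i *: X`_i.
  by rewrite sumX; congr (_ *m _); apply/rowP=> i; rewrite mxE.
by apply: memv_suml => i _; rewrite memvZ // memv_span // mem_nth // size_tuple.
Qed.

Variables (I : finType) (q : I -> 'rV[R]_n).
Implicit Types A : {set I}.
Notation p := (@homog R n \o q).

Lemma sp_comb A (y : 'rV[R]_(1 + n)) : (y <= sp p A)%MS ->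
  exists2 a : I -> R, forall v, v \notin A -> a v = 0 & y = \sum_v a v *: p v.
Proof.
case/sub_sumsmxP=> u ->.
have /choice[a aP] v : exists b, u v *m (<<p v>>)%MS = b *: p v.
  have /sub_rVP[b ->] : (u v *m (<<p v>>)%MS <= p v)%MS by rewrite -(genmxE (p v)) submxMl.
  by exists b.
exists (fun v => if v \in A then a v else 0) => [v /negPf-> //|].
rewrite big_mkcond; apply: eq_bigr => v _; case: ifP => _; first exact: aP.
by rewrite scale0r.
Qed.

Lemma aff_hull_hull A x : aff_hull (hull q A) x <-> (homog x <= sp p A)%MS.
Proof.
split=> [[m [a [v [vA sa ->]]]]|/sp_comb[a aA /homog_comb[sa ->]]].
  have -> : homog (\sum_i a i *: v i) = \sum_i a i *: homog (v i) by apply/homog_comb.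
  apply: summx_sub => i _; rewrite scalemx_sub //.
  by apply: conic_sp; apply/hullP; apply: vA.
exists #|A|, (fun i => a (enum_val i)), (fun i => q (enum_val i)); split=> //.
- by move=> i; apply: hull_gen; apply: enum_valP.
- rewrite -(big_enum_val (fun v => a v)) -sa [RHS](bigID (mem A)) /=.
  by rewrite [X in _ = _ + X]big1 ?addr0.
- rewrite -(big_enum_val (fun v => a v *: q v)) [LHS](bigID (mem A)) /=.
  by rewrite [X in _ + X]big1 ?addr0 // => v /aA ->; rewrite scale0r.
Qed.

(** [hone] maps the span onto a line, and its kernel there consists of the directions [(0, u)] of
    the affine hull. *)
Lemma rank_directions A v : v \in A ->
  \rank (sp p A) = (\rank (rsubmx (sp p A :&: kermx (hone R n))%MS)).+1 /\
  forall u : 'rV[R]_n, (row_mx (0 : 'M_1) u <= sp p A)%MS = (u <= rsubmx (sp p A :&: kermx (hone R n))%MS)%MS.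
Proof.
move=> vA; set K := (_ :&: _)%MS.
have K0 : lsubmx K = 0.
  have : K *m hone R n = 0 by apply/sub_kermxP; apply: capmxSr.
  by rewrite -{1}[K]hsubmxK mul_row_col mulmx1 mulmx0 addr0.
have KE : K = row_mx 0 (rsubmx K) by rewrite -{1}[K]hsubmxK K0.
split.
  have := mxrank_mul_ker (sp p A) (hone R n); rewrite -/K.
  have -> : \rank (sp p A *m hone R n) = 1%N.
    apply/eqP; rewrite eqn_leq rank_leq_col /= lt0n mxrank_eq0.
    apply/eqP=> E; have : (p v <= kermx (hone R n))%MS.
      by apply: submx_trans (p_sp p vA) _; apply/sub_kermxP.
    by rewrite sub_ker_ev /= ev_hone_homog oner_eq0.
  by rewrite add1n => <-; rewrite KE rank_row_0mx row_mxKr.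
move=> u; have -> : (row_mx (0 : 'M_1) u <= sp p A)%MS = (row_mx (0 : 'M_1) u <= K)%MS.
  by rewrite sub_capmx sub_ker_ev ev_hone mxE eqxx andbT.
rewrite {1}KE; apply/submxP/submxP=> -[D].
  by rewrite mul_mx_row mulmx0 => /eq_row_mx[_ ->]; exists D.
by move=> ->; exists D; rewrite mul_mx_row mulmx0.
Qed.

Lemma homog_direction A (x u : 'rV[R]_n) : (homog x <= sp p A)%MS ->
  (homog (u + x) <= sp p A)%MS = (row_mx (0 : 'M_1) u <= sp p A)%MS.
Proof.
have -> : homog (u + x) = row_mx 0 u + homog x by rewrite /homog add_row_mx add0r.
move=> xA; apply/idP/idP=> H; last exact: addmx_sub.
by rewrite -[row_mx 0 u](addrK (homog x)) addmx_sub // eqmx_opp.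
Qed.

Lemma has_dim_rank A k : has_dim (hull q A) k -> \rank (sp p A) = k.+1.
Proof.
case=> x0 [U [dU E]].
have inE x : (homog x <= sp p A)%MS = (x - x0 \in U).
  by apply/idP/idP=> [/aff_hull_hull|H]; [rewrite E|apply/aff_hull_hull; rewrite E].
have x0A : (homog x0 <= sp p A)%MS by rewrite inE subrr mem0v.
have [v vA] : exists v, v \in A.
  have [A0|[v vA]] := set_0Vmem A; last by exists v.
  have [a aA /homog_comb[]] := sp_comb x0A; rewrite big1 => [/eqP|v _]; last by rewrite aA ?A0 ?finset.inE.
  by rewrite eq_sym oner_eq0.
have [rk dirE] := rank_directions vA; rewrite rk -dU; congr _.+1.
have [W <- WE] := vspace_of_mx (rsubmx (sp p A :&: kermx (hone R n))%MS).
congr (\dim _); apply/vspaceP=> u.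
by rewrite WE -dirE -(homog_direction _ x0A) inE addrK.
Qed.

Lemma rank_has_dim A k v : v \in A -> \rank (sp p A) = k.+1 -> has_dim (hull q A) k.
Proof.
move=> vA; have [-> dirE] := rank_directions vA; move=> [rk].
have [W dW WE] := vspace_of_mx (rsubmx (sp p A :&: kermx (hone R n))%MS).
exists (q v), W; split; first by rewrite dW.
apply/seteqP; split=> x /=; rewrite aff_hull_hull WE -dirE -(homog_direction _ (p_sp p vA)) subrK //.
Qed.

End Dimension.

(** * Faces of a polytope and their vertex sets *)

Section PolytopeFaces.
Variables (R : realType) (n : nat) (P : set 'rV[R]_n).
Hypothesis polyP : polytope P.
Notation T := (vertices P : finType).
Notation q := (val : T -> 'rV[R]_n).
Notation p := (@homog R n \o q).
Implicit Types (A B S : {set T}) (F G : set 'rV[R]_n).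

Lemma P_hull : P = hull q [set: T]%SET.
Proof. by case: (polytope_vertices polyP). Qed.

Lemma p_inj : injective p.
Proof. by move=> u v /homog_inj/val_inj. Qed.

Lemma lface_mem A v : lface p A -> hull q A (val v) <-> v \in A.
Proof.
case=> d dA; split; last exact: hull_gen.
move/hullP/(conic_ev0 (d := d)) => H; case: (dA) => _ ->.
rewrite zerosP inE /=; apply/eqP; apply: H => u uA.
exact: (exposes_eq0 dA uA).
Qed.

Lemma lface_face A : lface p A -> face P (hull q A).
Proof. by case=> d [d0 ->]; rewrite {1}P_hull; apply: hull_face. Qed.

Lemma face_lface F : face P F -> exists2 A, lface p A & F = hull q A.
Proof.
rewrite {1}P_hull => /face_hull[d d0 ->]; exists (zeros p d [set: T]%SET) => //.
by exists d.
Qed.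

Lemma lface1 v : lface p [set v]%SET.
Proof.
have [_ _ /(_ v)/face_lface[A lA E]] := polytope_vertices polyP.
suff -> : [set v]%SET = A by [].
apply/setP=> u; rewrite finset.in_set1; apply/eqP/idP=> [->|uA].
  by apply/(lface_mem v lA); rewrite -E.
by have /(lface_mem u lA) := uA; rewrite -E => /val_inj.
Qed.

Lemma lface_subface A G : lface p A -> face (hull q A) G ->
  exists B, [/\ lface p B, B \subset A & G = hull q B].
Proof.
move=> lA /face_hull[d d0 ->]; exists (zeros p d A); split=> //.
  exact: lface_zeros.
by apply/fintype.subsetP=> v; rewrite zerosP => /andP[].
Qed.

Lemma subface_lface A B : lface p A -> lface p B -> B \subset A -> face (hull q A) (hull q B).
Proof.
move=> lA [d dB] sBA; have -> : B = zeros p d A.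
  apply/setP=> v; rewrite zerosP; case: dB => _ BE; rewrite {1}BE zerosP inE.
  by case: (boolP (v \in A)) => //= vA; apply/negbTE; apply: contra vA => H;
    apply: (fintype.subsetP sBA); rewrite BE zerosP inE.
by apply: hull_face => v _; apply: exposes_ge0 dB.
Qed.

(** An edge has rank 2, so a third vertex on it would give a dependence. A functional exposing one
    of the three vertices shows that the other two coefficients have opposite signs, and three
    pairwise opposite signs vanish. *)
Lemma adj_lface u v : adj P u v <-> u != v /\ lface p [set u; v]%SET.
Proof.
have rk1 w : (\rank (p w) <= 1)%N by apply: rank_leq_row.
split=> [/andP[nuv /asboolP[E [/face_lface[A lA ->] dE] [uE vE]]]|[nuv luv]].
  split=> //; have rA := has_dim_rank dE.
  have uA := (lface_mem u lA).1 uE; have vA := (lface_mem v lA).1 vE.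
  suff -> : [set u; v]%SET = A by [].
  apply/eqP; rewrite finset.eqEsubset; apply/andP; split.
    by apply/fintype.subsetP=> w; rewrite !inE => /orP[]/eqP->.
  apply/fintype.subsetP=> w wA; apply: contraT; rewrite !inE negb_or => /andP[nwu nwv].
  pose y (i : 'I_3) := nth 0 [:: p u; p v; p w] i.
  have yA i : (y i <= sp p A)%MS.
    by case: i => [[|[|[|i]]] //= lti]; rewrite /y /=; apply: (p_sp p).
  have [|t [i ti]] := dependent yA; first by rewrite rA.
  rewrite !big_ord_recl big_ord0 addr0 /y /= => Et.
  have Eg g : t ord0 * ev g (p u) + (t (lift ord0 ord0) * ev g (p v) +
      t (lift ord0 (lift ord0 ord0)) * ev g (p w)) = 0.
    by have := congr1 (ev g) Et; rewrite !evD !evZ ev0.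
  have sgE x y' z s s' : x != y' -> x != z ->
      (forall g, ev g (p x) = 0 -> s * ev g (p y') + s' * ev g (p z) = 0) -> Num.sg s' = - Num.sg s.
    move=> nxy nxz H; have [g gx] := lface1 x.
    by apply: opposite_sg (H g (exposes_eq0 gx (set11 x))); apply: (exposes_gt0 gx);
      rewrite inE eq_sym.
  have S1 : Num.sg (t (lift ord0 (lift ord0 ord0))) = - Num.sg (t (lift ord0 ord0)).
    apply: (sgE u v w); rewrite // 1?eq_sym // => g gu.
    by have := Eg g; rewrite gu mulr0 add0r.
  have S2 : Num.sg (t (lift ord0 (lift ord0 ord0))) = - Num.sg (t ord0).
    apply: (sgE v u w); rewrite // 1?eq_sym // => g gu.
    by have := Eg g; rewrite gu mulr0 add0r.
  have S3 : Num.sg (t (lift ord0 ord0)) = - Num.sg (t ord0).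
    apply: (sgE w u v); rewrite // 1?eq_sym // => g gu.
    by have := Eg g; rewrite gu mulr0 addr0.
  have s0 : Num.sg (t ord0) = 0 by move: S1 S2 S3; lra.
  have t0 : t ord0 = 0 by apply/eqP; rewrite -sgr_eq0 s0.
  have t1 : t (lift ord0 ord0) = 0 by apply/eqP; rewrite -sgr_eq0 S3 s0 oppr0.
  have t2 : t (lift ord0 (lift ord0 ord0)) = 0 by apply/eqP; rewrite -sgr_eq0 S2 s0 oppr0.
  case/eqP: ti; move: i => [[|[|[|i]]] //= ilt].
  - by rewrite -t0; congr t; apply: val_inj.
  - by rewrite -t1; congr t; apply: val_inj.
  - by rewrite -t2; congr t; apply: val_inj.
rewrite /adj nuv; apply/asboolP; exists (hull q [set u; v]%SET); last first.
  by split; apply: hull_gen; rewrite !inE eqxx ?orbT.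
split; first exact: lface_face.
apply: (@rank_has_dim _ _ _ _ _ _ u); first by rewrite !inE eqxx.
apply/eqP; rewrite eqn_leq; apply/andP; split.
  have sub : (sp p [set u; v]%SET <= p u + p v)%MS.
    apply/sp_subP=> w; rewrite !inE => /orP[]/eqP->; [exact: addsmxSl|exact: addsmxSr].
  apply: leq_trans (mxrankS sub) _; apply: leq_trans (mxrank_adds_leqif _ _) _.
  exact: (leq_add (rk1 u) (rk1 v)).
have [g gu] := lface1 u.
have lt : (p u < sp p [set u; v]%SET)%MS.
  rewrite ltmxE p_sp ?inE ?eqxx //=; apply/negP=> sub.
  have : (p v <= p u)%MS by apply: submx_trans sub; apply: p_sp; rewrite !inE eqxx orbT.
  have ku : (p u <= kermx g)%MS by rewrite sub_ker_ev (exposes_eq0 gu) ?inE.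
  move/(ev_sub0 ku); have := exposes_gt0 gu (_ : v \notin [set u]%SET).
  by rewrite inE eq_sym => /(_ nuv) gt0 g0; rewrite g0 ltxx in gt0.
apply: leq_ltn_trans (rank_ltmx lt); rewrite lt0n mxrank_eq0; apply/eqP=> pu0.
have := ev_hone_homog (val u); rewrite (_ : homog (val u) = 0) // ev0 => /eqP.
by rewrite eq_sym oner_eq0.
Qed.

Lemma rank_sp_le S : (\rank (sp p S) <= #|S|)%N.
Proof.
rewrite /sp -sum1_card; elim/big_rec2: _ => [|v m M _ IH]; first by rewrite mxrank0.
apply: leq_trans (mxrank_adds_leqif _ _) _; apply: leq_add => //.
by rewrite genmxE rank_leq_row.
Qed.

End PolytopeFaces.

(** * Faces of the standard cube *)

Section StandardCube.
Variables (R : realType) (k : nat).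
Notation Q := {ffun 'I_k -> bool}.

Definition cube_vertex (x : Q) : 'rV[R]_k := \row_i (x i)%:R.

Lemma cube_vertex_inj : injective cube_vertex.
Proof.
move=> x y /rowP E; apply/ffunP=> i; have := E i; rewrite !mxE.
by case: (x i); case: (y i) => // /eqP; rewrite ?oner_eq0 // eq_sym oner_eq0.
Qed.

Lemma cube_vertex_in x : std_cube (cube_vertex x).
Proof. by move=> i; rewrite mxE; case: (x i); rewrite ?lexx ler01. Qed.

(** A linear form is maximal at the vertex [e] with a 1 where the coefficient is positive;
    coordinates with coefficient 0 stay free. The point [x0] ensures that [b] is this maximum. *)
Lemma std_cube_face G x0 : face (@std_cube R k) G -> G x0 ->
  exists A e, forall x : Q, G (cube_vertex x) <-> x \in subcube A e.
Proof.
case=> c [b [cP ->]] [x0P /= x0b].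
pose e : Q := [ffun i => 0 < c 0 i].
have le_e x i : 0 <= x 0 i <= 1 -> c 0 i * x 0 i <= c 0 i * (cube_vertex e) 0 i.
  move=> /andP[x0' x1]; rewrite mxE ffunE; have [c0|c0] := ltP 0 (c 0 i).
    by rewrite ler_pM2l.
  by rewrite mulr0 mulr_le0_ge0.
have be : \sum_i c 0 i * (cube_vertex e) 0 i = b.
  apply/eqP; rewrite eq_le cP /=; last exact: cube_vertex_in.
  by rewrite -x0b; apply: ler_sum => i _; apply: le_e.
exists [set i | c 0 i == 0]%SET, e => x; split=> [[_ /= xb]|/subcubeP xe].
  have : \sum_i (c 0 i * (cube_vertex e) 0 i - c 0 i * (cube_vertex x) 0 i) == 0.
    by rewrite sumrB be xb subrr.
  rewrite psumr_eq0 => [/allP H|i _]; last by rewrite subr_ge0 le_e //; apply: cube_vertex_in.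
  apply/subcubeP=> i; rewrite inE => ci; have := H i (mem_index_enum i).
  rewrite -mulrBr mulf_eq0 (negPf ci) subr_eq0 !mxE => /eqP.
  by case: (e i); case: (x i) => // /eqP; rewrite ?oner_eq0 // eq_sym oner_eq0.
split; first exact: cube_vertex_in.
rewrite /= -be; apply: eq_bigr => i _; rewrite !mxE.
by have [->|ci] := eqVneq (c 0 i) 0; rewrite ?mul0r // xe // inE.
Qed.

Lemma subcube_face A (e : Q) :
  exists2 G, face (@std_cube R k) G & forall x : Q, G (cube_vertex x) <-> x \in subcube A e.
Proof.
pose c : 'rV[R]_k := \row_i (if i \in A then 0 else if e i then 1 else -1).
pose b := \sum_i c 0 i * (cube_vertex e) 0 i.
have le_e x i : 0 <= x 0 i <= 1 -> c 0 i * x 0 i <= c 0 i * (cube_vertex e) 0 i.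
  move=> /andP[x0 x1]; rewrite !mxE; case: (i \in A); first by rewrite !mul0r.
  by case: (e i); rewrite ?mul1r ?mulN1r ?oppr0 ?mulr0 ?oppr_le0.
exists (@std_cube R k `&` [set x | \sum_i c 0 i * x 0 i = b])%classic.
  by exists c, b; split=> // x xP; apply: ler_sum => i _; apply: le_e.
move=> x; split=> [[_ /= xb]|/subcubeP xe].
  have : \sum_i (c 0 i * (cube_vertex e) 0 i - c 0 i * (cube_vertex x) 0 i) == 0.
    by rewrite sumrB xb subrr.
  rewrite psumr_eq0 => [/allP H|i _]; last by rewrite subr_ge0 le_e //; apply: cube_vertex_in.
  apply/subcubeP=> i iA; have := H i (mem_index_enum i).
  rewrite !mxE (negPf iA); case: (e i); case: (x i) => //=.
    by rewrite mulr0 mulr1 subr0 oner_eq0.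
  by rewrite mulr0 mulr1 sub0r opprK oner_eq0.
split; first exact: cube_vertex_in.
rewrite /=; apply: eq_bigr => i _; rewrite !mxE.
by case: (boolP (i \in A)) => iA; rewrite ?mul0r // xe.
Qed.

Lemma vertex_face (x : Q) : face (@std_cube R k) [set cube_vertex x]%classic.
Proof.
pose c : 'rV[R]_k := \row_i (if x i then 1 else -1).
have le_x (y : 'rV[R]_k) i : 0 <= y 0 i <= 1 -> c 0 i * y 0 i <= c 0 i * (cube_vertex x) 0 i.
  move=> /andP[y0 y1]; rewrite !mxE.
  by case: (x i); rewrite ?mul1r ?mulN1r ?oppr0 ?mulr0 ?oppr_le0.
exists c, (\sum_i c 0 i * (cube_vertex x) 0 i); split=> [y yP|].
  by apply: ler_sum => i _; apply: le_x.
apply/seteqP; split=> [_ ->|y [yP /= yb]]; first by split=> //; apply: cube_vertex_in.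
have : \sum_i (c 0 i * (cube_vertex x) 0 i - c 0 i * y 0 i) == 0 by rewrite sumrB yb subrr.
rewrite psumr_eq0 => [/allP H|i _]; last by rewrite subr_ge0 le_x //; apply: yP.
apply/rowP=> i; have := H i (mem_index_enum i); rewrite -mulrBr mulf_eq0 subr_eq0.
case/orP=> /eqP // ci; move: ci; rewrite mxE; case: (x i) => /eqP.
  by rewrite oner_eq0.
by rewrite oppr_eq0 oner_eq0.
Qed.

Lemma face0 n (P : set 'rV[R]_n) : face P set0%classic.
Proof.
exists 0, 1; have E (x : 'rV[R]_n) : \sum_i (0 : 'rV[R]_n) 0 i * x 0 i = 0.
  by rewrite big1 // => i _; rewrite mxE mul0r.
split=> [x _|]; first by rewrite E ler01.
apply/seteqP; split=> // x [_ /=]; rewrite E => /eqP.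
by rewrite eq_sym oner_eq0.
Qed.

End StandardCube.

(** * Cubical polytopes give cubical lattices *)

Section CubicalPolytope.
Variables (R : realType) (n : nat) (P : set 'rV[R]_n).
Hypothesis polyP : polytope P.
Notation T := (vertices P : finType).
Notation q := (val : T -> 'rV[R]_n).
Notation p := (@homog R n \o q).

Lemma lface_set0 : lface p finset.set0.
Proof.
exists (hone R n); apply: exposesP => v; rewrite /= ev_hone_homog ?ler01 //.
by rewrite inE oner_eq0.
Qed.

Lemma hull_nonempty (A : {set T}) x : hull q A x -> exists v, v \in A.
Proof.
have [->|[v vA _]] := set_0Vmem A; last by exists v.
case/hullP=> a [_ aA /homog_comb[]]; rewrite big1 => [/eqP|v _]; last by rewrite aA ?inE.
by rewrite eq_sym oner_eq0.
Qed.

(** The isomorphism [f] concerns faces, not points, so labels are read off from one-vertex faces.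
    Membership of a vertex in a face becomes inclusion of faces, which [f] respects. *)
Lemma cube_has_label k (A : {set T}) : lface p A -> is_cube k (hull q A) ->
  exists phi : T -> {ffun 'I_k -> bool}, cube_label (lface p) A phi.
Proof.
move=> lA [_ [f [[ffun finj fsurj] fmono]]].
have fA v : v \in A -> face (hull q A) [set q v]%classic.
  by move=> vA; rewrite -hull1; apply: subface_lface => //; [apply: lface1|rewrite finset.sub1set].
have f0 : f set0 = set0.
  have [G fG Gf0] := fsurj set0 (face0 (@std_cube R k)).
  have := (fmono set0 G (face0 _) fG).1 (@sub0set _ _); rewrite Gf0.
  by rewrite classical_sets.subset0.
have surjE G : face (@std_cube R k) G -> exists2 B, [/\ lface p B & B \subset A] & f (hull q B) = G.
  move=> fG; have [G' fG' <-] := fsurj G fG.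
  by have [B [lB sBA ->]] := lface_subface lA fG'; exists B.
have hullf (B : {set T}) : lface p B -> B \subset A -> face (hull q A) (hull q B).
  by move=> lB sBA; apply: subface_lface.
have memf (B : {set T}) v : lface p B -> B \subset A -> v \in A ->
    v \in B <-> (f [set q v] `<=` f (hull q B))%classic.
  move=> lB sBA vA; rewrite -(fmono _ _ (fA v vA) (hullf B lB sBA)) -(lface_mem v lB).
  by split=> [? _ -> //|]; apply.
(* The preimage of the one-point face at [e] has a vertex [v], whose image is a nonempty face inside
   that point. *)
have vtx (e : {ffun 'I_k -> bool}) : exists2 v, v \in A & f [set q v]%classic = [set cube_vertex R e]%classic.
  have [B [lB sBA] fB] := surjE _ (vertex_face R e).
  have [v vB] : exists v, v \in B.
    have [B0|[v vB]] := set_0Vmem B; last by exists v.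
    have hB0 : hull q B = set0.
      by apply/seteqP; split=> // x; rewrite B0 => /hull_nonempty[v]; rewrite inE.
    by move: fB; rewrite hB0 f0 => /esym/seteqP[/(_ (cube_vertex R e) erefl)].
  have vA := fintype.subsetP sBA v vB; exists v => //.
  have sub := (memf B v lB sBA vA).1 vB; rewrite fB in sub.
  apply/seteqP; split=> // x ->.
  have nv : f [set q v]%classic <> set0.
    move=> fv0; have : [set q v]%classic = set0.
      by apply: finj; rewrite ?inE ?fv0 ?f0 //; [apply: fA|apply: face0].
    by move/seteqP=> [/(_ (q v) erefl)].
  have [y fy] : exists y, f [set q v]%classic y.
    by apply: contrapT => /forallNP H; apply: nv; apply/seteqP; split=> // y /H.
  by have := sub y fy => /= <-.
(* Conversely, the image of the face at [v] is nonempty, so it contains a cube vertex [e]. By [vtx]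
   this comes from some [u], which then lies in [[set v]]. *)
have /choice[phi phiP] v : exists e, v \in A -> f [set q v]%classic = [set cube_vertex R e]%classic.
  have [vA|_] := boolP (v \in A); last by exists [ffun=> false].
  have fv := fA v vA.
  have [x fx] : exists x, f [set q v]%classic x.
    apply: contrapT => /forallNP H; have fv0 : f [set q v]%classic = set0.
      by apply/seteqP; split=> // y /H.
    have : [set q v]%classic = set0.
      by apply: finj; rewrite ?inE ?fv0 ?f0 //; apply: face0.
    by move/seteqP=> [/(_ (q v) erefl)].
  have [B [e eP]] := std_cube_face (ffun _ fv) fx.
  exists e => _; have [u uA fu] := vtx e.
  suff -> : v = u by [].
  have : u \in [set v]%SET.
    apply/(memf [set v]%SET u (lface1 polyP v)) => //; first by rewrite finset.sub1set.
    by rewrite hull1 fu => _ ->; apply/eP; apply: subcube_refl.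
  by rewrite inE => /eqP.
have phi_inj : {in A &, injective phi}.
  move=> u v uA vA E; have : u \in [set v]%SET; last by rewrite inE => /eqP.
  apply/(memf [set v]%SET u (lface1 polyP v)) => //; first by rewrite finset.sub1set.
  by rewrite hull1 !phiP // E.
have inB (B : {set T}) v : lface p B -> B \subset A -> v \in A ->
    v \in B <-> f (hull q B) (cube_vertex R (phi v)).
  by move=> lB sBA vA; rewrite (memf B v lB sBA vA) phiP //; split=> [|? _ -> //]; apply.
exists phi; split=> // [e|S sSA].
  have [v vA fv] := vtx e; exists v => //; apply: (@cube_vertex_inj R).
  by have := phiP v vA; rewrite fv => /seteqP[/(_ (cube_vertex R e) erefl)] /= ->.
split=> [lS|[->|[B [e ->]]]]; last first.
- have [G fG eG] := subcube_face R B e; have [C [lC sCA] fC] := surjE G fG.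
  suff -> : A :&: phi @^-1: subcube B e = C by [].
  apply/setP=> v; rewrite finset.in_setI in_preimset.
  apply/andP/idP=> [[vA /eG]|vC]; first by rewrite -fC => /(inB C v lC sCA vA).
  have vA := fintype.subsetP sCA v vC; split=> //.
  by apply/eG; rewrite -fC; apply/(inB C v lC sCA vA).
- exact: lface_set0.
have [->|[v vS]] := set_0Vmem S; first by left.
right; have vA := fintype.subsetP sSA v vS.
have [B [e eP]] := std_cube_face (ffun _ (hullf S lS sSA)) ((inB S v lS sSA vA).1 vS).
exists B, e; apply/setP=> u; rewrite finset.in_setI in_preimset.
apply/idP/andP=> [uS|[uA /eP]]; last by move/(inB S u lS sSA uA).
by have uA := fintype.subsetP sSA u uS; split=> //; apply/eP/(inB S u lS sSA uA).
Qed.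

Variable d : nat.
Hypothesis d_ge3 : (2 < d)%N.
Hypothesis cubP : cubical_polytope d P.

Lemma rank_vertices : \rank (sp p [set: T]%SET) = d.+1.
Proof.
by case: cubP => _ dP _; apply: has_dim_rank; rewrite -(P_hull polyP).
Qed.

Lemma cubical_polytope_lattice : cubical_lattice d.-1 (adj P) (lface p) (lfacet p).
Proof.
split.
- exact: adj_lface.
- exact: lface_I.
- exact: lface1.
- move=> F [lF rF]; apply: cube_has_label => //; case: cubP => _ _; apply.
  have rFd : \rank (sp p F) = d.-1.+1.
    by rewrite prednK ?(leq_trans _ d_ge3) //; move: rF; rewrite rank_vertices => -[].
  have [v vF] : exists v, v \in F.
    have [F0|[v vF]] := set_0Vmem F; last by exists v.
    by have := rank_sp_le F; rewrite F0 cards0 -F0 rFd.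
  by split; [apply: lface_face|apply: (rank_has_dim vF rFd)].
- by move=> F [].
- exact: lfacet_max.
- move=> S lS cS; apply: face_in_facet => //; rewrite rank_vertices.
  apply: leq_ltn_trans (rank_sp_le S) _; apply: leq_ltn_trans cS _.
  exact: ltnW.
- exact: facet_cross.
- move=> A C G0 lG0 AG0 CG0 step G lG AG.
  exact: (dual_connected lG AG lG0 AG0 CG0 step).
Qed.

Lemma exists_vertex_degree_le3 : d = 3%N -> T -> exists v : T, (#|neighbours (adj P) v| <= 3)%N.
Proof.
move=> d3 v0; have str := cubical_polytope_lattice; have rk := rank_vertices.
rewrite d3 in str rk; have [c c_inj] := injective_functional (@p_inj R n P).
have one_p v : ev (hone R n) (p v) = 1 by apply: ev_hone_homog.
apply: (exists_degree_le3 str (h := fun v => ev c (p v))) v0 => [F lF|v].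
  exact: (mixed_facet one_p str rk c_inj lF).
exact: (mixed_vertex one_p str rk c_inj v).
Qed.

End CubicalPolytope.

(** * Components left by the neighbourhood of a vertex *)

Section Separators.
Variables (T : finType) (e : rel T).
Hypothesis e_sym : symmetric e.

Lemma connected_delE (X : {set T}) : connected_del e X <-> linked e (~: X)%SET.
Proof.
have E : connect (del e X) =2 connect (within e (~: X)%SET).
  by apply: eq_connect => u v; rewrite /within /del /= !inE.
by split=> H u v; have := H u v; rewrite E ?inE.
Qed.

Lemma connect_isolated (X : {set T}) w u : X = neighbours e w -> connect (del e X) w u -> u = w.
Proof.
move=> XE /connectP[[|v s] /=]; first by [].
by case/andP=> /and3P[_ + wv]; rewrite XE inE wv.
Qed.

(** What is left besides [w] is linked, and nonempty because otherwise [X] would not separate. *)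
Lemma components_corner (X : {set T}) w : w \notin X -> X = neighbours e w ->
    linked e (~: X :\ w)%SET -> ~ connected_del e X ->
  #|components e X| = 2%N /\ [set w]%SET \in components e X.
Proof.
move=> wX XE lw nc.
have delC : symmetric (del e X) by move=> u v; rewrite /del e_sym andbCA.
have [x xD] : exists x, x \in (~: X :\ w)%SET.
  apply: contrapT => /forallNP H; apply: nc => u v uX vX.
  have eqw z : z \notin X -> z = w.
    by move=> zX; apply/eqP; apply: contrapT => /negP zw; apply: (H z); rewrite !inE zw.
  by rewrite (eqw u uX) (eqw v vX) connect0.
have classw : [set y in (~: X)%SET | connect (del e X) w y] = [set w]%SET.
  apply/setP=> y; rewrite !inE; apply/andP/eqP=> [[_ /(connect_isolated XE)]//|->].
  by rewrite wX connect0.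
have classx y : y \in (~: X :\ w)%SET ->
    [set z in (~: X)%SET | connect (del e X) y z] = (~: X :\ w)%SET.
  move=> yD; apply/setP=> z; rewrite !inE andbC; case: (boolP (z \in X)); rewrite ?andbF ?andbT //= => zX.
  have [->|nzw] := eqVneq z w; last first.
    have zD : z \in (~: X :\ w)%SET by rewrite !inE nzw.
    have := lw y z yD zD; apply: connect_sub => a b /and3P[].
    rewrite !inE => /andP[_ aX] /andP[_ bX] ab.
    by apply: connect1; rewrite /del aX bX.
  rewrite (sym_connect_sym delC); apply/negbTE/negP=> /(connect_isolated XE) yw.
  by move: yD; rewrite yw !inE eqxx.
have compE : components e X = [set [set w]; ~: X :\ w]%SET.
  apply/setP=> B; apply/imsetP/set2P=> [[y]|[->|->]].
  - rewrite inE => yX ->; have [->|nyw] := eqVneq y w; first by left.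
    by right; apply: classx; rewrite !inE nyw.
  - by exists w; rewrite ?inE.
  - by exists x; rewrite ?classx //; move: xD; rewrite !inE => /andP[].
rewrite compE set21 cards2; split=> //.
suff -> : [set w]%SET != (~: X :\ w)%SET by [].
by apply/eqP=> /setP/(_ w); rewrite !inE eqxx.
Qed.

End Separators.

Theorem theorem19 (R : realType) (d : nat) (hd : (3 <= d)%N) :
  (forall (n : nat) (P : set 'rV[R]_n) (delta : nat),
     cubical_polytope d P ->
     is_min_degree (adj P) delta ->
     k_connected (adj P) (minn delta (2 * d - 2)))
  /\
  ((4 <= d)%N ->
   forall (n : nat) (P : set 'rV[R]_n) (X : {set vertices P}),
     cubical_polytope d P ->
     min_separator (adj P) X ->
     (#|X| <= 2 * d - 3)%N ->
     exists w : vertices P,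
       [/\ X = neighbours (adj P) w,
           #|components (adj P) X| = 2
         & [set w]%SET \in components (adj P) X]).
Proof.
have d_gt0 : (0 < d)%N := leq_trans (isT : (0 < 3)%N) hd.
have k_gt1 : (1 < d.-1)%N by rewrite -ltnS prednK.
split=> [n P delta cubP [[v0 deg0] degP]|d4 n P X cubP [sepX minX] lX].
  have polyP : polytope P by case: cubP.
  have str := cubical_polytope_lattice polyP hd cubP.
  split.
    apply: leq_ltn_trans (geq_minl _ _) _; rewrite -deg0 -cardsT; apply: proper_card.
    rewrite properT; apply/eqP=> /setP/(_ v0); rewrite !inE.
    by case/(cl_adjE str); rewrite eqxx.
  move=> X; rewrite leq_min => /andP[lXd lX2]; apply/connected_delE.
  have [d3|d4] := leqP d 3.
    have ed : d = 3%N by apply/eqP; rewrite eqn_leq d3.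
    have [v v3] := exists_vertex_degree_le3 polyP hd cubP ed v0.
    apply: (small_linked str k_gt1); first by rewrite ed.
    (* The vertex of degree at most 3 bounds [delta], so [#|X| < 3]. *)
    by rewrite -ltnS; apply: leq_trans lXd (leq_trans (degP v) v3).
  apply: contrapT => nl; have [||v|w [_ XE _]] := separator_corner str k_gt1 _ _ _ nl.
  - by rewrite -ltnS prednK.
  - by move: lX2 hd; clear; lia.
  - exact: leq_trans (ltnW lXd) (degP v).
  (* [X] would be a neighbourhood, which has at least [delta] vertices. *)
  - by move: lXd; rewrite ltnNge XE degP.
have polyP : polytope P by case: cubP.
have str := cubical_polytope_lattice polyP hd cubP.
have nl : ~ linked (adj P) (~: X)%SET by move/connected_delE.
(* Every neighbourhood is a separator, hence no smaller than [X]: a facet at [v] has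
   [2 ^ (d - 1) > d] vertices, so one is neither [v] nor a neighbour of [v]. *)
have degX v : (#|X| <= #|[set u | adj P v u]%SET|)%N.
  apply: minX => conn.
  have [F fF vF] := vertex_in_facet str v; have [phi lab] := cl_label str fF.
  have [u uF] : exists2 u, u \in F & u \notin v |: [set u in F | adj P v u]%SET.
    apply: ex_notin; rewrite (card_facet lab) cardsU1 (facet_nbrs str fF vF).
    have := ltn_expl d.-2 (isT : (1 < 2)%N).
    have -> : (2 ^ d.-1 = 2 * 2 ^ d.-2)%N by rewrite -expnS prednK // ltnW.
    by move: k_gt1; case: (_ \notin _); move: (2 ^ _)%N; clear; lia.
  rewrite !inE uF /= negb_or => /andP[nuv vu].
  have vv : ~~ adj P v v by apply/negP=> /(cl_adjE str)[]; rewrite eqxx.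
  have := conn v u; rewrite !inE vv vu => /(_ isT isT).
  by move/(connect_isolated erefl)/eqP; rewrite (negPf nuv).
have [||w [wX XE lw]] := separator_corner str k_gt1 _ _ degX nl.
- by rewrite -ltnS prednK.
- by move: #|X| lX hd => m; clear; lia.
exists w; have [|] := components_corner (adj_sym str) wX XE lw.
  exact: sepX.
by split.
Qed.
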